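(* Let $\Omega=[0,2\pi]^3$ and let $r>\frac{10}{2}$ be an integer. Suppose the exact periodic solution components ${\bf H},{\bf E}$ of Maxwell's equations $$\partial_t{\bf E}=\tfrac1\epsilon\nabla\times{\bf H},\quad \partial_t{\bf H}=-\tfrac1\mu\nabla\times{\bf E},\quad \nabla\cdot(\epsilon{\bf E})=0,\quad \nabla\cdot(\mu{\bf H})=0$$ satisfy ${\bf H},{\bf E}\in C^7\big(0,T;[H_p^r(\Omega)]^3\big)$, with initial conditions ${\bf H}_0,{\bf E}_0\in[H_p^r(\Omega)]^3$. For $n\ge0$ let ${\bf H}^n,{\bf E}^n$ be the solution of the scheme $$\mu\,\frac{{\bf H}^{n+1}-{\bf H}^n}{\tau}=-\hat{\bf D}\,\frac{{\bf E}^{n+1}+{\bf E}^n}{2},\qquad \epsilon\,\frac{{\bf E}^{n+1}-{\bf E}^n}{\tau}=\hat{\bf D}\,\frac{{\bf H}^{n+1}+{\bf H}^n}{2},$$ started from the grid values ${\bf H}^0={\bf H}(0)$, ${\bf E}^0={\bf E}(0)$. Then for any fixed $T>0$ there exists a positive constant $C$, independent of $\tau,h_x,h_y,h_z$, such that $$\max_{0\le n\le M}\Big(\epsilon\|{\bf H}(t_n)-{\bf H}^n\|_h^2+\mu\|{\bf E}(t_n)-{\bf E}^n\|_h^2\Big)^{1/2}\le CT(\tau^6+N^{-r}).$$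
   Context: $\epsilon,\mu>0$ are constants, $c=1/\sqrt{\epsilon\mu}$. $H_p^r(\Omega)$ is the closure in the Sobolev space $H^r(\Omega)$ of the infinitely differentiable functions on $\Omega$ that are $2\pi$-periodic in all variables; $C^7(0,T;X)$ is the space of $X$-valued functions that are seven times continuously differentiable in time on $[0,T]$. Grid: $N_x=N_y=N_z=N$ is an even positive integer, $h_x=h_y=h_z=2\pi/N$; the grid points are $(x_j,y_k,z_m)$ with $w_j=(j-1)2\pi/N$, $j=1,\dots,N$, $w\in\{x,y,z\}$. $\tau=T/M$ with $M$ a positive integer, $t_n=n\tau$. ${\bf D}_1^w\in\mathbb R^{N\times N}$ is the Fourier spectral first-order differentiation matrix: $({\bf D}_1^w)_{j,l}=\tfrac12(-1)^{j+l}\cot\big(\tfrac{w_j-w_l}{2}\big)$ for $j\ne l$, $({\bf D}_1^w)_{j,j}=0$. Put ${\bf D}_1={\bf I}_N\otimes{\bf I}_N\otimes{\bf D}_1^x$, ${\bf D}_2={\bf I}_N\otimes{\bf D}_1^y\otimes{\bf I}_N$, ${\bf D}_3={\bf D}_1^z\otimes{\bf I}_N\otimes{\bf I}_N$ ($\otimes$ the Kronecker product), acting on grid functions $U_{j,k,m}$ ordered as vectors in $\mathbb R^{N^3}$ with $j$ varying fastest, then $k$, then $m$. Let $${\bf D}=\begin{pmatrix}0&-{\bf D}_3&{\bf D}_2\\ {\bf D}_3&0&-{\bf D}_1\\ -{\bf D}_2&{\bf D}_1&0\end{pmatrix},\qquad \hat{\bf D}={\bf D}+\frac{c^2\tau^2}{12}{\bf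 D}^3+\frac{c^4\tau^4}{120}{\bf D}^5 .$$ ${\bf H}^n,{\bf E}^n\in\mathbb R^{3N^3}$ have component blocks ordered $x,y,z$. In the norms, ${\bf H}(t_n),{\bf E}(t_n)$ denote the vectors of grid values of the exact solution. For a three-component grid function ${\bf U}$, $\|{\bf U}\|_h^2=h_xh_yh_z\sum_{w\in\{x,y,z\}}\sum_{j,k,m}|U_{w_{j,k,m}}|^2$. *)

(* Defs.v *)
From HB Require Import structures.
From mathcomp Require Import all_boot all_order all_algebra.
From mathcomp Require Import all_classical all_reals all_analysis.
From mathcomp Require Export mxtens.

Set Implicit Arguments.
Unset Strict Implicit.
Unset Printing Implicit Defensive.

Import Order.TTheory GRing.Theory Num.Theory.
Import numFieldNormedType.Exports.

Local Open Scope classical_set_scope.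
Local Open Scope ring_scope.

(** * The box [0, 2 pi]^3 and Lebesgue measure on R^3 *)

Notation pt R := (R * R * R)%type.

(* [pt R] with the product sigma-algebra on which [vol] is a measure. *)
Definition mpt (R : realType) : measurableType _ :=
  (measurableTypeR R * measurableTypeR R * measurableTypeR R)%type.

Definition vol (R : realType) : {measure set (mpt R) -> \bar R} :=
  (@lebesgue_measure R \x @lebesgue_measure R \x @lebesgue_measure R)%E.

Definition Omega (R : realType) : set (pt R) :=
  `[0, 2 * pi]%classic `*` `[0, 2 * pi]%classic `*` `[0, 2 * pi]%classic.

Definition Omega_int (R : realType) : set (pt R) :=
  `]0, 2 * pi[%classic `*` `]0, 2 * pi[%classic `*` `]0, 2 * pi[%classic.

(* Coordinates x, y, z are numbered 0, 1, 2 in ['I_3]. *)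
Definition bvec (R : realType) (w : 'I_3) : pt R :=
  ((w == 0)%:R, (w == 1)%:R, (w == 2)%:R).

(** * Smooth functions on R^3 and their partial derivatives *)

Definition partial (R : realType) (w : 'I_3) (f : pt R -> R) : pt R -> R :=
  fun x => 'D_(bvec R w) f x.

(* All iterated partial derivatives, in every order, exist everywhere and are
   continuous. *)
Definition smooth (R : realType) (f : pt R -> R) : Prop :=
  forall s : seq 'I_3,
    let g := foldr (@partial R) f s in
    continuous g /\ forall w x, derivable g x (bvec R w).

Definition periodic2pi (R : realType) (f : pt R -> R) : Prop :=
  forall w x, f (x + (2 * pi) *: bvec R w) = f x.

Definition multi_index := {ffun 'I_3 -> nat}.

Definition mi_size (a : multi_index) : nat := (\sum_(w < 3) a w)%N.

Definition mi0 : multi_index := [ffun => 0%N].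

Definition mi1 (w : 'I_3) : multi_index := [ffun v => (v == w) : nat].

Definition mpartial (R : realType) (a : multi_index) (f : pt R -> R) :
    pt R -> R :=
  iter (a 0) (partial 0) (iter (a 1) (partial 1) (iter (a 2) (partial 2) f)).

(** * The Sobolev space H^r(Omega) *)

Definition L2 (R : realType) (u : pt R -> R) : Prop :=
  measurable_fun (@Omega R : set (mpt R)) (u : mpt R -> R) /\
  (\int[vol R]_(x in @Omega R) ((u x) ^+ 2)%:E < +oo)%E.

Definition test_function (R : realType) (phi : pt R -> R) : Prop :=
  smooth phi /\
  exists K : set (pt R),
    [/\ compact K, K `<=` @Omega_int R & forall x, ~ K x -> phi x = 0].

Definition weak_derivative (R : realType) (a : multi_index)
    (u g : pt R -> R) : Prop :=
  forall phi, test_function phi ->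
    \int[vol R]_(x in @Omega R) (u x * mpartial a phi x) =
    (-1) ^+ mi_size a * \int[vol R]_(x in @Omega R) (g x * phi x).

(* An element [u] of H^r(Omega), being an L^2 class, is handled through a family
   [U] of L^2 representatives of its weak derivatives: [U a] represents D^a u
   for every [a] with |a| <= r, and [U mi0] represents u itself.  The values
   [U a] with |a| > r are irrelevant. *)
Definition jet (R : realType) := multi_index -> pt R -> R.

Definition smooth_jet (R : realType) (f : pt R -> R) : jet R :=
  fun a => mpartial a f.

Definition sobolev (R : realType) (r : nat) (U : jet R) : Prop :=
  forall a, (mi_size a <= r)%N -> L2 (U a) /\ weak_derivative a (U mi0) (U a).

(* (sum_(|a| <= r) ||D^a u||_{L^2}^2)^(1/2); the finite type indexing the sum
   contains every multi-index of size at most r exactly once. *)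
Definition sobolev_norm (R : realType) (r : nat) (U : jet R) : \bar R :=
  ((\sum_(b : {ffun 'I_3 -> 'I_r.+1} | (\sum_(w < 3) b w <= r)%N)
      \int[vol R]_(x in @Omega R) ((U [ffun w => b w : nat] x) ^+ 2)%:E)
   `^ 2^-1)%E.

(** * The periodic space H_p^r(Omega) *)

(* [u] belongs to H_p^r(Omega), the closure in H^r(Omega) of the smooth
   2pi-periodic functions, and [U] represents its weak derivatives. *)
Definition Hp_jet (R : realType) (r : nat) (u : pt R -> R) (U : jet R) : Prop :=
  [/\ {ae vol R, forall x, @Omega R x -> U mi0 x = u x},
      sobolev r U &
      forall e : R, 0 < e ->
        exists phi : pt R -> R,
          [/\ smooth phi, periodic2pi phi &
              (sobolev_norm r (fun a x => U a x - smooth_jet phi a x)%R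
                 < e%:E)%E]].

Definition Hp (R : realType) (r : nat) (u : pt R -> R) : Prop :=
  exists U, Hp_jet r u U.

(* [u] belongs to C^k(0,T; H_p^r(Omega)), time derivatives being limits of
   difference quotients in the H^r norm (one-sided at 0 and T).  [V i t a]
   represents the i-th time derivative at t of D^a u, for i <= k, |a| <= r. *)
Definition Ck_Hp (R : realType) (k r : nat) (T : R) (u : R -> pt R -> R)
    (V : nat -> R -> jet R) : Prop :=
  [/\ forall t, 0 <= t <= T -> Hp_jet r (u t) (V 0%N t),
      forall i t, (i <= k)%N -> 0 <= t <= T -> Hp_jet r (V i t mi0) (V i t),
      forall i t, (i < k)%N -> 0 <= t <= T ->
        sobolev_norm r
          (fun a x => (V i (t + s) a x - V i t a x) / s - V i.+1 t a x)%R
          @[s --> within [set s | 0 <= t + s <= T] (0 : R)^'] --> 0%E &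
      forall t, 0 <= t <= T ->
        sobolev_norm r (fun a x => V k s a x - V k t a x)%R
          @[s --> within [set s | 0 <= s <= T] (nbhs t)] --> 0%E].

(** * Maxwell's equations *)

(* Index arithmetic is modulo 3. *)
Definition curl (R : realType) (F : 'I_3 -> jet R) (w : 'I_3) (x : pt R) : R :=
  F (w + 2) (mi1 (w + 1)) x - F (w + 1) (mi1 (w + 2)) x.

(* [E w] and [H w] are the time derivatives and spatial weak derivatives of the
   w-components of the fields, arranged as in [Ck_Hp]. *)
Definition maxwell (R : realType) (eps mu T : R)
    (E H : 'I_3 -> nat -> R -> jet R) : Prop :=
  forall t, 0 <= t <= T ->
  {ae vol R, forall x, @Omega R x ->
    [/\ forall w, E w 1%N t mi0 x = eps^-1 * curl (fun v => H v 0%N t) w x,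
        forall w, H w 1%N t mi0 x = - mu^-1 * curl (fun v => E v 0%N t) w x,
        \sum_(w < 3) eps * E w 0%N t (mi1 w) x = 0 &
        \sum_(w < 3) mu * H w 0%N t (mi1 w) x = 0]}.

(** * Spatial discretization *)

Definition grid_step (R : realType) (N : nat) : R := 2 * pi / N%:R.

Definition node (R : realType) (N : nat) (j : 'I_N) : R :=
  j%:R * grid_step R N.

Definition D1mx (R : realType) (N : nat) : 'M[R]_N :=
  \matrix_(j, l)
    if j == l then 0
    else let theta := (node R j - node R l) / 2 in
         2^-1 * (-1) ^+ (j + l) * (cos theta / sin theta).

Definition Dx (R : realType) (N : nat) : 'M[R]_(N * N * N) :=
  (1%:M : 'M[R]_N) *t (1%:M : 'M[R]_N) *t D1mx R N.
Definition Dy (R : realType) (N : nat) : 'M[R]_(N * N * N) :=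
  (1%:M : 'M[R]_N) *t D1mx R N *t (1%:M : 'M[R]_N).
Definition Dz (R : realType) (N : nat) : 'M[R]_(N * N * N) :=
  D1mx R N *t (1%:M : 'M[R]_N) *t (1%:M : 'M[R]_N).

Definition vdim (N : nat) : nat := (N * N * N + N * N * N + N * N * N)%N.

Definition Dmx (R : realType) (N : nat) : 'M[R]_(vdim N) :=
  col_mx (col_mx
    (row_mx (row_mx 0         (- Dz R N)) (Dy R N))
    (row_mx (row_mx (Dz R N)  0)          (- Dx R N)))
    (row_mx (row_mx (- Dy R N) (Dx R N))  0).

Definition Dhat (R : realType) (N : nat) (c tau : R) : 'M[R]_(vdim N) :=
  Dmx R N + (c ^+ 2 * tau ^+ 2 / 12) *: Dmx R N ^+ 3
          + (c ^+ 4 * tau ^+ 4 / 120) *: Dmx R N ^+ 5.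

(* The ordering matches the Kronecker products: the x-index varies fastest. *)
Definition grid_point (R : realType) (N : nat) (i : 'I_(N * N * N)) : pt R :=
  let: (mk, j) := mxtens_unindex i in
  let: (m, k) := mxtens_unindex mk in
  (node R j, node R k, node R m).

Definition grid_values (R : realType) (N : nat) (u : pt R -> R) :
    'cV[R]_(N * N * N) := \col_i u (grid_point R i).

Definition grid_field (R : realType) (N : nat) (F : 'I_3 -> pt R -> R) :
    'cV[R]_(vdim N) :=
  col_mx (col_mx (grid_values N (F 0)) (grid_values N (F 1)))
         (grid_values N (F 2)).

Definition normh (R : realType) (N : nat) (U : 'cV[R]_(vdim N)) : R :=
  Num.sqrt (grid_step R N ^+ 3 * \sum_i `|U i 0| ^+ 2).

(** * The scheme *)

Definition scheme (R : realType) (N : nat) (eps mu tau : R)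
    (H E : nat -> 'cV[R]_(vdim N)) : Prop :=
  let Dh := Dhat N (Num.sqrt (eps * mu))^-1 tau in
  forall n,
    mu *: (tau^-1 *: (H n.+1 - H n)) = - (Dh *m (2^-1 *: (E n.+1 + E n))) /\
    eps *: (tau^-1 *: (E n.+1 - E n)) = Dh *m (2^-1 *: (H n.+1 + H n)).

(* Main.v *)
From HB Require Import structures.
Require Import Defs.
From mathcomp Require Import all_boot all_order all_algebra.
From mathcomp Require Import all_classical all_reals all_analysis.
From mathcomp Require Import measurable_realfun zify ring lra.

(** The scheme is a perturbed energy-conserving recursion: the matrix Dhat is
symmetric, because every one-dimensional differentiation matrix is
antisymmetric and a discrete curl is built from them antisymmetrically.  Hence
mu |H|^2 + eps |E|^2 is conserved by the homogeneous scheme, and the square root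
of the energy of the error grows in one step by at most the size of the local
residual ([energy_step]).  Everything else consists in finding a grid function
that is within K N^-r of the exact solution at every grid point and whose
residual is at most 2 K tau^7 entrywise, with K independent of N and tau; summation
over the n <= T / tau steps then gives T (tau^6 + N^-r) up to a constant.

That grid function is the Fourier partial sum of the solution over the
frequencies |k_w| < N / 2, sampled on the grid ([trunc_field]).  It has two
virtues.  First, the differentiation matrix differentiates trigonometric
polynomials of degree less than N / 2 exactly ([D1mx_wave]), and Maxwell's
equations hold coefficient by coefficient ([fcoef_curl_law]); therefore the
truncated solution satisfies the semi-discrete Maxwell system exactly, and there
is no spatial residual at all ([Dmx_trunc_field]).  Replacing each discrete curl
by a time derivative turns Dhat into d_t - tau^2/12 d_t^3 + tau^4/120 d_t^5, the
Taylor polynomial of (2/tau) tanh(tau d_t / 2); with it the trapezoidal rule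
has order six ([consistency]).  Secondly, the truncation error is really of
order N^-r in the maximum norm, although a function in H^r in dimension three
need only have a truncation error of order N^(3/2-r).  The gain comes from the
equations: the two curl laws and the divergence law say that each coefficient
f_k(t) solves f_k'' = - |k|^2 f_k / (eps mu) ([fcoef_wave_law]), so f_k is,
up to a constant, |k|^-6 times its sixth time derivative, which is itself the
coefficient of an H^r function.  Thus f_k = O(|k|^(-r-6)), and the sum of these over |k_w| >= N/2
is O(N^-r) ([fourier_sum_tail]).  The seventh time derivative, whose
coefficients are O(|k|^-r) with r >= 6, has uniformly bounded partial sums
([fourier_sum_bound]); this is what bounds the time residual at the grid points.

Two points need real analysis.  The Fourier coefficients of an element of H_p^r
transform under derivatives as expected because those of smooth periodic
functions do, by Fubini and the fundamental theorem of calculus, and because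
coefficients are continuous in the L^2 norm ([fcoef_jet]).  And the solution is
the pointwise sum of its Fourier series: the partial sums are uniformly Cauchy,
and if their distance to a continuous representative exceeded the tail bound
somewhere, one would test the discrepancy against a high power of the positive
trigonometric polynomial prod_w (1 + cos (y_w - x_w)), whose mass concentrates
at x, and contradict the vanishing of the low coefficients ([inversion]).

Complex exponentials are avoided throughout: a Fourier coefficient carries a
phase th, as the integral of u(y) cos (k.y + th), and differentiation multiplies
it by k_w while shifting th by a quarter turn. *)

Set Implicit Arguments.
Unset Strict Implicit.
Unset Printing Implicit Defensive.
Import Order.TTheory GRing.Theory Num.Theory.
Import numFieldNormedType.Exports.
Local Open Scope classical_set_scope.
Local Open Scope ring_scope.

(** * Measurability of continuous functions on R^3 *)

Section Caratheodory.
Context {R : realType}.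

(** Rounding down to a multiple of 1/(n+1): it takes countably many values, which
is what makes the approximants below measurable. *)
Definition grid_floor (n : nat) (s : R) : R :=
  (Num.floor (n.+1%:R * s))%:~R / n.+1%:R.

Lemma grid_floor_cvg (s : R) : grid_floor ^~ s @ \oo --> s.
Proof.
apply/cvgrPdist_le => /= e e0.
near=> n.
have n0 : (0 : R) < n.+1%:R by rewrite ltr0n.
have -> : s - grid_floor n s =
   (n.+1%:R * s - (Num.floor (n.+1%:R * s))%:~R) / n.+1%:R.
  by rewrite /grid_floor mulrBl mulrAC divff ?mul1r// gt_eqF.
rewrite ger0_norm; last first.
  by rewrite divr_ge0 ?(ltW n0)// subr_ge0; exact: floor_le.
rewrite ler_pdivrMr//.
have h1 : n.+1%:R * s - (Num.floor (n.+1%:R * s))%:~R <= 1 :> R.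
  rewrite lerBlDl ltW//.
  by have := floorD1_gt (n.+1%:R * s); rewrite intrD.
apply: (le_trans h1).
rewrite mulrC -ler_pdivrMr// div1r.
have : e^-1 <= n%:R by near: n; exact: nbhs_infty_ger.
by move/le_trans; apply; rewrite ler_nat.
Unshelve. all: by end_near. Qed.

(** Rounding the second variable to a grid makes the function measurable, since it
is then given by countably many measurable pieces; by continuity in the second
variable these functions converge pointwise to f.  Two applications show
that continuous functions are measurable for the product sigma-algebra of R^3. *)
Lemma measurable_fun_Caratheodory d (X : measurableType d)
    (f : X * measurableTypeR R -> R) :
  (forall s, measurable_fun setT (fun t => f (t, s))) ->
  (forall t, continuous (fun s : R => f (t, s))) ->
  measurable_fun setT f.
Proof.
move=> mf cf.
apply: (@measurable_fun_cvg _ _ _ _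
  (fun n p => f (p.1, grid_floor n p.2))); last first.
  move=> [t s] _ /=.
  by have := cvg_comp _ _ (@grid_floor_cvg s) (cf t s).
move=> n _ A mA; rewrite setTI.
(* The preimage is cut according to the integer that determines the rounded
   value, and each piece is a measurable rectangle. *)
have -> : (fun p : X * measurableTypeR R => f (p.1, grid_floor n p.2)) @^-1` A =
  \bigcup_(m in [set: int])
    ([set t | A (f (t, m%:~R / n.+1%:R))] `*`
     [set s : measurableTypeR R | Num.floor (n.+1%:R * s) = m]).
  apply/seteqP; split => [[t s] /= H | [t s] [m _ [/= H Hm]]]; last by rewrite /grid_floor Hm.
  by exists (Num.floor (n.+1%:R * s)).
apply: countable_bigcupT_measurable => // m.
apply: measurableX.
  by have := mf (m%:~R / n.+1%:R) measurableT A mA; rewrite setTI.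
have -> : [set s : measurableTypeR R | Num.floor (n.+1%:R * s) = m] =
  `[m%:~R / n.+1%:R, (m + 1)%:~R / n.+1%:R[%classic.
  apply/seteqP; split => s /=; rewrite in_itv/= ler_pdivrMr ?ltr_pdivlMr ?ltr0n//
     [s * _]mulrC.
    by move=> <-; exact: floor_itv.
  exact: floor_def.
exact: measurable_itv.
Qed.

Lemma continuous_triple (X : topologicalType) (f g h : X -> R) :
  continuous f -> continuous g -> continuous h ->
  continuous (fun x => (f x, g x, h x)).
Proof.
move=> cf cg ch x.
apply: (@cvg_pair _ _ _ (nbhs x) (nbhs (f x, g x)) (nbhs (h x))); last exact: ch.
by apply: (@cvg_pair _ _ _ (nbhs x) (nbhs (f x)) (nbhs (g x))); [exact: cf|exact: cg].
Qed.

Lemma continuous_compose (X Y Z : topologicalType) (f : X -> Y) (g : Y -> Z) :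
  continuous f -> continuous g -> continuous (fun x => g (f x)).
Proof.
by move=> cf cg x; apply: (@continuous_comp _ _ _ f g); [exact: cf|exact: cg].
Qed.

Lemma continuous_line (f : pt R -> R) (x y z : R) : continuous f ->
  [/\ continuous (fun s => f (s, y, z)), continuous (fun s => f (x, s, z)) &
      continuous (fun s => f (x, y, s))].
Proof.
move=> cf.
have cc c : continuous (fun _ : R => c : R) by move=> ?; exact: cvg_cst.
have ci : continuous (fun s : R => s) by move=> ?; exact: cvg_id.
split.
- exact: continuous_compose (continuous_triple ci (cc y) (cc z)) cf.
- exact: continuous_compose (continuous_triple (cc x) ci (cc z)) cf.
- exact: continuous_compose (continuous_triple (cc x) (cc y) ci) cf.
Qed.

Lemma continuous_measurable_pt (f : pt R -> R) :
  continuous f -> measurable_fun setT (f : mpt R -> R).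
Proof.
move=> cf.
apply: measurable_fun_Caratheodory => [z|[x y]]; last first.
  by have [] := continuous_line x y 0 cf.
apply: (@measurable_fun_Caratheodory _ _ (fun p => f (p, z))) => [y|x]; last first.
  by have [] := continuous_line x 0 z cf.
apply: continuous_measurable_fun.
by have [] := continuous_line 0 y z cf.
Qed.

End Caratheodory.

(** * Fubini's theorem on a triple product *)

Section FubiniVanish.
Local Open Scope ereal_scope.
Context {R : realType} {d1 d2} {T1 : measurableType d1}
  {T2 : measurableType d2}.
Context (m1 : {sigma_finite_measure set T1 -> \bar R}).
Context (m2 : {sigma_finite_measure set T2 -> \bar R}).

Lemma integral_prod_eq0_snd (f : T1 * T2 -> \bar R) :
  (m1 \x m2).-integrable setT f ->
  (forall x, \int[m2]_y f (x, y) = 0) -> \int[m1 \x m2]_z f z = 0.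
Proof.
move=> intf f0; rewrite -integral12_prod_meas1//.
by apply: integral0_eq => x _; exact: f0.
Qed.

Lemma integral_prod_eq0_fst (f : T1 * T2 -> \bar R) :
  (m1 \x m2).-integrable setT f ->
  (forall y, \int[m1]_x f (x, y) = 0) -> \int[m1 \x m2]_z f z = 0.
Proof.
move=> intf f0; rewrite -integral21_prod_meas1//.
by apply: integral0_eq => x _; exact: f0.
Qed.

End FubiniVanish.

Section SigmaFiniteProduct.
Local Open Scope ereal_scope.
Context {R : realType} {d1 d2} {T1 : measurableType d1} {T2 : measurableType d2}.
Context (m1 : {sigma_finite_measure set T1 -> \bar R}).
Context (m2 : {sigma_finite_measure set T2 -> \bar R}).

(** A named copy of the product measure, so that its sigma-finiteness can be
registered and Fubini's theorem iterated. *)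
Definition prod_measure : set (T1 * T2) -> \bar R := m1 \x m2.

HB.instance Definition _ := Measure.on prod_measure.

Let sigma_finite_prod_measure : sigma_finite setT prod_measure.
Proof.
by have [] := lebesgue_integral_fubini.measure_function_Measure_isSigmaFinite__to__measure_function_isSigmaFinite m1 m2.
Qed.

HB.instance Definition _ := Measure_isSigmaFinite.Build _ _ _ prod_measure
  sigma_finite_prod_measure.

End SigmaFiniteProduct.

Section FubiniVanish3.
Local Open Scope ereal_scope.
Context {R : realType} {d1 d2 d3} {T1 : measurableType d1}
  {T2 : measurableType d2} {T3 : measurableType d3}.
Context (m1 : {sigma_finite_measure set T1 -> \bar R}).
Context (m2 : {sigma_finite_measure set T2 -> \bar R}).
Context (m3 : {sigma_finite_measure set T3 -> \bar R}).

(** A triple integral may be computed by integrating first in any one of the three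
variables.  Only the vanishing case is needed: it makes integrals of partial
derivatives of periodic functions vanish. *)
Lemma integral_prod3_eq0 (f : T1 * T2 * T3 -> \bar R) :
  (m1 \x m2 \x m3).-integrable setT f ->
  (forall z, (m1 \x m2).-integrable setT (fun p => f (p, z))) ->
  [\/ forall y z, \int[m1]_x f (x, y, z) = 0,
      forall x z, \int[m2]_y f (x, y, z) = 0 |
      forall x y, \int[m3]_z f (x, y, z) = 0] ->
  \int[m1 \x m2 \x m3]_p f p = 0.
Proof.
move=> intf intfz f0.
suff : \int[prod_measure m1 m2 \x m3]_p f p = 0 by [].
have {}intf : (prod_measure m1 m2 \x m3).-integrable setT f by [].
case: f0 => f0.
- apply: (integral_prod_eq0_fst intf) => z.
  exact: integral_prod_eq0_fst (intfz z) (f0^~ z).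
- apply: (integral_prod_eq0_fst intf) => z.
  exact: integral_prod_eq0_snd (intfz z) (f0^~ z).
- by apply: (integral_prod_eq0_snd intf) => -[x y].
Qed.
End FubiniVanish3.

(** * The box and its volume *)

Section Box.
Context {R : realType}.
Local Notation Om := (@Omega R).
Local Notation mu := (@lebesgue_measure R).

Lemma twopi_gt0 : 0 < 2 * pi :> R.
Proof. by rewrite mulr_gt0// pi_gt0. Qed.

Definition Omega2 : set (R * R) :=
  `[0, 2 * pi]%classic `*` `[0, 2 * pi]%classic.

Lemma measurable_Omega2 : measurable (Omega2 : set (measurableTypeR R * measurableTypeR R)%type).
Proof. by apply: measurableX; exact: measurable_itv. Qed.

Lemma measurable_Omega : measurable (Om : set (mpt R)).
Proof. by apply: measurableX; [exact: measurable_Omega2|exact: measurable_itv]. Qed.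

Lemma vol_box (A B C : set (measurableTypeR R)) :
  measurable A -> measurable B -> measurable C ->
  vol R (A `*` B `*` C) = (mu A * mu B * mu C)%E.
Proof.
move=> mA mB mC.
rewrite /vol /= product_measure1E//; last exact: measurableX.
by rewrite /= product_measure1E.
Qed.

Lemma vol_Omega : vol R Om = ((2 * pi) ^+ 3)%:E.
Proof.
rewrite vol_box; [|exact: measurable_itv..].
rewrite /= lebesgue_measure_itv/= lte_fin twopi_gt0 -EFinB subr0 -!EFinM.
by rewrite !exprS expr0 mulr1 mulrA.
Qed.

Lemma compact_Omega2 : compact Omega2.
Proof. by apply: compact_setX; exact: segment_compact. Qed.

Lemma compact_Omega : compact Om.
Proof. by apply: compact_setX; [exact: compact_Omega2|exact: segment_compact]. Qed.

Lemma continuous_bounded_on (X : topologicalType) (A : set X) (f : X -> R) :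
  compact A -> continuous f -> [bounded f x | x in A].
Proof.
move=> cA cf.
have : compact (f @` A) by apply: continuous_compact => //; exact: continuous_subspaceT.
move=> /compact_bounded [M [Mr HM]].
by exists M; split => // x /HM H y Ay; apply: H; exists y.
Qed.

Lemma integrable_Omega (f : pt R -> R) : continuous f ->
  (vol R).-integrable Om (EFin \o f).
Proof.
move=> cf; apply: measurable_bounded_integrable.
- exact: measurable_Omega.
- by rewrite [X in (X < _)%E]vol_Omega ltry.
- by apply: measurable_funS (continuous_measurable_pt cf) => //.
- by apply: continuous_bounded_on => //; exact: compact_Omega.
Qed.

End Box.

(** * Integrals of derivatives of periodic functions *)

Section Divergence.
Context {R : realType}.
Local Notation Om := (@Omega R).
Local Notation mu := (@lebesgue_measure R).

Lemma derive_along_line (f : pt R -> R) (v x : pt R) (s : R) :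
  derivable f (x + s *: v) v ->
  is_derive s 1 (fun s : R => f (x + s *: v)) ('D_v f (x + s *: v)).
Proof.
move=> df.
have E : (fun h : R => h^-1 *: (((fun s : R => f (x + s *: v)) \o shift s) (h *: (1 : R)) - f (x + s *: v))) =
   (fun h : R => h^-1 *: ((f \o shift (x + s *: v)) (h *: v) - f (x + s *: v))).
  apply/funext => h /=; congr (_ *: (f _ - _)).
  by rewrite [h *: 1]mulr1 scalerDl addrCA.
split; first by rewrite /derivable E.
by rewrite /derive E.
Qed.

Lemma bvec_line (x y z s : R) :
  [/\ (s, y, z) = (0, y, z) + s *: bvec R 0,
      (x, s, z) = (x, 0, z) + s *: bvec R 1 &
      (x, y, s) = (x, y, 0) + s *: bvec R 2].
Proof.
by split; rewrite /bvec /=; congr (_, _, _);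
  rewrite /= ?mulr1 ?mulr0 ?addr0 ?add0r ?[s *: _]mulr1 ?[s *: _]mulr0 ?addr0 ?add0r.
Qed.

Lemma integral_period1 (h g : R -> R) :
  (forall s, is_derive s (1 : R) h (g s)) -> continuous g -> h (2 * pi) = h 0 ->
  (\int[mu]_s ((g \_ `[0%R, (2 * pi)%R]) s)%:E = 0)%E.
Proof.
move=> dh cg hp.
have ch : continuous h.
  by move=> s; apply/differentiable_continuous/derivable1_diffP; have := dh s; case.
have -> : (fun s => ((g \_ `[0%R, (2 * pi)%R]) s)%:E) =
   (EFin \o g) \_ `[0%R, (2 * pi)%R].
  by apply/funext => s; rewrite restrict_EFin.
rewrite -integral_mkcond (@continuous_FTC2 _ g h 0 (2 * pi)).
- by rewrite hp -EFinB subrr.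
- exact: twopi_gt0.
- exact: continuous_subspaceT.
- split.
  + by move=> s _; have [] := dh s.
  + by apply: cvg_at_right_filter; exact: ch.
  + by apply: cvg_at_left_filter; exact: ch.
- by move=> s _; rewrite derive1E; have [_ ->] := dh s.
Qed.

(** On each line parallel to the w axis, the fundamental theorem of calculus gives
the difference of the values of G at two points that differ by a period.
This identity is integration by parts on the torus. *)
Lemma integral_partial_periodic (w : 'I_3) (G : pt R -> R) :
  (forall x, derivable G x (bvec R w)) -> continuous (partial w G) ->
  periodic2pi G -> \int[vol R]_(x in Om) partial w G x = 0.
Proof.
move=> dG cG pG; rewrite /Rintegral integral_mkcond.
set f := (X in integral _ _ X).
have fE x : f x = ((partial w G \_ Om) x)%:E.
  by rewrite /f restrict_EFin.
have intf : (vol R).-integrable setT f.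
  by have := integrable_Omega cG; rewrite (integrable_mkcond _ measurable_Omega).
suff -> : (\int[vol R]_x f x = 0)%E by [].
apply: (@integral_prod3_eq0 R _ _ _ _ _ _ mu mu mu) => //.
  move=> z.
  have [zin|zout] := pselect (`[0, 2 * pi]%classic z); last first.
    have -> : (fun p => f (p, z)) = cst 0%E.
      apply/funext => p; rewrite fE patchE; case: ifP => //.
      by rewrite inE => -[_ /zout].
    exact: integrable0.
  have -> : (fun p => f (p, z)) = (EFin \o (fun p => partial w G (p, z))) \_ Omega2.
    apply/funext => p; rewrite fE restrict_EFin; congr EFin; rewrite !patchE.
    have -> : ((p, z) \in Om) = (p \in Omega2) => //.
    by apply/idP/idP; rewrite !inE; [case|split].
  have H : (mu \x mu)%E.-integrable Omega2 (EFin \o (fun p => partial w G (p, z))).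
    apply: measurable_bounded_integrable.
    - exact: measurable_Omega2.
    - rewrite [X in (X < _)%E](_ : _ = mu `[0%R, (2 * pi)%R] * mu `[0%R, (2 * pi)%R])%E; last first.
        by apply: product_measure1E; exact: measurable_itv.
      by rewrite /= lebesgue_measure_itv/= lte_fin twopi_gt0 -EFinB -EFinM ltry.
    - have mz := continuous_measurable_pt cG.
      apply: measurable_funTS.
      by apply: (measurableT_comp mz); exact: pair2_measurable.
    - have : [bounded partial w G q | q in Om].
        by apply: continuous_bounded_on => //; exact: compact_Omega.
      move=> [M [Mr HM]]; exists M; split => // x /HM H p pin.
      by apply: H.
  by rewrite -(integrable_mkcond _ measurable_Omega2).
(* The integrand vanishes off the box, so on a line it is either zero or the
   derivative of a periodic function cut off to one period. *)
have slice (P : Prop) (i : R -> pt R) :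
    (forall s, Om (i s) <-> P /\ `[0, 2 * pi]%classic s) ->
    (forall s, is_derive s (1 : R) (G \o i) (partial w G (i s))) ->
    continuous (fun s => partial w G (i s)) -> G (i (2 * pi)) = G (i 0) ->
    (\int[mu]_s f (i s) = 0)%E.
  move=> iP dGi cGi pGi.
  have [HP|HP] := pselect P.
    rewrite -[RHS](integral_period1 dGi cGi pGi); apply: eq_integral => s _.
    rewrite fE !patchE; congr EFin.
    have -> : (i s \in Om) = (s \in `[0, 2 * pi]%classic) => //.
    by apply/idP/idP; rewrite !inE; [case/iP|move=> H; apply/iP].
  apply: integral0_eq => s _; rewrite fE patchE ifF//.
  by apply/negP; rewrite inE => /iP[].
have [cl0 cl1 cl2] : [/\ forall y z, continuous (fun s => partial w G (s, y, z)),
    forall x z, continuous (fun s => partial w G (x, s, z)) &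
    forall x y, continuous (fun s => partial w G (x, y, s))].
  by split=> a b; [have [] := continuous_line 0 a b cG|
    have [] := continuous_line a 0 b cG|have [] := continuous_line a b 0 cG].
have pw (i : R -> pt R) : (forall s, i s = i 0 + s *: bvec R w) ->
    G (i (2 * pi)) = G (i 0) /\
    forall s, is_derive s (1 : R) (G \o i) (partial w G (i s)).
  move=> Hi; split; first by rewrite Hi pG.
  move=> s; rewrite Hi.
  have -> : G \o i = (fun s => G (i 0 + s *: bvec R w)).
    by apply/funext => u /=; rewrite [in LHS]Hi.
  exact: derive_along_line.
have line0 y z s : (s, y, z) = (0, y, z) + s *: bvec R 0 by have [] := bvec_line 0 y z s.
have line1 x z s : (x, s, z) = (x, 0, z) + s *: bvec R 1 by have [] := bvec_line x 0 z s.
have line2 x y s : (x, y, s) = (x, y, 0) + s *: bvec R 2 by have [] := bvec_line x y 0 s.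
have [/eqP Hw|Hw|Hw] : [\/ w == 0, w == 1 | w == 2].
  by case: w {dG cG pG f fE intf slice cl0 cl1 cl2 pw} => [[|[|[|//]]] ?]; [constructor 1|constructor 2|constructor 3].
- constructor 1 => y z.
  have [] := pw (fun s => (s, y, z)); first by move=> s; rewrite Hw -line0.
  move=> H1 H2.
  apply: (slice (`[0, 2 * pi]%classic y /\ `[0, 2 * pi]%classic z) (fun s => (s, y, z))) => // s.
  by split=> [[[]]|[[]]].
- constructor 2 => x z; move/eqP in Hw.
  have [] := pw (fun s => (x, s, z)); first by move=> s; rewrite Hw -line1.
  move=> H1 H2.
  apply: (slice (`[0, 2 * pi]%classic x /\ `[0, 2 * pi]%classic z) (fun s => (x, s, z))) => // s.
  by split=> [[[]]|[[]]].
- constructor 3 => x y; move/eqP in Hw.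
  have [] := pw (fun s => (x, y, s)); first by move=> s; rewrite Hw -line2.
  move=> H1 H2.
  apply: (slice (`[0, 2 * pi]%classic x /\ `[0, 2 * pi]%classic y) (fun s => (x, y, s))) => // s.
Qed.
End Divergence.

(** * Fourier coefficients with a phase *)

Section Fourier.
Context {R : realType}.
Local Notation Om := (@Omega R).
Implicit Types (k x : pt R) (u v : pt R -> R) (w : 'I_3) (th : R).

Definition coordinate w k : R :=
  if w == 0 then k.1.1 else if w == 1 then k.1.2 else k.2.

Definition dot k x : R := k.1.1 * x.1.1 + k.1.2 * x.1.2 + k.2 * x.2.

Definition intvec k := forall w, coordinate w k \is a Num.int.

(** The real plane wave of frequency k and phase th. *)
Definition wave k th x : R := cos (dot k x + th).

Lemma I3_cases w : [\/ w = 0, w = 1 | w = 2].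
Proof.
case: w => [[|[|[|//]]] ?]; [constructor 1|constructor 2|constructor 3]; exact/val_inj.
Qed.

Lemma dot_shift k x w (s : R) : dot k (x + s *: bvec R w) = dot k x + s * coordinate w k.
Proof.
case: x => [[x y] z]; rewrite /dot /coordinate.
case: (I3_cases w) => ->; rewrite /= ?[_ *: _]mulr1 ?[_ *: _]mulr0;
  rewrite /GRing.scale /= ?mulr1 ?mulr0; ring.
Qed.

Lemma continuous_dot k : continuous (dot k).
Proof.
move=> x; have c1 : {for x, continuous (fun x : pt R => x.1.1)}.
  by apply: (@continuous_comp _ _ _ fst fst); exact: cvg_fst.
have c2 : {for x, continuous (fun x : pt R => x.1.2)}.
  by apply: (@continuous_comp _ _ _ fst snd); [exact: cvg_fst|exact: cvg_snd].
have c3 : {for x, continuous (fun x : pt R => x.2)} by exact: cvg_snd.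
by apply: cvgD; [apply: cvgD|]; apply: cvgM => //; exact: cvg_cst.
Qed.

Lemma continuous_wave k th : continuous (wave k th).
Proof.
apply: (@continuous_compose _ _ _ (fun x => dot k x + th) cos); last exact: continuous_cos.
by move=> x; apply: cvgD; [exact: continuous_dot|exact: cvg_cst].
Qed.

Lemma is_derive_wave k th w x :
  is_derive x (bvec R w) (wave k th) (coordinate w k * wave k (th + pi / 2) x).
Proof.
have E : (fun h : R => h^-1 *: ((wave k th \o shift x) (h *: bvec R w) - wave k th x)) =
   (fun h : R => h^-1 *: (((fun s => cos (s * coordinate w k + (dot k x + th))) \o shift 0)
     (h *: (1 : R)) - (fun s => cos (s * coordinate w k + (dot k x + th))) 0)).
  apply/funext => h /=; congr (_ *: (_ - _)).
    by rewrite /wave [X in dot k X]addrC dot_shift addr0 [h *: 1]mulr1; congr cos; ring.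
  by rewrite mul0r add0r.
have D : is_derive (0 : R) (1 : R) (fun s => cos (s * coordinate w k + (dot k x + th)))
    (coordinate w k * wave k (th + pi / 2) x).
  apply: is_derive_eq; rewrite /wave [dot k x + (th + _)]addrA cosDpihalf.
  by rewrite /GRing.scale /= mul0r add0r !mulr0 !mulr1 addr0 add0r mulrC.
by case: D => D1 D2; split; [rewrite /derivable E|rewrite /derive E].
Qed.

Lemma cosD2pin (x : R) (n : nat) : cos (x + 2 * pi * n%:R) = cos x.
Proof.
elim: n => [|n IH]; first by rewrite mulr0 addr0.
by rewrite -IH -[in RHS](cosD2pi (x + 2 * pi * n%:R)); congr cos; rewrite -natr1; ring.
Qed.

Lemma cosD2pi_int (x m : R) : m \is a Num.int -> cos (x + 2 * pi * m) = cos x.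
Proof.
move=> /intrP[[n|n] ->]; first exact: cosD2pin.
by rewrite NegzE -(cosD2pin _ n.+1); congr cos; rewrite mulrNz -pmulrn; ring.
Qed.

Lemma periodic_wave k th : intvec k -> periodic2pi (wave k th).
Proof.
by move=> ik w x; rewrite /wave dot_shift addrAC cosD2pi_int.
Qed.

Definition integrableO u := (vol R).-integrable Om (EFin \o u).

(** The phase th replaces complex numbers: fcoef u k 0 and fcoef u k (pi / 2) are
the real part and, up to sign, the imaginary part of the k-th coefficient, and
the other phases are their combinations.  A derivative becomes a shift of th. *)
Definition fcoef u k th : R := \int[vol R]_(x in Om) (u x * wave k th x).

Lemma integrableO_continuous u : continuous u -> integrableO u.
Proof. exact: integrable_Omega. Qed.

Lemma eq_integrableO u v : u =1 v -> integrableO u -> integrableO v.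
Proof. by move=> /funext ->. Qed.

Lemma integrableOD u v : integrableO u -> integrableO v -> integrableO (fun x => u x + v x).
Proof. by move=> iu iv; have := integrableD measurable_Omega iu iv. Qed.

Lemma integrableOZ u (a : R) : integrableO u -> integrableO (fun x => a * u x).
Proof. by move=> iu; have := integrableZl measurable_Omega a iu. Qed.

Lemma integrableOB u v : integrableO u -> integrableO v -> integrableO (fun x => u x - v x).
Proof.
move=> iu iv; apply: (eq_integrableO _ (integrableOD iu (integrableOZ (-1) iv))) => x.
by rewrite mulN1r.
Qed.

Lemma integrableO_norm u : integrableO u -> integrableO (fun x => `|u x|).
Proof. by move=> iu; have := integrable_abse iu. Qed.

Lemma integrableOM_continuous u v : integrableO u -> continuous v -> integrableO (fun x => u x * v x).
Proof.
move=> iu cv.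
have bv : [bounded v x | x in Om] by apply: continuous_bounded_on => //; exact: compact_Omega.
have mv : measurable_fun Om (v : mpt R -> R).
  by apply: measurable_funTS; exact: continuous_measurable_pt.
exact: (integrableMl measurable_Omega iu mv bv).
Qed.

Lemma integrableOM_wave u k th : integrableO u -> integrableO (fun x => u x * wave k th x).
Proof. by move=> iu; apply: integrableOM_continuous => //; exact: continuous_wave. Qed.

Lemma fcoefD u v k th : integrableO u -> integrableO v -> fcoef (fun x => u x + v x) k th = fcoef u k th + fcoef v k th.
Proof.
move=> iu iv; rewrite -(RintegralD measurable_Omega); [|exact: integrableOM_wave..].
by apply: eq_Rintegral => x _; rewrite mulrDl.
Qed.

Lemma fcoefB u v k th : integrableO u -> integrableO v -> fcoef (fun x => u x - v x) k th = fcoef u k th - fcoef v k th.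
Proof.
move=> iu iv; rewrite -(RintegralB measurable_Omega); [|exact: integrableOM_wave..].
by apply: eq_Rintegral => x _; rewrite mulrBl.
Qed.

Lemma fcoefZ u k th (a : R) : integrableO u -> fcoef (fun x => a * u x) k th = a * fcoef u k th.
Proof.
move=> iu; rewrite -(RintegralZl _ measurable_Omega); last exact: integrableOM_wave.
by apply: eq_Rintegral => x _; rewrite mulrA.
Qed.

Lemma fcoef_le u k th : integrableO u -> `|fcoef u k th| <= \int[vol R]_(x in Om) `|u x|.
Proof.
move=> iu; apply: (le_trans (le_normr_Rintegral measurable_Omega (integrableOM_wave _ _ iu))).
apply: le_Rintegral; [exact: measurable_Omega|exact/integrableO_norm/integrableOM_wave|exact: integrableO_norm|].
by move=> x _; rewrite normrM ler_piMr// /wave ler_norml cos_geN1 cos_le1.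
Qed.

Lemma ae_imply (P Q : mpt R -> Prop) : {ae vol R, forall x, P x} ->
  (forall x, P x -> Q x) -> {ae vol R, forall x, Q x}.
Proof. by move=> HP PQ; exact: (@filterS _ _ (ae_filter_ringOfSetsType (vol R)) P Q PQ HP). Qed.

Lemma fcoef_ae u v k th : integrableO u -> integrableO v ->
  {ae vol R, forall x, Om x -> u x = v x} -> fcoef u k th = fcoef v k th.
Proof.
move=> iu iv uv; rewrite /fcoef /Rintegral; congr fine.
apply: ae_eq_integral.
- exact: measurable_Omega.
- by have /integrableP[] := integrableOM_wave k th iu.
- by have /integrableP[] := integrableOM_wave k th iv.
- by apply: (ae_imply uv) => x + Ox => ->.
Qed.

Lemma fcoef_phase u k th : integrableO u ->
  fcoef u k th = cos th * fcoef u k 0 + sin th * fcoef u k (pi / 2).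
Proof.
move=> iu; have E x : u x * wave k th x = cos th * (u x * wave k 0 x) + sin th * (u x * wave k (pi / 2) x).
  rewrite /wave cosD addr0 cosDpihalf; ring.
rewrite -!(RintegralZl _ measurable_Omega); [|exact: integrableOM_wave..].
rewrite -(RintegralD measurable_Omega); [|exact/integrableOZ/integrableOM_wave..].
by apply: eq_Rintegral => x _; exact: E.
Qed.

End Fourier.

(** * Fourier coefficients of derivatives, and L^2 bounds *)

Section Sobolev.
Context {R : realType}.
Local Notation Om := (@Omega R).
Implicit Types (k x : pt R) (u v : pt R -> R) (w : 'I_3) (th : R).

Lemma partialM (f g : pt R -> R) w x :
  derivable f x (bvec R w) -> derivable g x (bvec R w) ->
  derivable (fun x => f x * g x) x (bvec R w) /\
  partial w (fun x => f x * g x) x = f x * partial w g x + partial w f x * g x.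
Proof.
move=> df dg.
have Df : is_derive x (bvec R w) f (partial w f x) by split.
have Dg : is_derive x (bvec R w) g (partial w g x) by split.
have := is_deriveM Df Dg => -[D1 D2]; split; first exact: D1.
by rewrite /partial -/(f * g) D2 /GRing.scale /= [g x * _]mulrC.
Qed.

(** Integration by parts: the derivative falls on the wave, and a derivative of a
cosine is a cosine a quarter turn away. *)
Lemma fcoef_partial (g : pt R -> R) w k th : intvec k ->
  continuous g -> continuous (partial w g) ->
  (forall x, derivable g x (bvec R w)) -> periodic2pi g ->
  fcoef (partial w g) k th = coordinate w k * fcoef g k (th - pi / 2).
Proof.
move=> ik cg cdg dg pg.
have dw x : derivable (wave k th) x (bvec R w) by have [] := is_derive_wave k th w x.
have pw x : partial w (wave k th) x = coordinate w k * wave k (th + pi / 2) x.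
  by have [] := is_derive_wave k th w x.
pose G x := g x * wave k th x.
have pG x : partial w G x = partial w g x * wave k th x -
   coordinate w k * (g x * wave k (th - pi / 2) x).
  have [_ ->] := partialM (dg x) (dw x).
  rewrite pw /wave !addrA cosDpihalf cosBpihalf; ring.
have := @integral_partial_periodic R w G.
rewrite (_ : partial w G = (fun x => partial w g x * wave k th x -
   coordinate w k * (g x * wave k (th - pi / 2) x))); last exact/funext.
rewrite (RintegralB measurable_Omega); last first.
- by apply/integrableOZ/integrableOM_wave/integrableO_continuous.
- by apply/integrableOM_wave/integrableO_continuous.
rewrite (RintegralZl _ measurable_Omega); last by apply/integrableOM_wave/integrableO_continuous.
move=> H; apply/eqP; rewrite -subr_eq0; apply/eqP/H.
- by move=> x; have [] := partialM (dg x) (dw x).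
- move=> x; apply: cvgB; apply: cvgM; first exact: cdg.
  + exact: continuous_wave.
  + exact: cvg_cst.
  + by apply: cvgM; [exact: cg|exact: continuous_wave].
- by move=> v x; rewrite /G pg periodic_wave.
Qed.

Lemma smooth_partial w (f : pt R -> R) : smooth f -> smooth (partial w f).
Proof. by move=> sf s; have := sf (rcons s w); rewrite /= foldr_rcons. Qed.

Lemma periodic_partial w (f : pt R -> R) : periodic2pi f -> periodic2pi (partial w f).
Proof.
move=> pf v x; rewrite /partial /derive.
suff -> : (fun h : R => h^-1 *: ((f \o shift (x + (2 * pi) *: bvec R v)) (h *: bvec R w)
    - f (x + (2 * pi) *: bvec R v))) =
  (fun h : R => h^-1 *: ((f \o shift x) (h *: bvec R w) - f x)) by [].
by apply/funext => h /=; rewrite addrA !pf.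
Qed.

Lemma smooth_continuous (f : pt R -> R) : smooth f -> continuous f.
Proof. by move=> /(_ [::])[]. Qed.

Lemma smooth_iter_partial w n (f : pt R -> R) :
  smooth f -> periodic2pi f ->
  smooth (iter n (partial w) f) /\ periodic2pi (iter n (partial w) f).
Proof.
move=> sf pf; elim: n => //= n [IH1 IH2].
by split; [exact: smooth_partial|exact: periodic_partial].
Qed.

Lemma fcoef_iter_partial w n (f : pt R -> R) k th : intvec k ->
  smooth f -> periodic2pi f ->
  fcoef (iter n (partial w) f) k th = coordinate w k ^+ n * fcoef f k (th - n%:R * (pi / 2)).
Proof.
move=> ik sf pf; elim: n th => [|n IH] th /=; first by rewrite mul0r subr0 mul1r.
have [sn pn] := smooth_iter_partial w n sf pf.
rewrite fcoef_partial ?IH ?exprS ?mulrA//.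
- by congr (_ * fcoef _ _ _); rewrite -natr1; ring.
- exact: smooth_continuous.
- exact/smooth_continuous/smooth_partial.
- by move=> x; have [_] := sn [::]; exact.
Qed.

(** The monomial k^a. *)
Definition kpow k (a : multi_index) : R :=
  coordinate 0 k ^+ a 0 * coordinate 1 k ^+ a 1 * coordinate 2 k ^+ a 2.

Lemma smooth_mpartial (a : multi_index) (f : pt R -> R) :
  smooth f -> periodic2pi f ->
  smooth (mpartial a f) /\ periodic2pi (mpartial a f).
Proof.
move=> sf pf; rewrite /mpartial.
have [s2 p2] := smooth_iter_partial 2 (a 2) sf pf.
have [s1 p1] := smooth_iter_partial 1 (a 1) s2 p2.
exact: smooth_iter_partial.
Qed.

Lemma mi_sizeE (a : multi_index) : mi_size a = (a 0%R + a 1%R + a 2%R)%N.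
Proof.
rewrite /mi_size !big_ord_recr big_ord0 /= add0n.
by congr (a _ + a _ + a _)%N; exact/val_inj.
Qed.

Lemma fcoef_mpartial (a : multi_index) (f : pt R -> R) k th : intvec k ->
  smooth f -> periodic2pi f ->
  fcoef (mpartial a f) k th = kpow k a * fcoef f k (th - (mi_size a)%:R * (pi / 2)).
Proof.
move=> ik sf pf; rewrite /mpartial.
have [s2 p2] := smooth_iter_partial 2 (a 2) sf pf.
have [s1 p1] := smooth_iter_partial 1 (a 1) s2 p2.
rewrite !fcoef_iter_partial// !mulrA; congr (_ * fcoef _ _ _).
by rewrite mi_sizeE !natrD; ring.
Qed.

(** The constant that arises from |u| <= s / 2 + u^2 / (2 s) on a domain of volume
(2 pi)^3. *)
Definition L1_L2_const : R := ((2 * pi) ^+ 3 + 1) / 2.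

Lemma L1_L2_const_gt0 : 0 < L1_L2_const.
Proof. by rewrite divr_gt0// addr_gt0// exprn_gt0// twopi_gt0. Qed.

Lemma L2_integrableO u : L2 u -> integrableO u.
Proof.
move=> [mu u2]; apply: (@le_integrable _ _ _ _ _ measurable_Omega _
  (EFin \o (fun x => 1 + u x ^+ 2))).
- exact/measurable_EFinP.
- move=> x _ /=; rewrite lee_fin [leRHS]ger0_norm ?addr_ge0 ?sqr_ge0//.
  rewrite -real_normK ?num_real//.
  by have := sqr_ge0 (`|u x| - 1 / 2); nra.
- apply: integrableOD; first by apply: integrableO_continuous => x; exact: cvg_cst.
  apply/integrableP; split.
    by apply/measurable_EFinP; exact: measurable_funX.
  under eq_integral do rewrite /= ger0_norm ?sqr_ge0//.
  exact: u2.
Qed.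

(** The inequality |u| <= s / 2 + u^2 / (2 s), integrated over the box, replaces
the Cauchy-Schwarz inequality. *)
Lemma L1_le_L2 u (s : R) : L2 u -> 0 < s ->
  (\int[vol R]_(x in Om) ((u x) ^+ 2)%:E <= (s ^+ 2)%:E)%E ->
  \int[vol R]_(x in Om) `|u x| <= L1_L2_const * s.
Proof.
move=> Lu s0 us; have iu := L2_integrableO Lu; have [mu u2] := Lu.
have iu2 : integrableO (fun x => u x ^+ 2).
  apply/integrableP; split.
    by apply/measurable_EFinP; exact: measurable_funX.
  by under eq_integral do rewrite /= ger0_norm ?sqr_ge0//.
have ic : integrableO (fun=> s / 2) by apply: integrableO_continuous => x; exact: cvg_cst.
have iw := integrableOD ic (integrableOZ (2 * s)^-1 iu2).
apply: (@le_trans _ _ (\int[vol R]_(x in Om) (s / 2 + (2 * s)^-1 * u x ^+ 2))).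
  apply: le_Rintegral; [exact: measurable_Omega|exact: integrableO_norm|exact: iw|] => x _.
  rewrite -(real_normK (num_real (u x))).
  have -> : s / 2 + (2 * s)^-1 * `|u x| ^+ 2 = `|u x| + (2 * s)^-1 * (`|u x| - s) ^+ 2.
    by field; rewrite gt_eqF.
  by rewrite lerDl mulr_ge0 ?sqr_ge0// invr_ge0 mulr_ge0// ltW.
rewrite (RintegralD measurable_Omega ic (integrableOZ _ iu2)) (RintegralZl _ measurable_Omega iu2).
rewrite (Rintegral_cst _ measurable_Omega) vol_Omega /=.
have h : \int[vol R]_(x in Om) (u x ^+ 2) <= s ^+ 2.
  rewrite -lee_fin /Rintegral fineK//.
  rewrite ge0_fin_numE; first exact: u2.
  by apply: integral_ge0 => x _; rewrite lee_fin sqr_ge0.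
have : (2 * s)^-1 * \int[vol R]_(x in Om) (u x ^+ 2) <= s / 2.
  have -> : s / 2 = (2 * s)^-1 * s ^+ 2 by field; rewrite gt_eqF.
  by rewrite ler_pM2l// invr_gt0 mulr_gt0.
rewrite /L1_L2_const; lra.
Qed.

Lemma fcoef_le_L2 u (s : R) k th : L2 u -> 0 < s ->
  (\int[vol R]_(x in Om) ((u x) ^+ 2)%:E <= (s ^+ 2)%:E)%E ->
  `|fcoef u k th| <= L1_L2_const * s.
Proof.
by move=> Lu s0 us; apply: le_trans (fcoef_le k th (L2_integrableO Lu)) (L1_le_L2 Lu s0 us).
Qed.

(** Each derivative contributes a nonnegative term to the square of the norm. *)
Lemma sobolev_norm_lt r (U : jet R) (e : R) (a : multi_index) :
  (sobolev_norm r U < e%:E)%E -> (mi_size a <= r)%N ->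
  (\int[vol R]_(x in Om) ((U a x) ^+ 2)%:E <= (e ^+ 2)%:E)%E.
Proof.
move=> + ar; rewrite /sobolev_norm.
set S := (\sum_(_ | _) _)%E => Se.
have term_ge0 (b : multi_index) : (0 <= \int[vol R]_(x in Om) ((U b x) ^+ 2)%:E)%E.
  by apply: integral_ge0 => x _; rewrite lee_fin sqr_ge0.
have S0 : (0 <= S)%E by apply: sume_ge0.
have aS : (\int[vol R]_(x in Om) ((U a x) ^+ 2)%:E <= S)%E.
  pose b : {ffun 'I_3 -> 'I_r.+1} := [ffun w => inord (a w)].
  have bE w : b w = a w :> nat.
    rewrite ffunE inordK// ltnS (leq_trans _ ar)// /mi_size (bigD1 w)//=.
    by rewrite leq_addr.
  have br : (\sum_(w < 3) b w <= r)%N.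
    by under eq_bigr do rewrite bE.
  rewrite /S (bigD1 b)//= (_ : [ffun w => b w : nat] = a); last first.
    by apply/ffunP => w; rewrite ffunE bE.
  by rewrite leeDl// sume_ge0.
apply: le_trans aS _.
have key (X : \bar R) : (0 <= X)%E -> (X `^ 2^-1 < e%:E)%E -> (X <= (e ^+ 2)%:E)%E.
  case: X => [s||] //; last by rewrite poweRyr// invr_eq0.
  rewrite lee_fin => s0; rewrite poweR12_sqrt ?lee_fin//= lte_fin => se.
  rewrite -(sqr_sqrtr s0) ler_sqr ?nnegrE ?sqrtr_ge0//; first exact: ltW.
  by rewrite (le_trans _ (ltW se)) ?sqrtr_ge0.
exact: key.
Qed.

End Sobolev.

(** * Fourier coefficients in H_p^r *)

Section Jets.
Context {R : realType}.
Local Notation Om := (@Omega R).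
Implicit Types (k x : pt R) (u v : pt R -> R) (w : 'I_3) (th : R).

Lemma mi_size0 : mi_size mi0 = 0%N.
Proof. by rewrite mi_sizeE !ffunE. Qed.

Lemma mi_size1 w : mi_size (mi1 w) = 1%N.
Proof. by rewrite mi_sizeE !ffunE; case: (I3_cases w) => ->. Qed.

Lemma kpow1 k w : kpow k (mi1 w) = coordinate w k.
Proof.
rewrite /kpow !ffunE; case: (I3_cases w) => -> /=;
  by rewrite !expr0 ?mulr1 ?mul1r.
Qed.

(** The multi-index of the n-th derivative in direction w. *)
Definition mi_pure n w : multi_index := [ffun v => if v == w then n else 0%N].

Lemma mi_size_pure n w : mi_size (mi_pure n w) = n.
Proof. by rewrite mi_sizeE !ffunE; case: (I3_cases w) => -> /=; rewrite ?addn0. Qed.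

Lemma kpow_pure k n w : kpow k (mi_pure n w) = coordinate w k ^+ n.
Proof.
rewrite /kpow !ffunE; case: (I3_cases w) => -> /=;
  by rewrite !expr0 ?mulr1 ?mul1r.
Qed.

Lemma Hp_jet_L2 r u (U : jet R) a : Hp_jet r u U -> (mi_size a <= r)%N -> L2 (U a).
Proof. by move=> [_ sU _] /sU[]. Qed.

(** Fourier coefficients are continuous in the L^2 norm, uniformly in k and th, so
the approximation in H^r by smooth periodic functions passes to the
coefficients of all derivatives at once. *)
Lemma Hp_jet_approx r u (U : jet R) (e : R) : Hp_jet r u U -> 0 < e ->
  exists phi, [/\ smooth phi, periodic2pi phi &
    forall a k th, (mi_size a <= r)%N ->
      `|fcoef (U a) k th - fcoef (mpartial a phi) k th| <= L1_L2_const * e].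
Proof.
move=> HU e0; have [_ _ /(_ _ e0)[phi [sphi pphi He]]] := HU.
exists phi; split => // a k th ar.
have [/smooth_continuous cphi _] := smooth_mpartial a sphi pphi.
have LU := Hp_jet_L2 HU ar.
have bd := sobolev_norm_lt He ar.
rewrite -fcoefB; [|exact: L2_integrableO|exact: integrableO_continuous].
apply: fcoef_le_L2 => //; split; last exact: le_lt_trans bd (ltry _).
apply: measurable_funB; first by case: LU.
by apply: measurable_funTS; exact: continuous_measurable_pt.
Qed.

(** The rule holds for smooth periodic functions by integration by parts, and both
sides are limits of coefficients of such functions.  This is where membership
in the closure, and not merely in H^r, enters: without periodicity there would
be boundary terms. *)
Lemma fcoef_jet r u (U : jet R) a k th : Hp_jet r u U -> (mi_size a <= r)%N ->
  intvec k -> fcoef (U a) k th = kpow k a * fcoef (U mi0) k (th - (mi_size a)%:R * (pi / 2)).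
Proof.
move=> HU ar ik; set th' := th - _; apply/eqP; rewrite -subr_eq0 -normr_le0.
apply/ler_addgt0Pr => e e0; rewrite add0r.
have K0 : 0 < L1_L2_const * (1 + `|kpow k a|) :> R by rewrite mulr_gt0 ?L1_L2_const_gt0// ltr_wpDr.
have [phi [sphi pphi Hphi]] := Hp_jet_approx HU (divr_gt0 e0 K0).
have h1 := Hphi a k th ar.
have h0 := Hphi mi0 k th' _; rewrite mi_size0 in h0.
have {}h0 := h0 isT.
rewrite fcoef_mpartial// -/th' in h1.
rewrite /mpartial !ffunE /= in h0.
(* e was divided so that the two approximation errors, the second multiplied by
   |k^a|, add up to e. *)
set d := e / _ in h0 h1.
have -> : fcoef (U a) k th - kpow k a * fcoef (U mi0) k th' =
  (fcoef (U a) k th - kpow k a * fcoef phi k th') - kpow k a * (fcoef (U mi0) k th' - fcoef phi k th').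
  by ring.
apply: (le_trans (ler_normB _ _)); rewrite normrM.
have : `|kpow k a| * `|fcoef (U mi0) k th' - fcoef phi k th'| <= `|kpow k a| * (L1_L2_const * d).
  by rewrite ler_wpM2l.
have -> : e = L1_L2_const * d + `|kpow k a| * (L1_L2_const * d).
  by rewrite /d; field; rewrite ?gt_eqF// ?L1_L2_const_gt0// ltr_wpDr.
by move=> h2; apply: lerD.
Qed.

Lemma fcoef_jet_pow_le r u (U : jet R) n w k th : Hp_jet r u U -> (n <= r)%N ->
  intvec k ->
  `|coordinate w k| ^+ n * `|fcoef (U mi0) k th| <= \int[vol R]_(x in Om) `|U (mi_pure n w) x|.
Proof.
move=> HU nr ik.
have ar : (mi_size (mi_pure n w) <= r)%N by rewrite mi_size_pure.
have := fcoef_jet (th + n%:R * (pi / 2)) HU ar ik.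
rewrite kpow_pure mi_size_pure addrK => H.
by rewrite -normrX -normrM -H; apply: fcoef_le; exact/L2_integrableO/(Hp_jet_L2 HU).
Qed.

End Jets.

(** * Derivatives on a closed time interval *)

Section TimeDerivative.
Context {R : realType}.
Implicit Types (T : R) (f g : R -> R).

(** The function g is the derivative of f on [0,T], one-sided at the end points.
The first-order expansion is preferred to a limit of difference quotients
because it makes the end points no exception. *)
Definition deriv_on T f g := forall t e, 0 <= t <= T -> 0 < e ->
  exists2 d, 0 < d & forall s, `|s| < d -> 0 <= t + s <= T ->
    `|f (t + s) - f t - s * g t| <= e * `|s|.

Lemma deriv_onD T f g f' g' : deriv_on T f f' -> deriv_on T g g' ->
  deriv_on T (fun t => f t + g t) (fun t => f' t + g' t).
Proof.
move=> df dg t e tT e0.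
have e20 : 0 < e / 2 by rewrite divr_gt0.
have [d1 d10 h1] := df t _ tT e20; have [d2 d20 h2] := dg t _ tT e20.
exists (Num.min d1 d2); first by rewrite lt_min d10.
move=> s; rewrite lt_min => /andP[/h1 {}h1 /h2 {}h2] sT.
have -> : f (t + s) + g (t + s) - (f t + g t) - s * (f' t + g' t) =
  (f (t + s) - f t - s * f' t) + (g (t + s) - g t - s * g' t) by ring.
apply: (le_trans (ler_normD _ _)).
have := lerD (h1 sT) (h2 sT); lra.
Qed.

Lemma deriv_onZ T f f' (c : R) : deriv_on T f f' ->
  deriv_on T (fun t => c * f t) (fun t => c * f' t).
Proof.
move=> df t e tT e0.
have c0 : 0 < `|c| + 1 by rewrite ltr_wpDl.
have [d d0 h] := df t _ tT (divr_gt0 e0 c0).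
exists d => // s sd sT.
have -> : c * f (t + s) - c * f t - s * (c * f' t) = c * (f (t + s) - f t - s * f' t).
  by ring.
rewrite normrM (le_trans (ler_wpM2l (normr_ge0 _) (h s sd sT)))//.
rewrite mulrA ler_wpM2r// mulrCA ler_piMr ?(ltW e0)//.
by rewrite ler_pdivrMr// mul1r lerDl.
Qed.

Lemma deriv_on_sum T (I : Type) (s : seq I) (f f' : I -> R -> R) :
  (forall i, deriv_on T (f i) (f' i)) ->
  deriv_on T (fun t => \sum_(i <- s) f i t) (fun t => \sum_(i <- s) f' i t).
Proof.
move=> df; elim: s => [|i s IH].
  move=> t e tT e0; exists 1 => // s _ _.
  by rewrite !big_nil mulr0 !subrr normr0 mulr_ge0// ltW.
have := deriv_onD (df i) IH.
congr deriv_on; apply/funext => t; by rewrite big_cons.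
Qed.

Lemma deriv_on_ext T f g f' g' : (forall t, 0 <= t <= T -> f t = g t) ->
  (forall t, 0 <= t <= T -> f' t = g' t) -> deriv_on T f f' -> deriv_on T g g'.
Proof.
move=> fg fg' df t e tT e0; have [d d0 h] := df t e tT e0; exists d => // s sd sT.
by rewrite -!fg// -fg'//; exact: h.
Qed.

Lemma deriv_on_unique T f g g' : 0 < T -> deriv_on T f g -> deriv_on T f g' ->
  forall t, 0 <= t <= T -> g t = g' t.
Proof.
move=> T0 df dg t tT; apply/eqP; rewrite -subr_eq0 -normr_le0.
apply/ler_addgt0Pr => e e0; rewrite add0r.
have e20 : 0 < e / 2 by rewrite divr_gt0.
have [d1 d10 h1] := df t _ tT e20; have [d2 d20 h2] := dg t _ tT e20.
have [s [sd1 sd2 s0 sT]] : exists s, [/\ `|s| < d1, `|s| < d2, s != 0 & 0 <= t + s <= T].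
  (* Increments go to the right in the left half of [0,T] and to the left in the
     other half, which covers both end points. *)
  pose m := Num.min (Num.min d1 d2 / 2) (T / 2).
  have m0 : 0 < m by rewrite lt_min !divr_gt0// lt_min d10.
  have md : m < Num.min d1 d2.
    by rewrite gt_min ltr_pdivrMr// ltr_pMr ?lt_min ?d10// ltr1n.
  move: md; rewrite lt_min => /andP[md1 md2].
  have mT : m <= T / 2 by rewrite ge_min lexx orbT.
  have [tl|tg] := lerP t (T / 2).
    by exists m; rewrite gtr0_norm// gt_eqF//; split=> //; lra.
  exists (- m); rewrite normrN gtr0_norm// oppr_eq0 gt_eqF//; split=> //; lra.
have {h1} := h1 s sd1 sT; have {h2} := h2 s sd2 sT.
have s1 : 0 < `|s| by rewrite normr_gt0.
move=> h2 h1; rewrite -(ler_pM2r s1) -normrM.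
have -> : (g t - g' t) * s = (f (t + s) - f t - s * g' t) - (f (t + s) - f t - s * g t) by ring.
apply: (le_trans (ler_normB _ _)); have := lerD h2 h1; lra.
Qed.

Lemma deriv_on_is_derive T f g x : deriv_on T f g -> x \in `]0, T[ ->
  is_derive x (1 : R) f (g x).
Proof.
move=> df; rewrite in_itv/= => /andP[x0 xT].
have H : (fun h : R => h^-1 *: ((f \o shift x) (h *: (1 : R)) - f x)) @ (0 : R)^' --> g x.
  apply/cvgrPdist_le => e e0.
  have [||d d0 h] := df x e => //; first by rewrite !ltW.
  near=> s.
  have s0 : s != 0 by near: s; exact: nbhs_dnbhs_neq.
  rewrite distrC /= [s *: 1]mulr1 [s + x]addrC.
  have s1 : 0 < `|s| by rewrite normr_gt0.
  rewrite -(ler_pM2r s1) -normrM /GRing.scale /=.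
  have -> : (s^-1 * (f (x + s) - f x) - g x) * s = f (x + s) - f x - s * g x by field.
  apply: h.
    by near: s; apply: dnbhs0_lt.
  have sx : `|s| < Num.min x (T - x).
    by near: s; apply: dnbhs0_lt; rewrite lt_min x0 subr_gt0.
  move: sx; rewrite lt_min !ltr_norml; lra.
split; first by apply/cvg_ex; exists (g x).
exact: (cvg_lim _ H).
Unshelve. all: by end_near. Qed.

Lemma deriv_on_continuous T f g : deriv_on T f g -> {within `[0, T], continuous f}.
Proof.
move=> df; apply/subspace_continuousP => x /=; rewrite in_itv/= => xT.
apply/cvgrPdist_le => e e0.
have [d d0 h] := df x 1 xT ltr01.
have k0 : 0 < 1 + `|g x| by rewrite ltr_wpDr.
have m0 : 0 < Num.min d (e / (1 + `|g x|)) by rewrite lt_min d0 divr_gt0.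
apply/nbhs_ballP; exists (Num.min d (e / (1 + `|g x|))) => // y.
rewrite /ball /= distrC in_itv/= => + yT; rewrite lt_min => /andP[yd ye].
have := h (y - x) yd; rewrite subrKC => /(_ yT) hy; rewrite distrC.
have -> : f y - f x = (f y - f x - (y - x) * g x) + (y - x) * g x by ring.
apply: (le_trans (ler_normD _ _)); rewrite normrM.
move: ye; rewrite ltr_pdivlMr// => ye.
by apply: le_trans (ltW ye); rewrite mulrDr mulr1 lerD2r -[leRHS]mul1r.
Qed.

Lemma deriv_on_MVT T f g a b : deriv_on T f g -> 0 <= a -> a <= b -> b <= T ->
  exists2 c, a <= c <= b & f b - f a = g c * (b - a).
Proof.
move=> df a0 ab bT.
have [||c + E] := @MVT_segment R f g a b ab.
- move=> x; rewrite in_itv/= => /andP[ax xb]; apply: deriv_on_is_derive df _.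
  by rewrite in_itv/= (le_lt_trans a0)// (lt_le_trans xb).
- apply: continuous_subspaceW (deriv_on_continuous df) => x /=.
  by rewrite !in_itv/= => /andP[ax xb]; rewrite (le_trans a0)// (le_trans xb).
- by rewrite in_itv/= => cab; exists c.
Qed.

Lemma is_derive_deriv_on T f g : (forall x, is_derive x (1 : R) f (g x)) ->
  deriv_on T f g.
Proof.
move=> df t e _ e0; have [D1 D2] := df t.
have /cvgrPdist_le/(_ e e0) : (fun h : R => h^-1 *: ((f \o shift t) (h *: (1 : R)) - f t)) @ (0 : R)^' --> g t.
  by rewrite -D2; exact: D1.
move=> /nbhs_ballP[d /= d0 h]; exists d => // s sd _.
have [->|s0] := eqVneq s 0; first by rewrite addr0 mul0r !subrr normr0 mulr0.
have := h s; rewrite /ball /= sub0r normrN => /(_ sd s0).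
rewrite [s *: 1]mulr1 [s + t]addrC /GRing.scale /= => H.
have s1 : 0 < `|s| by rewrite normr_gt0.
have -> : f (t + s) - f t - s * g t = - (g t - s^-1 * (f (t + s) - f t)) * s by field.
by rewrite normrM normrN ler_pM2r.
Qed.

(** Induction on the order: the remainder of f i at order n + 1 vanishes at a and
has the remainder of f i.+1 at order n as its derivative, so the mean value
theorem gains one factor t - a.  The factorial in the denominator of the
sharp bound is given up. *)
Lemma deriv_on_taylor T (f : nat -> R -> R) (K : R) (n i : nat) (a t : R) :
  (forall j, (j < i + n)%N -> deriv_on T (f j) (f j.+1)) ->
  (forall t, 0 <= t <= T -> `|f (i + n)%N t| <= K) ->
  0 <= a -> a <= t -> t <= T ->
  `|f i t - \sum_(j < n) f (i + j)%N a * (t - a) ^+ j / j`!%:R| <= K * (t - a) ^+ n.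
Proof.
elim: n i t => [|n IH] i t df fK a0 at_ tT.
  rewrite big_ord0 subr0 expr0 mulr1; have := fK t; rewrite addn0; apply.
  by rewrite tT (le_trans a0).
pose P t := \sum_(j < n.+1) f (i + j)%N a * (t - a) ^+ j / j`!%:R.
pose Q t := \sum_(j < n) f (i.+1 + j)%N a * (t - a) ^+ j / j`!%:R.
have dP : deriv_on T P Q.
  have -> : P = fun t => (fun=> f i a) t + \sum_(j < n) f (i.+1 + j)%N a * (t - a) ^+ j.+1 / j.+1`!%:R.
    apply/funext => s; rewrite /P big_ord_recl /= addn0 expr0 mulr1 divr1.
    by congr (_ + _); apply: eq_bigr => j _; rewrite /bump /= add1n addnS.
  have -> : Q = fun t => (fun=> 0) t + Q t by apply/funext => s; rewrite add0r.
  apply: deriv_onD; first by apply: is_derive_deriv_on.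
  apply: deriv_on_sum => j; apply: is_derive_deriv_on => x.
  have D : is_derive x (1 : R) (fun t => (f (i.+1 + j)%N a / j.+1`!%:R) * (t - a) ^+ j.+1)
     ((f (i.+1 + j)%N a / j.+1`!%:R) * (j.+1%:R * (x - a) ^+ j)).
    have D0 : is_derive x (1 : R) (fun t => t - a) 1.
      by apply: is_derive_eq; rewrite subr0.
    have D1 := is_deriveX j.+1 D0.
    have E : (fun t => (f (i.+1 + j)%N a / j.+1`!%:R) * (t - a) ^+ j.+1) =
        (f (i.+1 + j)%N a / j.+1`!%:R) *: ((fun t => t - a) ^+ j.+1 : R -> R).
      by apply/funext => s; rewrite !fctE.
    rewrite E; apply: is_derive_eq (is_deriveZ _ D1) _.
    by rewrite /GRing.scale /= mulr1.
  have -> : (fun t => f (i.+1 + j)%N a * (t - a) ^+ j.+1 / j.+1`!%:R) =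
     (fun t => (f (i.+1 + j)%N a / j.+1`!%:R) * (t - a) ^+ j.+1).
    by apply/funext => s; rewrite mulrAC.
  apply: is_derive_eq D _.
  have h1 : (j`!)%:R != 0 :> R by rewrite pnatr_eq0 -lt0n fact_gt0.
  have h2 : j.+1%:R != 0 :> R by rewrite pnatr_eq0.
  rewrite factS natrM /=; move: (j.+1%:R : R) ((j`!)%:R : R) h1 h2 => y z h1 h2.
  by field; rewrite h1 h2.
have dR : deriv_on T (fun t => f i t + (-1) * P t) (fun t => f i.+1 t + (-1) * Q t).
  by apply: deriv_onD; [apply: df; rewrite addnS ltnS leq_addr|exact: deriv_onZ].
have [c /andP[ac ct] E] := deriv_on_MVT dR a0 at_ tT.
have Pa : P a = f i a.
  rewrite /P big_ord_recl /= addn0 expr0 mulr1 divr1 big1 ?addr0// => j _.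
  by rewrite subrr /= expr0n /= mulr0 mul0r.
move: E; rewrite !mulN1r Pa subrr subr0 => E.
rewrite [X in `|X|](_ : _ = (f i.+1 c - Q c) * (t - a)); last exact: E.
rewrite normrM (ger0_norm (_ : 0 <= t - a)) ?subr_ge0// exprSr mulrA.
apply: ler_wpM2r; first by rewrite subr_ge0.
have K0 : 0 <= K by apply: le_trans (fK a _) => //; rewrite a0 (le_trans at_).
apply: (le_trans (IH i.+1 c _ _ a0 ac (le_trans ct tT))).
- by rewrite addSnnS.
- by rewrite addSnnS.
- by rewrite ler_wpM2l// lerXn2r ?nnegrE ?subr_ge0// ?lerD2r// (le_trans ac).
Qed.

End TimeDerivative.

(** * Fourier coefficients of functions in C^k(0,T;H_p^r) *)

Section CkFourier.
Context {R : realType}.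
Local Notation Om := (@Omega R).
Implicit Types (k x : pt R) (w : 'I_3) (th T : R).

Lemma nbhs_ereal_lt (e : R) : 0 < e -> nbhs (0%E : \bar R) [set x | (x < e%:E)%E].
Proof.
move=> e0; apply: open_nbhs_nbhs; split; first exact: open_ereal_lt_ereal.
by rewrite /= lte_fin.
Qed.

Lemma L2_of_sobolev r (U : jet R) (e : R) a :
  measurable_fun Om (U a : mpt R -> R) -> (mi_size a <= r)%N ->
  (sobolev_norm r U < e%:E)%E -> L2 (U a).
Proof.
by move=> mU ar /sobolev_norm_lt/(_ ar) H; split=> //; exact: le_lt_trans H (ltry _).
Qed.

(** Taking a Fourier coefficient is linear and bounded for the L^2 norm, hence
commutes with the limit that defines the time derivative in H^r. *)
Lemma Ck_deriv_on n r T u V i k th : Ck_Hp n r T u V -> (i < n)%N ->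
  deriv_on T (fun t => fcoef (V i t mi0) k th) (fun t => fcoef (V i.+1 t mi0) k th).
Proof.
move=> [_ HV HD _] ni t e tT e0.
have K0 := @L1_L2_const_gt0 R.
pose e' := e / L1_L2_const.
have e'0 : 0 < e' by rewrite divr_gt0.
have LV j s : (j <= n)%N -> 0 <= s <= T -> L2 (V j s mi0).
  by move=> jn sT; apply: Hp_jet_L2 (HV j s jn sT) _; rewrite mi_size0.
have := HD i t ni tT _ (nbhs_ereal_lt e'0).
move=> /nbhs_ballP[d /= d0 h]; exists d => // s sd sT.
have [->|s0] := eqVneq s 0; first by rewrite addr0 mul0r !subrr normr0 mulr0.
have := h s; rewrite /ball /= sub0r normrN => /(_ sd s0 sT) Hs.
have L1 := LV i _ (ltnW ni) sT; have L0 := LV i _ (ltnW ni) tT.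
have L3 := LV i.+1 _ ni tT.
have m0 : (mi_size mi0 <= r)%N by rewrite mi_size0.
pose D x := (V i (t + s) mi0 x - V i t mi0 x) / s - V i.+1 t mi0 x.
have LD : L2 D.
  apply: L2_of_sobolev m0 Hs; apply: measurable_funB; last by case: L3.
  apply: measurable_funM; last exact: measurable_cst.
  by apply: measurable_funB; [case: L1|case: L0].
have fcoefD := fcoef_le_L2 k th LD e'0 (sobolev_norm_lt Hs m0).
have E : fcoef D k th = s^-1 * (fcoef (V i (t + s) mi0) k th - fcoef (V i t mi0) k th) - fcoef (V i.+1 t mi0) k th.
  rewrite /D fcoefB; [|under eq_fun do rewrite mulrC|exact: L2_integrableO].
    rewrite (_ : (fun x => _ / s) = (fun x => s^-1 * (V i (t + s) mi0 x - V i t mi0 x))).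
      by rewrite fcoefZ ?fcoefB//; try exact: L2_integrableO; apply: integrableOB; exact: L2_integrableO.
    by apply/funext => x; rewrite mulrC.
  by apply/integrableOZ/integrableOB; exact: L2_integrableO.
have -> : fcoef (V i (t + s) mi0) k th - fcoef (V i t mi0) k th - s * fcoef (V i.+1 t mi0) k th = fcoef D k th * s.
  by rewrite E; field.
rewrite normrM ler_wpM2r// (le_trans fcoefD)// /e' mulrC divfK// gt_eqF//.
Qed.

(** A continuous function on the compact interval [0,T] with values in H^r is
bounded; the bound is extracted from a covering by neighbourhoods on which the
H^r distance to the centre is less than one. *)
Lemma Ck_L1_bounded n r T u V a : Ck_Hp n r T u V -> (mi_size a <= r)%N ->
  exists B, forall t, 0 <= t <= T -> \int[vol R]_(x in Om) `|V n t a x| <= B.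
Proof.
move=> [_ HV _ HC] ar.
have LV s : 0 <= s <= T -> L2 (V n s a).
  by move=> sT; apply: Hp_jet_L2 (HV n s (leqnn _) sT) ar.
have := @segment_compact R 0 T; rewrite compact_near_coveringP => /(_ R (+oo : set_system R)
  (fun B t => 0 <= t <= T -> \int[vol R]_(x in Om) `|V n t a x| <= B) _).
case=> [|B [_ HB]]; last first.
  exists (B + 1) => t tT; have := HB (B + 1); apply => //; by rewrite ltrDl.
move=> t; rewrite /= in_itv/= => tT.
have := HC t tT _ (nbhs_ereal_lt (@ltr01 R)) => Ht.
(* Near t the integral exceeds its value at t by at most L1_L2_const. *)
exists ([set s | 0 <= s <= T ->
    (sobolev_norm r (fun a x => V n s a x - V n t a x)%R < 1%:E)%E],
  [set B | \int[vol R]_(x in Om) `|V n t a x| + L1_L2_const <= B]).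
  split; first exact: Ht.
  by apply: nbhs_pinfty_ge; exact: num_real.
move=> [s B] /= [Hs HB] sT; have {}Hs := Hs sT.
have L1 := LV s sT; have L0 := LV t tT.
have LD : L2 (fun x => V n s a x - V n t a x).
  by apply: L2_of_sobolev ar Hs; apply: measurable_funB; [case: L1|case: L0].
have H := L1_le_L2 LD ltr01 (sobolev_norm_lt Hs ar).
apply: (@le_trans _ _ (\int[vol R]_(x in Om) `|V n t a x| + L1_L2_const)) => //.
rewrite mulr1 in H.
apply: (@le_trans _ _ (\int[vol R]_(x in Om) (`|V n t a x| + `|V n s a x - V n t a x|))).
  apply: le_Rintegral; [exact: measurable_Omega|exact/integrableO_norm/L2_integrableO| |].
    by apply: integrableOD; apply: integrableO_norm; exact: L2_integrableO.
  by move=> x _; rewrite -[X in `|X| <= _](subrKC (V n t a x)) ler_normD.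
rewrite (RintegralD measurable_Omega); [|exact/integrableO_norm/L2_integrableO|exact/integrableO_norm/L2_integrableO].
by rewrite lerD2l.
Qed.

End CkFourier.

(** * Enumeration of the frequencies and summation over cubes *)

Section Frequencies.
Context {R : realType}.
Implicit Types (f : nat -> nat -> nat -> R).

(** The enumeration 0, 1, -1, 2, -2, ... of the integers.  The first 2q+1 of them
are those of absolute value at most q, so the sums over symmetric cubes of
frequencies become sums over initial segments of nat. *)
Definition freq (j : nat) : R := (if odd j then 1 else -1) * (uphalf j)%:R.

Lemma norm_freq j : `|freq j| = (uphalf j)%:R.
Proof. by rewrite /freq normrM; case: odd; rewrite ?normrN normr1 mul1r normr_nat. Qed.

Lemma freq_int j : freq j \is a Num.int.
Proof. by rewrite /freq; case: odd; rewrite ?mulN1r ?mul1r ?rpredN ?natr_int. Qed.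

Lemma freq_inj : injective freq.
Proof.
move=> i j E; have Eu : uphalf i = uphalf j.
  by apply/eqP; rewrite -(eqr_nat R) -!norm_freq E.
have oi := odd_double_half i; have oj := odd_double_half j.
move: E Eu; rewrite /freq !uphalf_half.
case: (odd i) oi; case: (odd j) oj => /= oj oi E Eu; try by rewrite -oi -oj; lia.
- move/eqP: E; rewrite -subr_eq0 mul1r mulN1r opprK -natrD pnatr_eq0; lia.
- move/eqP: E; rewrite -subr_eq0 mul1r mulN1r -opprD oppr_eq0 -natrD pnatr_eq0; lia.
Qed.

Lemma freq_surj (m : R) (q : nat) : m \is a Num.int -> `|m| <= q%:R ->
  exists2 j, (j < q.*2.+1)%N & freq j = m.
Proof.
move=> /intrP[[n|n] ->].
  rewrite normr_nat ler_nat => nq; case: n nq => [|n] nq.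
    by exists 0%N => //; rewrite /freq mulr0.
  exists n.*2.+1; first by lia.
  have E : uphalf n.*2.+1 = n.+1 by exact: (doubleK n.+1).
  by rewrite /freq E oddS odd_double mul1r.
rewrite NegzE mulrNz normrN normr_nat ler_nat => nq.
exists n.+1.*2; first by lia.
by rewrite /freq odd_double mulN1r uphalf_double.
Qed.

Definition freq_sum (a b c : nat) f : R :=
  \sum_(0 <= i < a) \sum_(0 <= j < b) \sum_(0 <= l < c) f i j l.

(** A summable weight of the size of 1 / k^2, made finite at k = 0.  The product
of three of them dominates |k|^-6 in dimension three. *)
Definition inv_sq (j : nat) : R := (maxn 1 (uphalf j))%:R ^- 2.

Lemma inv_sq_ge0 j : 0 <= inv_sq j.
Proof. by rewrite /inv_sq invr_ge0 exprn_ge0. Qed.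

Lemma inv_sq0 : inv_sq 0 = 1.
Proof. by rewrite /inv_sq (_ : maxn 1 (uphalf 0) = 1%N)// expr1n invr1. Qed.

Lemma inv_sq1 : inv_sq 1 = 1.
Proof. by rewrite /inv_sq (_ : maxn 1 (uphalf 1) = 1%N)// expr1n invr1. Qed.

(** Beyond the first two terms, inv_sq n.+2 <= 4 / (n + 2)^2, which is at most the
telescoping difference 4 / (n + 1) - 4 / (n + 2). *)
Lemma sum_inv_sq_le m : \sum_(0 <= j < m) inv_sq j <= 9.
Proof.
suff H n : \sum_(0 <= j < n.+2) inv_sq j <= 9 - 4 / n.+1%:R.
  case: m => [|[|m]]; [by rewrite big_geq|by rewrite big_nat1 inv_sq0; lra|].
  apply: (le_trans (H m)); rewrite gerBl; exact: divr_ge0.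
elim: n => [|n IH].
  by rewrite big_nat_recr//= big_nat1 inv_sq0 inv_sq1; lra.
rewrite big_nat_recr//=.
have hq : inv_sq n.+2 <= 4 / n.+2%:R ^+ 2.
  rewrite /inv_sq; have -> : 4 / n.+2%:R ^+ 2 = ((n.+2%:R / 2) ^+ 2)^-1 :> R.
    by rewrite expr_div_n invf_div; congr (_ / _); lra.
  rewrite lef_pV2 ?posrE ?exprn_gt0 ?divr_gt0 ?ltr0n ?leq_max//.
  rewrite lerXn2r ?nnegrE ?divr_ge0// ler_pdivrMr// -natrM ler_nat.
  by have := odd_double_half n; rewrite uphalf_half; lia.
have h2 : 4 / n.+2%:R ^+ 2 <= 4 / n.+1%:R - 4 / n.+2%:R :> R.
  have -> : 4 / n.+1%:R - 4 / n.+2%:R = 4 / (n.+1%:R * n.+2%:R) :> R.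
    rewrite -[n.+2%:R]natr1; have : n.+1%:R != 0 :> R by rewrite pnatr_eq0.
    have : n.+1%:R + 1 != 0 :> R by rewrite natr1 pnatr_eq0.
    by move: (n.+1%:R : R) => y h1 h2; field; rewrite h1 h2.
  rewrite ler_wpM2l// lef_pV2 ?posrE ?mulr_gt0 ?exprn_gt0 ?ltr0n//.
  by rewrite expr2 ler_wpM2r// ler_nat.
by apply: (le_trans (lerD IH (le_trans hq h2))); rewrite addrA subrK.
Qed.

Lemma sum_inv_sq_ge0 a b : 0 <= \sum_(a <= j < b) inv_sq j.
Proof. by apply: sumr_ge0 => j _; exact: inv_sq_ge0. Qed.

Lemma sum_inv_sq_range_le a b : \sum_(a <= j < b) inv_sq j <= 9.
Proof.
have [ab|ba] := leqP a b; last by rewrite big_geq ?(ltnW ba).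
apply: le_trans (sum_inv_sq_le b); rewrite (@big_cat_nat _ _ _ a 0 b)//=.
by rewrite lerDr sum_inv_sq_ge0.
Qed.

Definition freq_block_sum (a a' b b' c c' : nat) f : R :=
  \sum_(a <= i < a') \sum_(b <= j < b') \sum_(c <= l < c') f i j l.

(** The dominating triple sum is the product of three sums of weights, each at
most 9. *)
Lemma freq_block_sum_bound (a a' b b' c c' : nat) f (A : R) : 0 <= A ->
  (forall i j l, (a <= i)%N -> (b <= j)%N -> (c <= l)%N ->
     `|f i j l| <= A * (inv_sq i * inv_sq j * inv_sq l)) ->
  `|freq_block_sum a a' b b' c c' f| <= A * 9 ^+ 3.
Proof.
move=> A0 fA.
have H : `|freq_block_sum a a' b b' c c' f| <= \sum_(a <= i < a') \sum_(b <= j < b')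
    \sum_(c <= l < c') A * (inv_sq i * inv_sq j * inv_sq l).
  apply: (le_trans (ler_norm_sum _ _ _)); apply: ler_sum_nat => i /andP[ai _].
  apply: (le_trans (ler_norm_sum _ _ _)); apply: ler_sum_nat => j /andP[bj _].
  apply: (le_trans (ler_norm_sum _ _ _)); apply: ler_sum_nat => l /andP[cl _].
  exact: fA.
apply: (le_trans H).
have -> : \sum_(a <= i < a') \sum_(b <= j < b') \sum_(c <= l < c') A * (inv_sq i * inv_sq j * inv_sq l) =
   A * ((\sum_(a <= i < a') inv_sq i) * (\sum_(b <= j < b') inv_sq j) * (\sum_(c <= l < c') inv_sq l)).
  rewrite -mulrA mulr_suml mulr_sumr; apply: eq_bigr => i _.
  rewrite mulr_suml 2!mulr_sumr; apply: eq_bigr => j _.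
  by rewrite 3!mulr_sumr; apply: eq_bigr => l _; ring.
apply: ler_wpM2l => //.
rewrite !exprS expr0 mulr1 mulrA.
apply: ler_pM; rewrite ?mulr_ge0 ?sum_inv_sq_ge0 ?sum_inv_sq_range_le//.
by apply: ler_pM; rewrite ?sum_inv_sq_ge0 ?sum_inv_sq_range_le.
Qed.

(** The difference of two nested cubes is cut into three blocks, on each of which
one chosen index is at least n. *)
Lemma freq_sum_tail (n m : nat) f (A : R) : (n <= m)%N -> 0 <= A ->
  (forall i j l, ~~ [&& (i < n)%N, (j < n)%N & (l < n)%N] ->
     `|f i j l| <= A * (inv_sq i * inv_sq j * inv_sq l)) ->
  `|freq_sum m m m f - freq_sum n n n f| <= 3 * (A * 9 ^+ 3).
Proof.
move=> nm A0 fA.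
have -> : freq_sum m m m f - freq_sum n n n f =
    freq_block_sum n m 0 m 0 m f + freq_block_sum 0 n n m 0 m f + freq_block_sum 0 n 0 n n m f.
  rewrite /freq_sum /freq_block_sum (@big_cat_nat _ _ _ n 0 m)//=.
  have -> : \sum_(0 <= i < n) \sum_(0 <= j < m) \sum_(0 <= l < m) f i j l =
     \sum_(0 <= i < n) \sum_(0 <= j < n) \sum_(0 <= l < n) f i j l +
     (\sum_(0 <= i < n) \sum_(n <= j < m) \sum_(0 <= l < m) f i j l +
      \sum_(0 <= i < n) \sum_(0 <= j < n) \sum_(n <= l < m) f i j l).
    rewrite -!big_split/=; apply: eq_bigr => i _.
    rewrite (@big_cat_nat _ _ _ n 0 m)//= addrCA addrC; congr (_ + _).
    by rewrite -big_split/=; apply: eq_bigr => j _; rewrite (@big_cat_nat _ _ _ n 0 m).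
  ring.
have h1 := @freq_block_sum_bound n m 0 m 0 m f A A0.
have h2 := @freq_block_sum_bound 0 n n m 0 m f A A0.
have h3 := @freq_block_sum_bound 0 n 0 n n m f A A0.
apply: (le_trans (ler_normD _ _)).
have := lerD (ler_normD (freq_block_sum n m 0 m 0 m f) (freq_block_sum 0 n n m 0 m f)) (lexx `|freq_block_sum 0 n 0 n n m f|).
have {}h1 : `|freq_block_sum n m 0 m 0 m f| <= A * 9 ^+ 3.
  by apply: h1 => i j l ni _ _; apply: fA; rewrite ltnNge ni.
have {}h2 : `|freq_block_sum 0 n n m 0 m f| <= A * 9 ^+ 3.
  by apply: h2 => i j l _ ni _; apply: fA; rewrite [(j < n)%N]ltnNge ni andbF.
have {}h3 : `|freq_block_sum 0 n 0 n n m f| <= A * 9 ^+ 3.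
  by apply: h3 => i j l _ _ ni; apply: fA; rewrite [(l < n)%N]ltnNge ni !andbF.
lra.
Qed.

End Frequencies.

(** * Orthogonality and Fourier partial sums *)

Section Orthogonality.
Context {R : realType}.
Local Notation Om := (@Omega R).
Implicit Types (k x : pt R) (u v : pt R -> R) (w : 'I_3) (th : R).

Lemma int_wave_neq0 k th : intvec k -> k != 0 ->
  \int[vol R]_(x in Om) wave k th x = 0.
Proof.
move=> ik k0.
have [w kw] : exists w, coordinate w k != 0.
  apply: contrapT => H; move/negP: k0; apply; apply/eqP.
  have H' w : coordinate w k = 0 by apply/eqP/negPn/negP => H1; apply: H; exists w.
  by case: k {ik H} H' => [[a b] c] H'; congr (_, _, _);
    [exact: (H' 0)|exact: (H' 1)|exact: (H' 2)].
have D x := is_derive_wave k (th - pi / 2) w x.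
have E : wave k th = fun x => (coordinate w k)^-1 * partial w (wave k (th - pi / 2)) x.
  apply/funext => x; rewrite /partial; have [_ ->] := D x.
  by rewrite subrK mulrA mulVf// mul1r.
have pE : partial w (wave k (th - pi / 2)) = fun x => coordinate w k * wave k th x.
  by apply/funext => x; rewrite /partial; have [_ ->] := D x; rewrite subrK.
have cp : continuous (partial w (wave k (th - pi / 2))).
  by rewrite pE => x; apply: cvgM; [exact: cvg_cst|exact: continuous_wave].
rewrite E (RintegralZl _ measurable_Omega); last exact: integrable_Omega.
rewrite (@integral_partial_periodic R w) ?mulr0//; last exact: periodic_wave.
Qed.

Lemma wave0 th x : wave 0 th x = cos th.
Proof. by rewrite /wave /dot /= !mul0r !add0r. Qed.

Lemma int_wave0 th : \int[vol R]_(x in Om) wave 0 th x = (2 * pi) ^+ 3 * cos th.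
Proof.
under eq_Rintegral do rewrite wave0.
by rewrite (Rintegral_cst _ measurable_Omega) vol_Omega mulrC.
Qed.

Lemma waveM k l a b x :
  wave k a x * wave l b x = 2^-1 * wave (k + l) (a + b) x + 2^-1 * wave (k - l) (a - b) x.
Proof.
rewrite /wave (_ : dot (k + l) x + (a + b) = (dot k x + a) + (dot l x + b)); last first.
  by rewrite /dot /=; ring.
rewrite (_ : dot (k - l) x + (a - b) = (dot k x + a) - (dot l x + b)); last first.
  by rewrite /dot /=; ring.
by rewrite [in RHS]cosD cosB; field.
Qed.

Lemma intvecD k l : intvec k -> intvec l -> intvec (k + l).
Proof.
by move=> ik il w; have := rpredD (ik w) (il w); rewrite /coordinate; case: (I3_cases w) => ->.
Qed.

Lemma intvecN k : intvec k -> intvec (- k).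
Proof.
by move=> ik w; have := ik w; rewrite -rpredN /coordinate; case: (I3_cases w) => ->.
Qed.

Lemma integrableO_wave k th : integrableO (wave k th).
Proof. by apply: integrableO_continuous; exact: continuous_wave. Qed.

(** Orthogonality of the waves; a real wave of frequency k also has frequency - k. *)
Lemma fcoef_wave k a l b : intvec k -> intvec l ->
  fcoef (wave k a) l b = 2^-1 * (2 * pi) ^+ 3 *
    ((k == - l)%:R * cos (a + b) + (k == l)%:R * cos (a - b)).
Proof.
move=> ik il; rewrite /fcoef.
under eq_Rintegral do rewrite waveM.
rewrite (RintegralD measurable_Omega); [|exact/integrableOZ/integrableO_wave|exact/integrableOZ/integrableO_wave].
rewrite !(RintegralZl _ measurable_Omega); [|exact/integrableO_wave|exact/integrableO_wave].
have h1 : \int[vol R]_(x in Om) wave (k + l) (a + b) x = (2 * pi) ^+ 3 * ((k == - l)%:R * cos (a + b)).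
  case: eqP => [->|kl]; first by rewrite addNr int_wave0 mul1r.
  rewrite int_wave_neq0 ?mul0r ?mulr0//; first exact: intvecD.
  by apply/eqP => /eqP; rewrite addr_eq0 => /eqP.
have h2 : \int[vol R]_(x in Om) wave (k - l) (a - b) x = (2 * pi) ^+ 3 * ((k == l)%:R * cos (a - b)).
  case: eqP => [->|kl]; first by rewrite subrr int_wave0 mul1r.
  rewrite int_wave_neq0 ?mul0r ?mulr0//; first exact/intvecD/intvecN.
  by rewrite subr_eq0; apply/eqP.
by rewrite h1 h2; ring.
Qed.

(** The choice of phase gives the integral of u(y) cos (k . (y - x)), that is
(2 pi)^3 times the real part of the k-th term of the Fourier series at x. *)
Definition mode u k x : R := fcoef u k (- dot k x).

Lemma modeE u k x : integrableO u ->
  mode u k x = fcoef u k 0 * wave k 0 x + fcoef u k (pi / 2) * wave k (pi / 2) x.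
Proof.
move=> iu; rewrite /mode fcoef_phase// /wave cosN sinN addr0 cosDpihalf; ring.
Qed.

Lemma continuous_mode u k : integrableO u -> continuous (mode u k).
Proof.
move=> iu; rewrite (_ : mode u k = fun x => fcoef u k 0 * wave k 0 x + fcoef u k (pi / 2) * wave k (pi / 2) x).
  by move=> x; apply: cvgD; apply: cvgM; [exact: cvg_cst|exact: continuous_wave|exact: cvg_cst|exact: continuous_wave].
by apply/funext => x; exact: modeE.
Qed.

Lemma fcoef_opp u k th : fcoef u (- k) th = fcoef u k (- th).
Proof.
apply: eq_Rintegral => x _; congr (_ * _).
by rewrite /wave -[RHS]cosN; congr cos; rewrite /dot /=; ring.
Qed.

Lemma fcoef_mode u k l th : integrableO u -> intvec k -> intvec l ->
  fcoef (mode u k) l th = (2 * pi) ^+ 3 *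
    (2^-1 * ((k == - l)%:R + (k == l)%:R) * fcoef u l th).
Proof.
move=> iu ik il.
have -> : fcoef (mode u k) l th = fcoef u k 0 * fcoef (wave k 0) l th + fcoef u k (pi / 2) * fcoef (wave k (pi / 2)) l th.
  rewrite -!fcoefZ; [|exact: integrableO_wave|exact: integrableO_wave].
  rewrite -fcoefD; [|exact/integrableOZ/integrableO_wave|exact/integrableOZ/integrableO_wave].
  by congr fcoef; apply/funext => x; exact: modeE.
rewrite !fcoef_wave// add0r sub0r cosN.
have -> : cos (pi / 2 + th) = - sin th by rewrite addrC cosDpihalf.
have -> : cos (pi / 2 - th) = sin th by rewrite -cosN opprB cosBpihalf.
have h1 : (k == - l)%:R * (fcoef u k 0 * cos th - fcoef u k (pi / 2) * sin th) = (k == - l)%:R * fcoef u l th.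
  case: eqP => [->|_]; last by rewrite !mul0r.
  rewrite !mul1r -[in RHS](_ : fcoef u (- l) (- th) = fcoef u l th); last by rewrite fcoef_opp opprK.
  by rewrite [in RHS]fcoef_phase// cosN sinN; ring.
have h2 : (k == l)%:R * (fcoef u k 0 * cos th + fcoef u k (pi / 2) * sin th) = (k == l)%:R * fcoef u l th.
  case: eqP => [->|_]; last by rewrite !mul0r.
  by rewrite !mul1r [in RHS]fcoef_phase//; ring.
transitivity (2^-1 * (2 * pi) ^+ 3 * ((k == - l)%:R * (fcoef u k 0 * cos th - fcoef u k (pi / 2) * sin th)
  + (k == l)%:R * (fcoef u k 0 * cos th + fcoef u k (pi / 2) * sin th))); first by ring.
by rewrite h1 h2; ring.
Qed.

Definition freqv (i j l : nat) : pt R := (freq i, freq j, freq l).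

Lemma intvec_freqv i j l : intvec (freqv i j l).
Proof. by move=> w; rewrite /coordinate; case: (I3_cases w) => -> /=; exact: freq_int. Qed.

Definition fourier_sum (n : nat) u x : R := (2 * pi) ^- 3 * freq_sum n n n (fun i j l => mode u (freqv i j l) x).

Lemma fcoef_sum (I : Type) (s : seq I) (f : I -> pt R -> R) k th :
  (forall i, integrableO (f i)) ->
  integrableO (fun x => \sum_(i <- s) f i x) /\
  fcoef (fun x => \sum_(i <- s) f i x) k th = \sum_(i <- s) fcoef (f i) k th.
Proof.
move=> fi; elim: s => [|i s [IH1 IH2]].
  rewrite big_nil (_ : (fun x => _) = fun=> 0); last by apply/funext => x; rewrite big_nil.
  split; first by apply: integrableO_continuous => x; exact: cvg_cst.
  rewrite /fcoef; under eq_Rintegral do rewrite mul0r.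
  by rewrite (Rintegral_cst _ measurable_Omega) mul0r.
rewrite big_cons (_ : (fun x => _) = fun x => f i x + \sum_(i <- s) f i x); last first.
  by apply/funext => x; rewrite big_cons.
by split; [exact: integrableOD|rewrite fcoefD// IH2].
Qed.

Lemma integrableO_mode u k : integrableO u -> integrableO (mode u k).
Proof. by move=> iu; apply: integrableO_continuous; exact: continuous_mode. Qed.

Lemma integrableO_fourier_sum n u : integrableO u -> integrableO (fourier_sum n u).
Proof.
move=> iu; apply: integrableOZ.
have h := integrableO_mode _ iu.
have H1 i j := (fcoef_sum (index_iota 0 n) 0 0 (fun l => h (freqv i j l))).1.
have H2 i := (fcoef_sum (index_iota 0 n) 0 0 (H1 i)).1.
exact: (fcoef_sum (index_iota 0 n) 0 0 H2).1.
Qed.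

Lemma sum_delta (n : nat) (m : R) : (exists2 j, (j < n)%N & freq j = m) ->
  \sum_(0 <= j < n) (freq j == m)%:R = 1 :> R.
Proof.
move=> [j jn <-]; rewrite (@big_cat_nat _ _ _ j 0 n)//=; last exact: ltnW.
rewrite big1_seq ?add0r; last first.
  move=> i /=; rewrite mem_index_iota => /andP[_ ij].
  by rewrite (inj_eq freq_inj) ltn_eqF.
rewrite big_ltn// eqxx big1_seq ?addr0// => i /=.
by rewrite mem_index_iota => /andP[ij _]; rewrite (inj_eq freq_inj) gtn_eqF.
Qed.

Lemma freqv_eq i j l k :
  (freqv i j l == k)%:R = (freq i == coordinate 0 k)%:R * ((freq j == coordinate 1 k)%:R * (freq l == coordinate 2 k)%:R) :> R.
Proof.
case: k => [[a b] c]; rewrite /freqv /coordinate /= !xpair_eqE.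
by rewrite -!natrM !mulnb andbA.
Qed.

Lemma freq_sum_delta n k : (forall w, exists2 j, (j < n)%N & freq j = coordinate w k) ->
  freq_sum n n n (fun i j l => (freqv i j l == k)%:R) = 1 :> R.
Proof.
move=> H; rewrite /freq_sum.
transitivity ((\sum_(0 <= i < n) (freq i == coordinate 0 k)%:R) *
  ((\sum_(0 <= i < n) (freq i == coordinate 1 k)%:R) * (\sum_(0 <= i < n) (freq i == coordinate 2 k)%:R)) : R).
  rewrite mulr_suml; apply: eq_bigr => i _.
  rewrite mulr_suml mulr_sumr; apply: eq_bigr => j _.
  by rewrite !mulr_sumr; apply: eq_bigr => l _; exact: freqv_eq.
by rewrite !sum_delta// !mulr1.
Qed.

(** Over a cube that is symmetric about the origin both k and - k occur, and each
contributes one half of the coefficient. *)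
Lemma fcoef_fourier_sum q u k th : integrableO u -> intvec k -> (forall w, `|coordinate w k| <= q%:R) ->
  fcoef (fourier_sum q.*2.+1 u) k th = fcoef u k th.
Proof.
move=> iu ik kq; set n := q.*2.+1.
have h := integrableO_mode _ iu.
have H1 i j := fcoef_sum (index_iota 0 n) k th (fun l => h (freqv i j l)).
have H2 i := fcoef_sum (index_iota 0 n) k th (fun j => (H1 i j).1).
have H3 := fcoef_sum (index_iota 0 n) k th (fun i => (H2 i).1).
have -> : fcoef (fourier_sum n u) k th = (2 * pi) ^- 3 * freq_sum n n n (fun i j l => fcoef (mode u (freqv i j l)) k th).
  rewrite [LHS](fcoefZ _ _ _ H3.1) H3.2; congr (_ * _); apply: eq_bigr => i _.
  by rewrite (H2 i).2; apply: eq_bigr => j _; rewrite (H1 i j).2.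
have -> : freq_sum n n n (fun i j l => fcoef (mode u (freqv i j l)) k th) =
  (2 * pi) ^+ 3 * (2^-1 * (freq_sum n n n (fun i j l => (freqv i j l == - k)%:R) +
    freq_sum n n n (fun i j l => (freqv i j l == k)%:R)) * fcoef u k th).
  rewrite /freq_sum -big_split /= mulr_sumr mulr_suml mulr_sumr; apply: eq_bigr => i _.
  rewrite -big_split /= mulr_sumr mulr_suml mulr_sumr; apply: eq_bigr => j _.
  rewrite -big_split /= mulr_sumr mulr_suml mulr_sumr; apply: eq_bigr => l _.
  by rewrite fcoef_mode//; exact: intvec_freqv.
rewrite !freq_sum_delta.
- have : (2 * pi : R) != 0 by rewrite gt_eqF// twopi_gt0.
  by move: (2 * pi : R) => y y0; field.
- by move=> w; apply: freq_surj.
- move=> w; apply: freq_surj; first exact: intvecN.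
  have := kq w; rewrite -normrN /coordinate; by case: (I3_cases w) => ->.
Qed.

End Orthogonality.

(** * A concentrating trigonometric kernel *)

Section PeakKernel.
Context {R : realType}.
Local Notation Om := (@Omega R).
Implicit Types (k x y : pt R) (u : pt R -> R) (v w : 'I_3) (th : R).

Definition peak_factor w x y : R := 1 + cos (coordinate w y - coordinate w x).

Lemma peak_factorE w x y : peak_factor w x y = 1 + wave (bvec R w) (- coordinate w x) y.
Proof.
rewrite /peak_factor /wave; congr (1 + cos (_ - _)).
by rewrite /dot /coordinate; case: (I3_cases w) => -> /=; ring.
Qed.

Lemma continuous_peak_factor w x : continuous (peak_factor w x).
Proof.
rewrite (_ : peak_factor w x = fun y => 1 + wave (bvec R w) (- coordinate w x) y); last first.
  by apply/funext => y; exact: peak_factorE.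
by move=> y; apply: cvgD; [exact: cvg_cst|exact: continuous_wave].
Qed.

(** A nonnegative trigonometric polynomial in y of degree one in each variable,
whose maximum over the box is attained at x when x is an interior point. *)
Definition peak x y : R := peak_factor 0 x y * peak_factor 1 x y * peak_factor 2 x y.

Lemma continuous_peak x : continuous (peak x).
Proof.
by move=> y; apply: cvgM; [apply: cvgM|]; exact: continuous_peak_factor.
Qed.

Lemma intvec_bvec w : intvec (bvec R w).
Proof.
by move=> v; rewrite /coordinate /bvec /=; case: (I3_cases v) => -> /=; case: eqP => _; rewrite ?natr_int.
Qed.

Lemma coordinate_bvec_le v w : `|coordinate v (bvec R w)| <= 1.
Proof.
by rewrite /coordinate /bvec /=; case: (I3_cases v) => -> /=; case: eqP => _; rewrite ?normr0 ?normr1.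
Qed.

Lemma coordinateD v k l : coordinate v (k + l) = coordinate v k + coordinate v l.
Proof. by rewrite /coordinate; case: (I3_cases v) => ->. Qed.

Lemma coordinateN v k : coordinate v (- k) = - coordinate v k.
Proof. by rewrite /coordinate; case: (I3_cases v) => ->. Qed.

(** Multiplication by 1 + cos (y_w - x_w) shifts frequencies by at most one, so it
costs one unit of the range in which the coefficients vanish. *)
Lemma fcoef_peak_factor w x W (p : nat) : integrableO W ->
  (forall k th, intvec k -> (forall v, `|coordinate v k| <= p.+1%:R) -> fcoef W k th = 0) ->
  forall k th, intvec k -> (forall v, `|coordinate v k| <= p%:R) ->
    fcoef (fun y => W y * peak_factor w x y) k th = 0.
Proof.
move=> iW FW k th ik kp.
have e1 v : `|coordinate v (bvec R w + k)| <= p.+1%:R.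
  rewrite coordinateD -natr1; have := ler_normD (coordinate v (bvec R w)) (coordinate v k).
  by have := kp v; have := coordinate_bvec_le v w; lra.
have e2 v : `|coordinate v (bvec R w - k)| <= p.+1%:R.
  rewrite coordinateD coordinateN -natr1; have := ler_normB (coordinate v (bvec R w)) (coordinate v k).
  by have := kp v; have := coordinate_bvec_le v w; lra.
have i1 := intvecD (intvec_bvec w) ik.
have i2 := intvecD (intvec_bvec w) (intvecN ik).
set a := - coordinate w x.
have -> : fcoef (fun y => W y * peak_factor w x y) k th =
   fcoef W k th + 2^-1 * fcoef W (bvec R w + k) (a + th) + 2^-1 * fcoef W (bvec R w - k) (a - th).
  rewrite -!(RintegralZl _ measurable_Omega); [|exact: integrableOM_wave|exact: integrableOM_wave].
  rewrite -!(RintegralD measurable_Omega); first last.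
  - exact/integrableOZ/integrableOM_wave.
  - exact/integrableOM_wave.
  - exact/integrableOZ/integrableOM_wave.
  - by apply: integrableOD; [exact: integrableOM_wave|exact/integrableOZ/integrableOM_wave].
  apply: eq_Rintegral => y _; rewrite peak_factorE -/a.
  transitivity (W y * wave k th y + W y * (wave (bvec R w) a y * wave k th y)); first by ring.
  by rewrite waveM; ring.
rewrite !FW// ?mulr0 ?addr0//.
by move=> v; rewrite (le_trans (kp v))// ler_nat.
Qed.

(** In particular the integral of W peak^n vanishes when the coefficients of W do up
to 3 n. *)
Lemma fcoef_peak_exp n (p : nat) W x : integrableO W ->
  (forall k th, intvec k -> (forall v, `|coordinate v k| <= (3 * n + p)%:R) -> fcoef W k th = 0) ->
  forall k th, intvec k -> (forall v, `|coordinate v k| <= p%:R) ->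
    fcoef (fun y => W y * peak x y ^+ n) k th = 0.
Proof.
elim: n W => [|n IH] W iW FW k th ik kp.
  rewrite -[RHS](FW k th)//; congr fcoef; apply/funext => y; by rewrite mulr1.
have i0 := integrableOM_continuous iW (@continuous_peak_factor 0 x).
have i1 := integrableOM_continuous i0 (@continuous_peak_factor 1 x).
have i2 := integrableOM_continuous i1 (@continuous_peak_factor 2 x).
have H0 : forall k th, intvec k -> (forall v, `|coordinate v k| <= (3 * n + p).+3%:R) -> fcoef W k th = 0.
  by move=> l b il lp; apply: FW => // v; rewrite (le_trans (lp v))// ler_nat; lia.
have H3 := fcoef_peak_factor 2 x i1 (fcoef_peak_factor 1 x i0 (fcoef_peak_factor 0 x iW H0)).
rewrite -[RHS](IH _ i2 H3 k th ik kp).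
by congr fcoef; apply/funext => y; rewrite exprS /peak; ring.
Qed.

Lemma Rintegral_ae_ge0 (D : pt R -> R) : integrableO D ->
  {ae vol R, forall x, Om x -> 0 <= D x} -> 0 <= \int[vol R]_(x in Om) D x.
Proof.
move=> iD D0.
have -> : \int[vol R]_(x in Om) D x = \int[vol R]_(x in Om) `|D x|.
  rewrite /Rintegral; congr fine; apply: ae_eq_integral.
  - exact: measurable_Omega.
  - by have /integrableP[] := iD.
  - by have /integrableP[] := integrableO_norm iD.
  - apply: (ae_imply D0) => x Dx Ox.
    by rewrite ger0_norm// Dx.
by apply: Rintegral_ge0.
Qed.

Definition cube x (d : R) : set (pt R) :=
  `]x.1.1 - d, x.1.1 + d[%classic `*` `]x.1.2 - d, x.1.2 + d[%classic
  `*` `]x.2 - d, x.2 + d[%classic.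

Lemma cubeP x d y : cube x d y <-> forall w, `|coordinate w y - coordinate w x| < d.
Proof.
case: x => [[x1 x2] x3]; case: y => [[y1 y2] y3]; rewrite /cube /=.
rewrite !in_itv /= -!ltr_distlC.
split=> [[[h1 h2] h3] w|H].
  by case: (I3_cases w) => ->; rewrite /coordinate /= distrC.
by have := H 0; have := H 1; have := H 2; rewrite /coordinate /= !(distrC _ x1, distrC _ x2, distrC _ x3).
Qed.

Lemma OmegaP x : Om x <-> forall w, 0 <= coordinate w x <= 2 * pi.
Proof.
case: x => [[x1 x2] x3]; rewrite /Omega /= !in_itv/=; split=> [[[h1 h2] h3] w|H].
  by case: (I3_cases w) => ->.
by have := H 0; have := H 1; have := H 2.
Qed.

Lemma within_cube (f : pt R -> R) x (e : R) : {within Om, continuous f} -> Om x -> 0 < e ->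
  exists2 d, 0 < d & forall y, Om y -> cube x d y -> `|f y - f x| < e.
Proof.
move=> /subspace_continuousP /(_ x) H Ox e0.
have /cvgrPdist_lt /(_ e e0) := H Ox.
move=> /nbhs_ballP[d /= d0 h]; exists d => // y Oy /cubeP cy.
rewrite distrC; apply: h => //.
by split; [split|]; rewrite /ball /=; [have := cy 0|have := cy 1|have := cy 2];
  rewrite /coordinate /= distrC.
Qed.

Lemma cos_le (a b : R) : a \in `[0, pi] -> b \in `[0, pi] -> (cos a <= cos b) = (b <= a).
Proof. by move=> ha hb; rewrite !leNgt ltr_cos. Qed.

Lemma cos_le_far (d r : R) : 0 <= r -> r <= `|d| -> `|d| <= 2 * pi - r -> cos d <= cos r.
Proof.
move=> r0 rd dr.
have -> : cos d = cos `|d| by case: (ger0P d) => _; rewrite ?cosN.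
move: (`|d|) rd dr => {}d rd dr.
have p0 : 0 < pi :> R by exact: pi_gt0.
have [dp|pd] := lerP d pi.
  by rewrite cos_le ?in_itv/=; lra.
have -> : cos d = cos (2 * pi - d).
  by rewrite -cosN -[LHS]cosD2pi; congr cos; ring.
by rewrite cos_le ?in_itv/=; lra.
Qed.

Lemma cos_ge_near (d r : R) : `|d| <= r -> r <= pi -> cos r <= cos d.
Proof.
move=> dr rp.
have -> : cos d = cos `|d| by case: (ger0P d) => _; rewrite ?cosN.
have d0 := normr_ge0 d; by rewrite cos_le ?in_itv/=; lra.
Qed.

Lemma peak_factor_ge0 w x y : 0 <= peak_factor w x y.
Proof. by rewrite /peak_factor; have := cos_geN1 (coordinate w y - coordinate w x); lra. Qed.

Lemma peak_factor_le2 w x y : peak_factor w x y <= 2.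
Proof. by rewrite /peak_factor; have := cos_le1 (coordinate w y - coordinate w x); lra. Qed.

Lemma peak_ge0 x y : 0 <= peak x y.
Proof. by rewrite /peak !mulr_ge0 ?peak_factor_ge0. Qed.

Lemma peak_near x y (r : R) : r <= pi -> cube x r y -> (1 + cos r) ^+ 3 <= peak x y.
Proof.
move=> rp /cubeP cy.
have h w : 1 + cos r <= peak_factor w x y.
  by rewrite /peak_factor lerD2l; apply: cos_ge_near rp; exact/ltW.
have c0 : 0 <= 1 + cos r by have := cos_geN1 r; lra.
rewrite /peak !exprS expr0 mulr1 mulrA.
by apply: ler_pM; rewrite ?mulr_ge0//; apply: ler_pM.
Qed.

(** Some coordinate of y is at distance between r and 2 pi - r from that of x,
where the factor is at most 1 + cos r; the two other factors are at most 2. *)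
Lemma peak_far x y (r : R) : 0 <= r -> Om y -> (forall w, r <= coordinate w x <= 2 * pi - r) ->
  ~ cube x r y -> peak x y <= 4 * (1 + cos r).
Proof.
move=> r0 /OmegaP Oy xr ncy.
have [w hw] : exists w, r <= `|coordinate w y - coordinate w x|.
  apply: contrapT => H; apply: ncy; apply/cubeP => w.
  by rewrite ltNge; apply/negP => H'; apply: H; exists w.
have far : peak_factor w x y <= 1 + cos r.
  rewrite /peak_factor lerD2l; apply: cos_le_far => //.
  have := Oy w; have := xr w; rewrite ler_norml; lra.
have c0 : 0 <= 1 + cos r by have := cos_geN1 r; lra.
have := peak_factor_ge0 0 x y; have := peak_factor_ge0 1 x y; have := peak_factor_ge0 2 x y.
have := peak_factor_le2 0 x y; have := peak_factor_le2 1 x y; have := peak_factor_le2 2 x y.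
rewrite /peak; case: (I3_cases w) far => ->.
- move: (peak_factor 0 x y) (peak_factor 1 x y) (peak_factor 2 x y) (1 + cos r) => a b c d ad c2 b2 a2 c0' b0 a0.
  rewrite -mulrA mulrC; apply: ler_pM => //; first exact: mulr_ge0.
  by rewrite (_ : 4 = 2 * 2)//; [exact: ler_pM|lra].
- move: (peak_factor 0 x y) (peak_factor 1 x y) (peak_factor 2 x y) (1 + cos r) => a b c d ad c2 b2 a2 c0' b0 a0.
  rewrite mulrAC; apply: ler_pM => //; first exact: mulr_ge0.
  by rewrite (_ : 4 = 2 * 2)//; [exact: ler_pM|lra].
- move: (peak_factor 0 x y) (peak_factor 1 x y) (peak_factor 2 x y) (1 + cos r) => a b c d ad c2 b2 a2 c0' b0 a0.
  apply: ler_pM => //; first exact: mulr_ge0.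
  by rewrite (_ : 4 = 2 * 2)//; [exact: ler_pM|lra].
Qed.

(** The left-hand side bounds the peak outside the cube of radius r, the right-hand
side bounds it from below on the cube of radius s; the latter tends to 8 as s
tends to 0.  High powers of the peak therefore live near its centre. *)
Lemma exists_concentration (r : R) : 0 < r -> r <= pi ->
  exists2 s, 0 < s <= r & 4 * (1 + cos r) < (1 + cos s) ^+ 3.
Proof.
move=> r0 rp.
have cr : cos r < 1.
  by rewrite -cos0 ltr_cos ?in_itv/= ?lexx ?pi_ge0 ?(ltW r0)//.
have C : continuous (fun s : R => (1 + cos s) ^+ 3).
  have c1 : continuous (fun s : R => 1 + cos s).
    by move=> s; apply: cvgD; [exact: cvg_cst|exact: continuous_cos].
  rewrite (_ : (fun s => _) = fun s : R => (1 + cos s) * ((1 + cos s) * (1 + cos s))).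
    by move=> s; apply: cvgM; [|apply: cvgM]; exact: c1.
  by apply/funext => s; ring.
have H : (fun s : R => (1 + cos s) ^+ 3) @ 0 --> (8 : R).
  rewrite (_ : 8 = (1 + cos 0) ^+ 3); last by rewrite cos0; ring.
  exact: C.
have e0 : 0 < 8 - 4 * (1 + cos r) by lra.
have /cvgrPdist_lt /(_ _ e0) /nbhs_ballP[d /= d0 h] := H.
exists (Num.min (d / 2) r).
  by rewrite lt_min divr_gt0// r0 /= ge_min lexx orbT.
have m0 : 0 < Num.min (d / 2) r by rewrite lt_min divr_gt0.
have md : Num.min (d / 2) r < d by rewrite gt_min ltr_pdivrMr// ltr_pMr// ltr1n.
have := h (Num.min (d / 2) r); rewrite /ball /= sub0r normrN gtr0_norm// => /(_ md).
rewrite ltr_norml; lra.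
Qed.

End PeakKernel.

(** * Pointwise Fourier inversion *)

Section InteriorInversion.
Context {R : realType}.
Local Notation Om := (@Omega R).
Implicit Types (k x y : pt R) (u : pt R -> R) (v w : 'I_3) (th : R).

Lemma continuous_sum (I : Type) (s : seq I) (f : I -> pt R -> R) :
  (forall i, continuous (f i)) -> continuous (fun x => \sum_(i <- s) f i x).
Proof.
move=> cf; elim: s => [|i s IH] x.
  by rewrite (_ : (fun x => _) = fun=> 0);
    [exact: cvg_cst|apply/funext => y; rewrite big_nil].
rewrite (_ : (fun x => _) = fun x => f i x + \sum_(i <- s) f i x).
  by apply: cvgD; [exact: cf|exact: IH].
by apply/funext => y; rewrite big_cons.
Qed.

Lemma continuous_exp (f : pt R -> R) n : continuous f -> continuous (fun x => f x ^+ n).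
Proof.
move=> cf; elim: n => [|n IH] x; first exact: cvg_cst.
rewrite (_ : (fun x => _) = fun x => f x * f x ^+ n); first by apply: cvgM; [exact: cf|exact: IH].
by apply/funext => y; rewrite exprS.
Qed.

Lemma continuous_fourier_sum n u : integrableO u -> continuous (fourier_sum n u).
Proof.
move=> iu x; apply: cvgM; first exact: cvg_cst.
move: x; do 3!(apply: continuous_sum => ?).
exact: continuous_mode.
Qed.

Lemma measurable_cube x d : measurable (cube x d : set (mpt R)).
Proof. by apply: measurableX; [apply: measurableX|]; exact: measurable_itv. Qed.

Lemma vol_cube x d : 0 < d -> vol R (cube x d) = ((2 * d) ^+ 3)%:E.
Proof.
move=> d0; rewrite vol_box; [|exact: measurable_itv..].
have H (a : R) : a - d < a + d by lra.
rewrite /= !lebesgue_measure_itv/= !lte_fin !H -!EFinB -!EFinM; congr EFin; ring.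
Qed.

Lemma int_indic_cube x d : 0 < d -> cube x d `<=` Om ->
  integrableO (\1_(cube x d) : pt R -> R) /\
  \int[vol R]_(y in Om) (\1_(cube x d) y : R) = (2 * d) ^+ 3.
Proof.
move=> d0 cO; split.
  apply: measurable_bounded_integrable.
  - exact: measurable_Omega.
  - by rewrite [X in (X < _)%E]vol_Omega ltry.
  - apply: measurable_funTS; exact: (measurable_indic (measurable_cube x d)).
  - exists 1; split => // M M1 y _ /=; rewrite indicE; case: (_ \in _);
      by rewrite ?normr1 ?normr0 ?(ltW M1)// (le_trans ler01 (ltW M1)).
rewrite /Rintegral integral_indic; [|exact: measurable_Omega|exact: measurable_cube].
by rewrite (setIidl cO) vol_cube.
Qed.

Lemma expr_lt_eventually (a b c M : R) : 0 <= a -> a < b -> 0 < c ->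
  exists N, a ^+ N * M < c * b ^+ N.
Proof.
move=> a0 ab c0; have b0 : 0 < b by exact: le_lt_trans ab.
have z1 : `|a / b| < 1 by rewrite ger0_norm ?divr_ge0 ?(ltW b0)// ltr_pdivrMr// mul1r.
have := cvg_geometric M z1 => /cvgrPdist_lt /(_ c c0) [N _ /(_ N (leqnn N))].
rewrite /geometric /= sub0r normrN => H; exists N.
have {H} : M * (a / b) ^+ N < c by apply: le_lt_trans (ler_norm _) H.
by rewrite expr_div_n mulrA ltr_pdivrMr ?exprn_gt0// mulrC.
Qed.

Lemma exists_lb3 (f : 'I_3 -> R) : (forall w, 0 < f w) ->
  exists2 g, 0 < g & forall w, g <= f w.
Proof.
move=> f0; exists (Num.min (f 0) (Num.min (f 1) (f 2))); first by rewrite !lt_min !f0.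
by move=> w; case: (I3_cases w) => ->; rewrite !ge_min lexx ?orbT.
Qed.

(** Suppose that the difference exceeds e by 4 del at x.  For every m >= n the
discrepancy W between U and its partial sum of order m is then at least del on
a fixed cube around x, while its L^1 norm is bounded independently of m.  With
m large, the coefficients of W vanish up to 3 N, so the integral of W peak^N
is zero; but the contribution of the cube is at least a constant times k2^N
and the remainder is at most a constant times k1^N with k1 < k2. *)
Lemma inversion_interior_le u U n (e : R) x : integrableO U ->
  {ae vol R, forall y, Om y -> U y = u y} -> {within Om, continuous u} ->
  (forall m y, (n <= m)%N -> `|fourier_sum m U y - fourier_sum n U y| <= e) ->
  (forall w, 0 < coordinate w x < 2 * pi) ->
  u x - fourier_sum n U x <= e.
Proof.
move=> iU Uu cu tail xint; rewrite leNgt; apply/negP => hx.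
have e0 : 0 <= e by apply: le_trans (tail n x (leqnn n)).
pose del := (u x - fourier_sum n U x - e) / 4.
have del0 : 0 < del by rewrite divr_gt0// subr_gt0.
have Ox : Om x by apply/OmegaP => w; have /andP[a b] := xint w; rewrite !ltW.
have [d1 d10 h1] := within_cube cu Ox del0.
have [d2 d20 h2] := within_cube (continuous_subspaceT (@continuous_fourier_sum n _ iU)) Ox del0.
have p0 : 0 < pi :> R by exact: pi_gt0.
(* On the cube of radius r around x the discrepancy is at least del for every
   m >= n; the cube keeps away from the boundary, so that no periodic image of
   the peak enters the box. *)
have [r [r0 rp r1 r2 rx]] : exists r, [/\ 0 < r, r <= pi, r <= d1, r <= d2 &
    forall w, r <= coordinate w x <= 2 * pi - r].
  pose f w := Num.min (coordinate w x) (2 * pi - coordinate w x).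
  have f0 w : 0 < f w by rewrite lt_min subr_gt0; exact: xint.
  have [g g0 gf] := exists_lb3 f0.
  exists (Num.min (Num.min pi (Num.min d1 d2)) g); split.
  - by rewrite !lt_min p0 d10 d20 g0.
  - by rewrite !ge_min lexx.
  - by rewrite !ge_min lexx ?orbT.
  - by rewrite !ge_min lexx ?orbT.
  - move=> w; have : Num.min (Num.min pi (Num.min d1 d2)) g <= f w.
      by rewrite ge_min gf orbT.
    by rewrite /f le_min => /andP[a b]; lra.
have cubeO y : cube x r y -> Om y.
  move=> /cubeP cy; apply/OmegaP => w; have := cy w; have := rx w.
  rewrite ltr_norml; lra.
have [s /andP[s0 sr] conc] := exists_concentration r0 rp.
have sp : s <= pi by exact: le_trans sr rp.
set k1 := 4 * (1 + cos r) in conc; set k2 := (1 + cos s) ^+ 3 in conc.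
have k10 : 0 <= k1 by rewrite /k1; have := cos_geN1 r; lra.
have cubesr y : cube x s y -> cube x r y.
  by move=> /cubeP cy; apply/cubeP => w; exact: lt_le_trans (cy w) sr.
pose M := \int[vol R]_(y in Om) (`|U y - fourier_sum n U y| + e).
have iS m := integrableO_fourier_sum m iU.
have ic : integrableO (fun=> e) by apply: integrableO_continuous => y; exact: cvg_cst.
have iM : integrableO (fun y => `|U y - fourier_sum n U y| + e).
  by apply: integrableOD => //; apply: integrableO_norm; exact: integrableOB.
have c0 : 0 < del * (2 * s) ^+ 3 by rewrite mulr_gt0// exprn_gt0// mulr_gt0.
have [N HN] := expr_lt_eventually M k10 conc c0.
pose q := maxn n (3 * N); pose m := q.*2.+1.
have nm : (n <= m)%N.
  by rewrite /m leqW// -addnn (leq_trans (leq_maxl n (3 * N)))// leq_addr.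
(* 3 N bounds the degree of peak^N, and q >= 3 N makes the partial sum of order m
   reproduce all the coefficients up to it. *)
pose W y := U y - fourier_sum m U y.
have iW : integrableO W by exact: integrableOB.
have FW0 k th : intvec k -> (forall v, `|coordinate v k| <= (3 * N + 0)%:R) -> fcoef W k th = 0.
  move=> ik kN; rewrite /W fcoefB// fcoef_fourier_sum ?subrr// => v.
  by rewrite (le_trans (kN v))// ler_nat addn0 leq_maxr.
have int0 : intvec (0 : pt R).
  by move=> v; rewrite /coordinate; case: (I3_cases v) => -> /=; rewrite rpred0.
have FWK : \int[vol R]_(y in Om) (W y * peak x y ^+ N) = 0.
  have := @fcoef_peak_exp R N 0 W x iW FW0 0 0 int0.
  rewrite /fcoef; under eq_Rintegral do rewrite wave0 cos0 mulr1.
  by apply=> v; rewrite /coordinate; case: (I3_cases v) => -> /=; rewrite normr0.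
have cKN : continuous (fun y => peak x y ^+ N).
  by apply: continuous_exp; exact: continuous_peak.
have iWK : integrableO (fun y => W y * peak x y ^+ N) by exact: integrableOM_continuous.
have [i1 E1] := int_indic_cube s0 (fun y cy => cubeO y (cubesr y cy)).
have iWn : integrableO (fun y => k1 ^+ N * `|W y|) by exact/integrableOZ/integrableO_norm.
have i1' : integrableO (fun y => (del * k2 ^+ N) * (\1_(cube x s) y : R)) by exact: integrableOZ.
(* The integrand is nonnegative: outside the cube of radius r the first term is
   at least - k1^N |W|, inside it W >= del, and on the cube of radius s the peak
   is at least k2. *)
have := @Rintegral_ae_ge0 R (fun y => (W y * peak x y ^+ N + k1 ^+ N * `|W y|) -
  (del * k2 ^+ N) * (\1_(cube x s) y : R)).
rewrite (RintegralB measurable_Omega (integrableOD iWK iWn) i1').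
rewrite (RintegralD measurable_Omega iWK iWn) FWK add0r.
rewrite (RintegralZl _ measurable_Omega i1) E1.
rewrite (RintegralZl _ measurable_Omega (integrableO_norm iW)) => key.
have WM : \int[vol R]_(y in Om) `|W y| <= M.
  apply: le_Rintegral; [exact: measurable_Omega|exact: integrableO_norm|exact: iM|] => y _.
  have := tail m y nm; rewrite /W.
  have := ler_normB (U y - fourier_sum n U y) (fourier_sum m U y - fourier_sum n U y).
  rewrite (_ : U y - fourier_sum n U y - (fourier_sum m U y - fourier_sum n U y) = U y - fourier_sum m U y); last by ring.
  lra.
have {}key : 0 <= k1 ^+ N * \int[vol R]_(y in Om) `|W y| - del * k2 ^+ N * (2 * s) ^+ 3.
  apply: key; first exact: integrableOB (integrableOD iWK iWn) i1'.
  apply: (ae_imply Uu) => y Uy Oy.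
  have K0 : 0 <= peak x y ^+ N by rewrite exprn_ge0 ?peak_ge0.
  have A0 : 0 <= k1 ^+ N * `|W y| by rewrite mulr_ge0 ?exprn_ge0.
  have [cr|ncr] := pselect (cube x r y); last first.
    have -> : \1_(cube x s) y = 0 :> R.
      by rewrite indicE; case: (boolP (y \in cube x s)) => //; rewrite inE => /cubesr.
    rewrite mulr0 subr0.
    have h : peak x y ^+ N <= k1 ^+ N.
      by rewrite lerXn2r ?nnegrE ?peak_ge0//; apply: peak_far => //; exact: ltW.
    have : - (`|W y| * peak x y ^+ N) <= W y * peak x y ^+ N.
      by rewrite -mulNr ler_wpM2r// lerNl; rewrite -normrN ler_norm.
    have : `|W y| * peak x y ^+ N <= k1 ^+ N * `|W y| by rewrite mulrC ler_wpM2r.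
    lra.
  have Wy : del <= W y.
    have cr1 : cube x d1 y.
      by move/cubeP: cr => cr; apply/cubeP => w; exact: lt_le_trans (cr w) r1.
    have cr2 : cube x d2 y.
      by move/cubeP: cr => cr; apply/cubeP => w; exact: lt_le_trans (cr w) r2.
    have := h1 y Oy cr1; have := h2 y Oy cr2; have := tail m y nm.
    rewrite /W Uy// !ltr_norml ler_norml /del; lra.
  have [cs|ncs] := pselect (cube x s y).
    have -> : \1_(cube x s) y = 1 :> R by rewrite indicE mem_set.
    rewrite mulr1.
    have h : k2 ^+ N <= peak x y ^+ N.
      rewrite lerXn2r ?nnegrE ?peak_ge0//; first exact: le_trans k10 (ltW conc).
      exact: peak_near.
    have : del * k2 ^+ N <= W y * peak x y ^+ N.
      apply: ler_pM => //; first exact: ltW.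
      by rewrite exprn_ge0// (le_trans k10 (ltW conc)).
    lra.
  have -> : \1_(cube x s) y = 0 :> R.
    by rewrite indicE memNset.
  rewrite mulr0 subr0 addr_ge0// mulr_ge0//.
  exact: le_trans (ltW del0) Wy.
have : k1 ^+ N * \int[vol R]_(y in Om) `|W y| <= k1 ^+ N * M.
  by rewrite ler_wpM2l// exprn_ge0.
rewrite [del * k2 ^+ N * _]mulrAC in key.
lra.
Qed.

End InteriorInversion.

Section Inversion.
Context {R : realType}.
Local Notation Om := (@Omega R).
Implicit Types (k x y : pt R) (u : pt R -> R) (v w : 'I_3) (th : R).

Lemma fourier_sumZ n u (c : R) x : integrableO u -> fourier_sum n (fun y => c * u y) x = c * fourier_sum n u x.
Proof.
move=> iu; rewrite /fourier_sum mulrCA; congr (_ * _); rewrite /freq_sum.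
rewrite mulr_sumr; apply: eq_bigr => i _; rewrite mulr_sumr; apply: eq_bigr => j _.
by rewrite mulr_sumr; apply: eq_bigr => l _; rewrite /mode fcoefZ.
Qed.

(** The opposite inequality comes from the same argument for - u. *)
Lemma inversion_interior u U n (e : R) x : integrableO U ->
  {ae vol R, forall y, Om y -> U y = u y} -> {within Om, continuous u} ->
  (forall m y, (n <= m)%N -> `|fourier_sum m U y - fourier_sum n U y| <= e) ->
  (forall w, 0 < coordinate w x < 2 * pi) ->
  `|u x - fourier_sum n U x| <= e.
Proof.
move=> iU Uu cu tail xint.
have h1 := inversion_interior_le iU Uu cu tail xint.
have iU' : integrableO (fun y => -1 * U y) by exact: integrableOZ.
have Uu' : {ae vol R, forall y, Om y -> -1 * U y = (-1 * u y : R)}.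
  by apply: (ae_imply Uu) => y + Oy => ->.
have cu' : {within Om, continuous (fun y => -1 * u y)}.
  by move=> y; apply: cvgM; [exact: cvg_cst|exact: cu].
have tail' m y : (n <= m)%N -> `|fourier_sum m (fun y => -1 * U y) y - fourier_sum n (fun y => -1 * U y) y| <= e.
  by move=> nm; rewrite !fourier_sumZ// -mulrBr normrM normrN1 mul1r tail.
have := inversion_interior_le iU' Uu' cu' tail' xint.
by rewrite fourier_sumZ// ler_norml h1; lra.
Qed.

(** Both sides are continuous up to the boundary, and every point of the box is a
limit of interior points on the segment to its centre. *)
Lemma inversion u U n (e : R) x : integrableO U ->
  {ae vol R, forall y, Om y -> U y = u y} -> {within Om, continuous u} ->
  (forall m y, (n <= m)%N -> `|fourier_sum m U y - fourier_sum n U y| <= e) ->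
  Om x -> `|u x - fourier_sum n U x| <= e.
Proof.
move=> iU Uu cu tail Ox; rewrite leNgt; apply/negP => hx.
pose del := (`|u x - fourier_sum n U x| - e) / 2.
have del0 : 0 < del by rewrite divr_gt0// subr_gt0.
have [d1 d10 h1] := within_cube cu Ox del0.
have [d2 d20 h2] := within_cube (continuous_subspaceT (@continuous_fourier_sum _ n _ iU)) Ox del0.
have p0 : 0 < pi :> R by exact: pi_gt0.
pose d := Num.min d1 d2.
have d0 : 0 < d by rewrite lt_min d10.
(* Moving from x towards the centre (pi, pi, pi) by the ratio s changes each
   coordinate by at most s pi < d. *)
pose s := d / (d + 2 * pi).
have D0 : 0 < d + 2 * pi by rewrite addr_gt0// mulr_gt0.
have s0 : 0 < s by rewrite divr_gt0.
have s1 : s < 1 by rewrite ltr_pdivrMr// mul1r ltrDl mulr_gt0.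
have sd : s * pi < d.
  by rewrite /s mulrAC ltr_pdivrMr// ltr_pM2l// ltr_wpDl ?(ltW d0)// ltr_pMl// ltr1n.
pose y : pt R := (x.1.1 + s * (pi - x.1.1), x.1.2 + s * (pi - x.1.2), x.2 + s * (pi - x.2)).
have yE w : coordinate w y = coordinate w x + s * (pi - coordinate w x).
  by rewrite /coordinate; case: (I3_cases w) => ->.
move/OmegaP: (Ox) => xO.
have yi w : 0 < coordinate w y < 2 * pi.
  rewrite yE; have := xO w; move: (coordinate w x) => a /andP[a0 a1].
  apply/andP; split.
    rewrite (_ : a + s * (pi - a) = (1 - s) * a + s * pi); last by ring.
    by apply: ltr_wpDl; [apply: mulr_ge0; rewrite // subr_ge0 ltW|exact: mulr_gt0].
  rewrite -subr_gt0 (_ : 2 * pi - (a + s * (pi - a)) = (1 - s) * (2 * pi - a) + s * pi); last by ring.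
  by apply: ltr_wpDl; [apply: mulr_ge0; rewrite // subr_ge0 // ltW|exact: mulr_gt0].
have yd w : `|coordinate w y - coordinate w x| < d.
  rewrite yE addrAC subrr add0r normrM (gtr0_norm s0); apply: le_lt_trans sd.
  rewrite ler_pM2l// ler_norml; have := xO w; lra.
have Oy : Om y by apply/OmegaP => w; have /andP[/ltW-> /ltW->] := yi w.
have c1 : cube x d1 y.
  by apply/cubeP => w; apply: lt_le_trans (yd w) _; rewrite ge_min lexx.
have c2 : cube x d2 y.
  by apply/cubeP => w; apply: lt_le_trans (yd w) _; rewrite ge_min lexx orbT.
have H := inversion_interior iU Uu cu tail yi.
have := h1 y Oy c1; have := h2 y Oy c2.
have := ler_normD (u y - fourier_sum n U y) ((u x - u y) + (fourier_sum n U y - fourier_sum n U x)).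
have := ler_normD (u x - u y) (fourier_sum n U y - fourier_sum n U x).
rewrite (_ : u y - fourier_sum n U y + (u x - u y + (fourier_sum n U y - fourier_sum n U x)) = u x - fourier_sum n U x); last by ring.
rewrite (distrC (u x)) /del; lra.
Qed.

End Inversion.

(** * Maxwell's equations for the Fourier coefficients *)

Section MaxwellCoef.
Context {R : realType}.
Local Notation Om := (@Omega R).
Implicit Types (k x y : pt R) (u : pt R -> R) (v w : 'I_3) (th T : R).

Lemma fcoef_curl r (c : R) (B : 'I_3 -> jet R) (u : 'I_3 -> pt R -> R) (f : pt R -> R) w k th :
  (0 < r)%N -> (forall v, Hp_jet r (u v) (B v)) -> integrableO f ->
  {ae vol R, forall x, Om x -> f x = c * curl B w x} -> intvec k ->
  fcoef f k th = c * (coordinate (w + 1) k * fcoef (B (w + 2) mi0) k (th - pi / 2) -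
                  coordinate (w + 2) k * fcoef (B (w + 1) mi0) k (th - pi / 2)).
Proof.
move=> r0 HB iF fE ik.
have i1 v v' : integrableO (B v (mi1 v')).
  by apply: L2_integrableO; apply: Hp_jet_L2 (HB v) _; rewrite mi_size1.
have FE v v' : fcoef (B v (mi1 v')) k th = coordinate v' k * fcoef (B v mi0) k (th - pi / 2).
  by rewrite (fcoef_jet th (HB v)) ?mi_size1// kpow1 mul1r.
rewrite (fcoef_ae k th iF _ fE); last exact/integrableOZ/integrableOB.
by rewrite fcoefZ ?fcoefB// ?FE//; exact: integrableOB.
Qed.

Lemma fcoef_shift_pi u k th : integrableO u -> fcoef u k (th - pi / 2 - pi / 2) = - fcoef u k th.
Proof.
move=> iu; rewrite fcoef_phase// [in RHS]fcoef_phase// cosBpihalf !sinBpihalf cosBpihalf; ring.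
Qed.

(** One half of the evolution equations; the roles of A and B are exchanged in the
other half. *)
Definition curl_law (c T : R) (A B : 'I_3 -> nat -> R -> jet R) : Prop :=
  forall t, 0 <= t <= T -> forall w,
    {ae vol R, forall x, Om x -> A w 1%N t mi0 x = c * curl (fun v => B v 0%N t) w x}.

Definition div_law (T : R) (A : 'I_3 -> nat -> R -> jet R) : Prop :=
  forall t, 0 <= t <= T ->
    {ae vol R, forall x, Om x -> \sum_(w < 3) A w 0%N t (mi1 w) x = 0}.

Lemma Ck_integrableO n r T (uV : R -> pt R -> R) V i t : Ck_Hp n r T uV V -> (i <= n)%N -> 0 <= t <= T ->
  integrableO (V i t mi0).
Proof.
move=> [_ HV _ _] i_n tT; apply: L2_integrableO; apply: Hp_jet_L2 (HV i t i_n tT) _.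
by rewrite mi_size0.
Qed.

(** For i = 0 this is the equation itself.  The time derivatives of the jets are
not assumed to satisfy it: for higher i the identity between coefficients is
differentiated in time, and derivatives on [0,T] are unique. *)
Lemma fcoef_curl_law n r (c T : R) (uA uB : 'I_3 -> R -> pt R -> R) A B :
  0 < T -> (0 < r)%N ->
  (forall w, Ck_Hp n r T (uA w) (A w)) -> (forall w, Ck_Hp n r T (uB w) (B w)) ->
  curl_law c T A B ->
  forall i w k th t, (i < n)%N -> 0 <= t <= T -> intvec k ->
  fcoef (A w i.+1 t mi0) k th =
  c * (coordinate (w + 1) k * fcoef (B (w + 2) i t mi0) k (th - pi / 2) -
       coordinate (w + 2) k * fcoef (B (w + 1) i t mi0) k (th - pi / 2)).
Proof.
move=> T0 r0 CA CB AB i w k th + + + ik; elim: i => [|i IH] t i_n tT.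
  apply: (@fcoef_curl r c (fun v => B v 0%N t) (fun v => uB v t)) => //.
  - by move=> v; have [+ _ _ _] := CB v; apply.
  - exact: Ck_integrableO (CA w) i_n tT.
  - exact: AB.
pose g t := c * (coordinate (w + 1) k * fcoef (B (w + 2) i t mi0) k (th - pi / 2) +
       (-1) * (coordinate (w + 2) k * fcoef (B (w + 1) i t mi0) k (th - pi / 2))).
pose g' t := c * (coordinate (w + 1) k * fcoef (B (w + 2) i.+1 t mi0) k (th - pi / 2) +
       (-1) * (coordinate (w + 2) k * fcoef (B (w + 1) i.+1 t mi0) k (th - pi / 2))).
have dg : deriv_on T g g'.
  apply: deriv_onZ; apply: deriv_onD; first by apply: deriv_onZ; exact: Ck_deriv_on (CB _) (ltnW i_n).
  by do 2!apply: deriv_onZ; exact: Ck_deriv_on (CB _) (ltnW i_n).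
have dA := Ck_deriv_on k th (CA w) i_n.
have dA' : deriv_on T (fun t => fcoef (A w i.+1 t mi0) k th) g'.
  apply: deriv_on_ext dg => // s sT.
  by rewrite /g mulN1r IH ?(ltnW i_n).
by rewrite (deriv_on_unique T0 dA dA' tT) /g' mulN1r.
Qed.

Lemma fcoef_div_law n r (T : R) (uA : 'I_3 -> R -> pt R -> R) A k th t :
  (0 < r)%N -> (forall w, Ck_Hp n r T (uA w) (A w)) -> div_law T A ->
  0 <= t <= T -> intvec k ->
  \sum_(w < 3) coordinate w k * fcoef (A w 0%N t mi0) k th = 0.
Proof.
move=> r0 CA HA tT ik.
have HJ w : Hp_jet r (uA w t) (A w 0%N t) by have [+ _ _ _] := CA w; apply.
have iA w : integrableO (A w 0%N t (mi1 w)).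
  by apply: L2_integrableO; apply: Hp_jet_L2 (HJ w) _; rewrite mi_size1.
have [iS ES] := fcoef_sum (index_enum 'I_3) k (th + pi / 2) iA.
have i0 : integrableO (fun _ : pt R => 0 : R) by apply: integrableO_continuous => x; exact: cvg_cst.
have := fcoef_ae k (th + pi / 2) iS i0 (HA t tT).
rewrite ES => H.
transitivity (fcoef (fun _ : pt R => 0 : R) k (th + pi / 2)).
  rewrite -H; apply: eq_bigr => w _.
  by rewrite (fcoef_jet (a := mi1 w) _ (HJ w)) ?mi_size1// kpow1 mul1r addrK.
rewrite /fcoef; under eq_Rintegral do rewrite mul0r.
by rewrite (Rintegral_cst _ measurable_Omega) mul0r.
Qed.

Definition normsq k : R := \sum_(w < 3) coordinate w k ^+ 2.

Lemma sum3E (f : 'I_3 -> R) : \sum_(w < 3) f w = f 0 + f 1 + f 2.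
Proof.
rewrite !big_ord_recr big_ord0 /= add0r.
by congr (f _ + f _ + f _); exact/val_inj.
Qed.

Lemma I3_add : [/\ (0 + 1 = 1 :> 'I_3), (0 + 2 = 2 :> 'I_3), (1 + 1 = 2 :> 'I_3) &
   [/\ (1 + 2 = 0 :> 'I_3), (2 + 1 = 0 :> 'I_3) & (2 + 2 = 1 :> 'I_3)]].
Proof. by split; try split; exact/val_inj. Qed.

(** curl curl = grad div - Laplacian: applying the two curl laws in succession
gives c c' (|k|^2 f - k (k . f)), and the divergence law removes the last term.  Higher i follow by differentiation in time. *)
Lemma fcoef_wave_law n r (c c' T : R) (uA uB : 'I_3 -> R -> pt R -> R) A B :
  0 < T -> (0 < r)%N ->
  (forall w, Ck_Hp n r T (uA w) (A w)) -> (forall w, Ck_Hp n r T (uB w) (B w)) ->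
  curl_law c T A B -> curl_law c' T B A -> div_law T A ->
  forall i w k th t, (i.+1 < n)%N -> 0 <= t <= T -> intvec k ->
  fcoef (A w i.+2 t mi0) k th = c * c' * normsq k * fcoef (A w i t mi0) k th.
Proof.
move=> T0 r0 CA CB AB BA dA i w k th + + + ik; elim: i => [|i IH] t i_n tT.
  rewrite (fcoef_curl_law T0 r0 CA CB AB)// !(fcoef_curl_law T0 r0 CB CA BA) ?(ltnW i_n)//.
  have iA v : integrableO (A v 0%N t mi0) by exact: Ck_integrableO (CA v) _ tT.
  have := fcoef_div_law th r0 CA dA tT ik.
  rewrite !fcoef_shift_pi// /normsq !sum3E.
  have [e1 e2 e3 [e4 e5 e6]] := I3_add.
  move=> H.
  case: (I3_cases w) => ->; rewrite !(e1, e2, e3, e4, e5, e6, add0r).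
  - apply/eqP; rewrite -subr_eq0; apply/eqP.
    by rewrite -[RHS](mulr0 (- c * c' * coordinate 0 k)) -H; ring.
  - apply/eqP; rewrite -subr_eq0; apply/eqP.
    by rewrite -[RHS](mulr0 (- c * c' * coordinate 1 k)) -H; ring.
  - apply/eqP; rewrite -subr_eq0; apply/eqP.
    by rewrite -[RHS](mulr0 (- c * c' * coordinate 2 k)) -H; ring.
have dA0 : deriv_on T (fun t => c * c' * normsq k * fcoef (A w i t mi0) k th)
    (fun t => c * c' * normsq k * fcoef (A w i.+1 t mi0) k th).
  by apply: deriv_onZ; apply: Ck_deriv_on (CA w) _; exact: ltnW (ltnW i_n).
have dA2 := Ck_deriv_on k th (CA w) i_n.
have dA' : deriv_on T (fun t => fcoef (A w i.+2 t mi0) k th)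
    (fun t => c * c' * normsq k * fcoef (A w i.+1 t mi0) k th).
  by apply: deriv_on_ext dA0 => // s sT; rewrite IH// ltnW.
exact: deriv_on_unique T0 dA2 dA' t tT.
Qed.

(** The seventh derivative is bounded in H^r by compactness of [0,T]; the sixth is
bounded by its value at 0 and the mean value theorem.  The exponents 0 and r
are the two that decay estimates use: the former for k_w = 0, the latter
otherwise. *)
Lemma Ck_coef_bounds r T (uV : R -> pt R -> R) V : 0 <= T -> Ck_Hp 7 r T uV V ->
  exists B, forall n w k th t, (n == 0%N) || (n == r) -> intvec k -> 0 <= t <= T ->
    `|coordinate w k| ^+ n * `|fcoef (V 7 t mi0) k th| <= B /\
    `|coordinate w k| ^+ n * `|fcoef (V 6 t mi0) k th| <= B.
Proof.
move=> T0 CV; have [_ HV _ _] := CV.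
have TT : (0 : R) <= 0 <= T by apply/andP; split.
have H n w : (n <= r)%N -> exists B, 0 <= B /\ forall k th t, intvec k -> 0 <= t <= T ->
    `|coordinate w k| ^+ n * `|fcoef (V 7 t mi0) k th| <= B /\
    `|coordinate w k| ^+ n * `|fcoef (V 6 t mi0) k th| <= B.
  move=> nr; have ar : (mi_size (mi_pure n w) <= r)%N by rewrite mi_size_pure.
  have [B7 HB7] := Ck_L1_bounded CV ar.
  pose B6 := \int[vol R]_(x in Om) `|V 6 0 (mi_pure n w) x|.
  have B60 : 0 <= B6 by exact: Rintegral_ge0.
  have B70 : 0 <= B7 by apply: le_trans (HB7 0 TT); exact: Rintegral_ge0.
  have h7 k th t : intvec k -> 0 <= t <= T ->
      `|coordinate w k| ^+ n * `|fcoef (V 7 t mi0) k th| <= B7.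
    move=> ik tT; apply: le_trans (HB7 t tT).
    exact: fcoef_jet_pow_le (HV 7 t _ tT) nr ik.
  exists (B7 + (B6 + B7 * T)); split; first by rewrite !addr_ge0// mulr_ge0.
  move=> k th t ik tT; split.
    by apply: (le_trans (h7 k th t ik tT)); rewrite lerDl addr_ge0// mulr_ge0.
  have /andP[t0 t1] := tT.
  have h6 : `|coordinate w k| ^+ n * `|fcoef (V 6 0 mi0) k th| <= B6.
    exact: fcoef_jet_pow_le (HV 6 0 _ TT) nr ik.
  have [cc /andP[c0 ct] E] := deriv_on_MVT (Ck_deriv_on k th CV (ltnSn 6)) (lexx 0) t0 t1.
  have h7c := h7 k th cc ik _.
  have {}h7c : `|coordinate w k| ^+ n * `|fcoef (V 7 cc mi0) k th| <= B7.
    by apply: h7c; rewrite c0 (le_trans ct).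
  have E6 : fcoef (V 6 t mi0) k th = fcoef (V 6 0 mi0) k th + fcoef (V 7 cc mi0) k th * t.
    by rewrite -[t in RHS]subr0 -E subrKC.
  rewrite E6; set p := `|coordinate w k| ^+ n in h6 h7c *.
  have p0 : 0 <= p by rewrite exprn_ge0.
  have s1 : p * `|fcoef (V 6 0 mi0) k th + fcoef (V 7 cc mi0) k th * t| <=
      p * `|fcoef (V 6 0 mi0) k th| + p * `|fcoef (V 7 cc mi0) k th| * t.
    rewrite -mulrA -mulrDr ler_wpM2l// (le_trans (ler_normD _ _))//.
    by rewrite normrM (ger0_norm t0).
  have s2 : p * `|fcoef (V 7 cc mi0) k th| * t <= B7 * T by apply: ler_pM; rewrite ?mulr_ge0.
  lra.
have [B H'] : exists B : nat -> 'I_3 -> R, forall n w, (n <= r)%N -> 0 <= B n w /\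
    forall k th t, intvec k -> 0 <= t <= T ->
    `|coordinate w k| ^+ n * `|fcoef (V 7 t mi0) k th| <= B n w /\
    `|coordinate w k| ^+ n * `|fcoef (V 6 t mi0) k th| <= B n w.
  have /choice[B HB] : forall nw : nat * 'I_3, exists B, (nw.1 <= r)%N -> 0 <= B /\
    forall k th t, intvec k -> 0 <= t <= T ->
    `|coordinate nw.2 k| ^+ nw.1 * `|fcoef (V 7 t mi0) k th| <= B /\
    `|coordinate nw.2 k| ^+ nw.1 * `|fcoef (V 6 t mi0) k th| <= B.
    move=> [n w]; have [nr|] := leqP n r; last by exists 0.
    by have [B HB] := H n w nr; exists B.
  by exists (fun n w => B (n, w)) => n w; exact: HB (n, w).
exists (\sum_(w < 3) (B 0%N w + B r w)) => n w k th t nr ik tT.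
have Bw : forall w, 0 <= B 0%N w + B r w.
  by move=> v; rewrite addr_ge0//; [have [] := H' 0%N v (leq0n r)|have [] := H' r v (leqnn r)].
have nr' : (n <= r)%N by case/orP: nr => /eqP ->.
have [_ /(_ k th t ik tT)[h7 h6]] := H' n w nr'.
have le : B n w <= \sum_(w < 3) (B 0%N w + B r w).
  rewrite (bigD1 w)//=; apply: (@le_trans _ _ (B 0%N w + B r w)).
    case/orP: nr => /eqP ->; [rewrite lerDl|rewrite lerDr].
      by have [] := H' r w (leqnn r).
    by have [] := H' 0%N w (leq0n r).
  by rewrite lerDl sumr_ge0.
by split; [apply: le_trans h7 le|apply: le_trans h6 le].
Qed.

End MaxwellCoef.

(** * Exactness of the Fourier differentiation matrix *)

Section Differentiation1D.
Context {R : realType}.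
Implicit Types (a b : R).

Lemma cosDpin a (n : nat) : cos (a + pi * n%:R) = (-1) ^+ n * cos a.
Proof.
elim: n => [|n IH]; first by rewrite mulr0 addr0 expr0 mul1r.
rewrite (_ : a + pi * n.+1%:R = (a + pi * n%:R) + pi); last by rewrite -natr1; ring.
by rewrite cosDpi IH exprS mulN1r mulNr.
Qed.

Lemma cosBpin a (n : nat) : cos (a - pi * n%:R) = (-1) ^+ n * cos a.
Proof. by rewrite -cosN opprB addrC -[a in RHS]opprK cosN -cosDpin addrC. Qed.

Lemma sinDpin a (n : nat) : sin (a + pi * n%:R) = (-1) ^+ n * sin a.
Proof.
elim: n => [|n IH]; first by rewrite mulr0 addr0 expr0 mul1r.
rewrite (_ : a + pi * n.+1%:R = (a + pi * n%:R) + pi); last by rewrite -natr1; ring.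
by rewrite sinDpi IH exprS mulN1r mulNr.
Qed.

Lemma cotDpi_int a (q : R) : q \is a Num.int ->
  cos (a + pi * q) / sin (a + pi * q) = cos a / sin a.
Proof.
have H (b : R) (n : nat) : cos (b + pi * n%:R) / sin (b + pi * n%:R) = cos b / sin b.
  rewrite cosDpin sinDpin invfM mulrACA mulfV ?mul1r//.
  by rewrite expf_neq0// oppr_eq0 oner_eq0.
move=> /intrP[[n|n] ->]; first exact: H.
rewrite NegzE -[RHS](H _ n.+1) -(H _ n.+1) -addrA.
by rewrite (_ : pi * (- n.+1%:Z)%:~R + pi * n.+1%:R = 0) ?addr0 ?H//; rewrite mulrNz -pmulrn; ring.
Qed.

Section Row.
Context (N : nat) (j : 'I_N) (N0 : (0 < N)%N) (Neven : ~~ odd N).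
Local Notation h := (grid_step R N).

Let NR : N%:R != 0 :> R. Proof. by rewrite pnatr_eq0 -lt0n. Qed.

Lemma grid_stepN : N%:R * h = 2 * pi.
Proof. by rewrite /grid_step mulrCA divff ?mulr1. Qed.

(** Multiplied by 2 sin (p h / 2), the terms become differences of consecutive sines,
and the telescoped sum runs over a whole period. *)
Lemma cos_row_sum (p : nat) : (0 < p < N)%N ->
  \sum_(l < N) cos (p%:R * (node R j - node R l)) = 0.
Proof.
move=> /andP[p0 pN].
have s0 : sin (p%:R * h / 2) != 0.
  rewrite gt_eqF// sin_gt0_pi//.
  have -> : p%:R * h / 2 = pi * (p%:R / N%:R) by rewrite /grid_step; field.
  have pi0 := @pi_gt0 R.
  rewrite mulr_gt0 ?divr_gt0 ?ltr0n//= -[ltRHS]mulr1 ltr_pM2l//.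
  by rewrite ltr_pdivrMr ?ltr0n// mul1r ltr_nat.
apply/eqP; rewrite -(mulrI_eq0 _ (mulfI (mulf_neq0 (_ : 2 != 0) s0))) ?pnatr_eq0//.
pose s (l : nat) := sin (p%:R * (node R j - l%:R * h) + p%:R * h / 2).
rewrite mulr_sumr (eq_bigr (fun l : 'I_N => - (s l.+1 - s l))); last first.
  move=> l _; rewrite /s -[l.+1%:R]natr1 /node.
  rewrite (_ : p%:R * (j%:R * h - (l%:R + 1) * h) + p%:R * h / 2 =
    p%:R * (j%:R * h - l%:R * h) - p%:R * h / 2); last by field.
  by rewrite sinB sinD; ring.
rewrite sumrN -(big_mkord xpredT (fun l => s l.+1 - s l)) telescope_sumr//.
have -> : s N = s 0%N; last by rewrite subrr oppr0.
rewrite /s mul0r subr0 grid_stepN.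
rewrite (_ : _ + p%:R * h / 2 = (p%:R * node R j + p%:R * h / 2) - pi * (2 * p)%:R).
  have := sinDpin (p%:R * node R j + p%:R * h / 2 - pi * (2 * p)%:R) (2 * p).
  by rewrite subrK exprM sqrrN expr1n expr1n mul1r => <-.
by rewrite natrM; ring.
Qed.

(** The sign (-1)^(j+l) shifts the frequency by N / 2, because N h / 2 = pi. *)
Lemma alternating_row_sum (k : nat) : (k < N./2)%N ->
  \sum_(l < N) (-1) ^+ (j + l) * cos (k%:R * (node R j - node R l)) = 0.
Proof.
move=> kN; have NE : N = (N./2).*2 by rewrite -[LHS]odd_double_half (negbTE Neven).
rewrite -[RHS](@cos_row_sum (k + N./2)); last first.
  by rewrite addn_gt0 orbC (leq_ltn_trans _ kN)//= {2}NE -addnn ltn_add2r.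
apply: eq_bigr => l _.
have Nh : N./2%:R * h = pi.
  have := grid_stepN; rewrite {1}NE -muln2 natrM => H.
  by apply: (mulfI (_ : 2 != 0)); rewrite ?pnatr_eq0// -H; ring.
have -> : (k + N./2)%:R * (node R j - node R l) = k%:R * (node R j - node R l) + pi * j%:R - pi * l%:R.
  by rewrite natrD mulrDl -Nh /node; ring.
by rewrite cosBpin cosDpin mulrA -exprD addnC.
Qed.

Lemma sin_half_neq0 (l : 'I_N) : j != l -> sin ((node R j - node R l) / 2) != 0.
Proof.
move=> jl.
have H (m n : nat) : (n < m)%N -> (m < N)%N -> sin ((m%:R * h - n%:R * h) / 2) != 0.
  move=> nm mN; have -> : (m%:R * h - n%:R * h) / 2 = pi * ((m - n)%N%:R / N%:R).
    by rewrite natrB ?(ltnW nm)// /grid_step; field.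
  have d0 : (0 < m - n)%N by rewrite subn_gt0.
  have pi0 := @pi_gt0 R.
  rewrite gt_eqF// sin_gt0_pi// mulr_gt0 ?divr_gt0 ?ltr0n//= -[ltRHS]mulr1 ltr_pM2l//.
  by rewrite ltr_pdivrMr ?ltr0n// mul1r ltr_nat (leq_ltn_trans (leq_subr n m)).
case: (ltngtP l j) => [lj|lj|/val_inj lj].
- exact: H.
- have -> : (node R j - node R l) / 2 = - ((node R l - node R j) / 2) by field.
  by rewrite sinN oppr_eq0; exact: H.
- by rewrite lj eqxx in jl.
Qed.

Definition row_coef (l : 'I_N) : R := D1mx R N j l.

(** By induction on k: the increment sin ((k+1) th) - sin (k th) is
2 cos ((k + 1/2) th) sin (th / 2), whose sine cancels the denominator of the
cotangent, and cos ((k + 1/2) th) cos (th / 2) is half of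
cos ((k+1) th) + cos (k th).  There remain two alternating sums, which vanish
when the missing diagonal term 1 is added. *)
Lemma D1mx_sin_sum (k : nat) : (k < N./2)%N ->
  \sum_(l < N) row_coef l * sin (k%:R * (node R j - node R l)) = - k%:R.
Proof.
elim: k => [|k IH] kN.
  by rewrite big1 ?oppr0// => l _; rewrite mul0r sin0 mulr0.
have Hk := alternating_row_sum (ltnW kN).
have Hk1 := alternating_row_sum kN.
suff : \sum_(l < N) row_coef l * sin (k.+1%:R * (node R j - node R l)) -
       \sum_(l < N) row_coef l * sin (k%:R * (node R j - node R l)) = -1.
  by rewrite (IH (ltnW kN)) -natr1 opprK; lra.
rewrite -sumrB.
(* The diagonal entry of D1mx is zero, whereas the alternating sums contain the
   term 1 at l = j; hence the two subtractions of 1. *)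
transitivity (2^-1 * (\sum_(l < N) (-1) ^+ (j + l) * cos (k.+1%:R * (node R j - node R l)) - 1
    + (\sum_(l < N) (-1) ^+ (j + l) * cos (k%:R * (node R j - node R l)) - 1))); last first.
  by rewrite Hk Hk1; field.
rewrite (bigD1 j)//= [in RHS](bigD1 j)//= [X in _ = _ * (_ + (X - _))](bigD1 j)//=.
rewrite !subrr !mulr0 sin0 cos0 mulr0 subrr add0r mulr1.
rewrite addnn -signr_odd odd_double expr0.
rewrite ![1 + _]addrC !addrK mulrDr !mulr_sumr -big_split /=.
apply: eq_bigr => l lj.
rewrite /row_coef mxE (negbTE (_ : j != l)) 1?eq_sym//.
have s0 : sin ((node R j - node R l) / 2) != 0 by apply: sin_half_neq0; rewrite eq_sym.
cbv zeta; move: (node R j - node R l) s0 => th s0.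
have [A EA] : exists A, A = k%:R * th + th / 2 by eexists.
have -> : k.+1%:R * th = A + th / 2 by rewrite EA -natr1; field.
have -> : k%:R * th = A - th / 2 by rewrite EA; field.
rewrite sinD sinB cosD cosB.
move: (sin (th / 2)) s0 (cos (th / 2)) (sin A) (cos A) ((-1) ^+ (j + l) : R).
by move=> s s0 cc sA cA e; field.
Qed.

End Row.

(** The reflection l -> 2 j - l of the indices modulo N, lifted to natural numbers:
the quotient q keeps track of the multiples of the period. *)
Lemma reflect_val n (j l : 'I_n.+1) :
  exists q, (j + j + (n.+1 - l) = q * n.+1 + nat_of_ord (j + j - l)%R)%N.
Proof.
exists ((j + j + (n.+1 - l)) %/ n.+1)%N.
rewrite {1}(divn_eq (j + j + (n.+1 - l)) n.+1); congr (_ + _)%N.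
by rewrite /= modnDm.
Qed.

(** The reflection l -> 2 j - l about j leaves the cosine unchanged and reverses the
cotangent; N being even, the sign (-1)^(j+l) is well defined modulo N. *)
Lemma D1mx_cos_sum (N : nat) (j : 'I_N) (k : nat) : (0 < N)%N -> ~~ odd N ->
  \sum_(l < N) row_coef j l * cos (k%:R * (node R j - node R l)) = 0.
Proof.
case: N j => // n j _ Neven.
set S := \sum_(l < _) _.
suff : S = - S by move=> E; lra.
have rinj : injective (fun l : 'I_n.+1 => j + j - l) by move=> a b /addrI/oppr_inj.
rewrite {1}/S (reindex_inj rinj) /S -sumrN; apply: eq_bigr => l _.
have [q Hq] := reflect_val j l.
rewrite /row_coef !mxE; cbv zeta.
have [jl|jl] := eqVneq j l.
  by rewrite -jl addrK eqxx !mul0r oppr0.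
have -> : (j == j + j - l) = false.
  by apply/negbTE; apply: contra jl; rewrite eq_sym -addrA addrC -subr_eq0 addrK subr_eq0.
set v := nat_of_ord (j + j - l) in Hq *.
have vE : v%:R = (2 * j)%:R + n.+1%:R - l%:R - q%:R * n.+1%:R :> R.
  have := congr1 (fun m : nat => m%:R : R) Hq.
  rewrite !natrD natrB ?(ltnW (ltn_ord l))// !natrM; lra.
have sg : (-1) ^+ (j + v) = (-1) ^+ (j + l) :> R.
  rewrite -signr_odd -[RHS]signr_odd; congr ((-1) ^+ nat_of_bool _).
  have := congr1 odd Hq; rewrite !oddD oddM oddB ?(ltnW (ltn_ord l))//.
  rewrite (negbTE Neven) andbF addbb /= => ->.
  by [].
have hE := @grid_stepN n.+1 (ltn0Sn n).
have E : node R j - v%:R * grid_step R n.+1 =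
   - (node R j - node R l) + 2 * pi * (q%:R - 1).
  rewrite vE /node natrM -hE; ring.
rewrite /node -/v -/(node R j) sg E.
set th := node R j - l%:R * _.
have -> : (- (node R j - node R l) + 2 * pi * (q%:R - 1)) / 2 = - (th / 2) + pi * (q%:R - 1).
  by rewrite /th /node; field.
have qi : (q%:R - 1 : R) \is a Num.int by rewrite rpredB ?rpred1 ?natr_int.
rewrite cotDpi_int// cosN sinN.
have -> : k%:R * (- (node R j - node R l) + 2 * pi * (q%:R - 1)) = - (k%:R * th) + 2 * pi * (k%:R * (q%:R - 1)).
  by rewrite /th /node; ring.
rewrite cosD2pi_int ?cosN; last by rewrite rpredM ?natr_int.
by rewrite invrN !(mulrN, mulNr).
Qed.

(** Exactness of the differentiation matrix below the Nyquist frequency. *)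
Lemma D1mx_wave (N : nat) (j : 'I_N) (m a : R) : (0 < N)%N -> ~~ odd N ->
  m \is a Num.int -> `|m| < N%:R / 2 ->
  \sum_(l < N) D1mx R N j l * cos (m * node R l + a) = m * cos (m * node R j + a + pi / 2).
Proof.
move=> N0 Ne mint mN; rewrite cosDpihalf.
have H (k : nat) (b : R) : (k < N./2)%N ->
    \sum_(l < N) D1mx R N j l * cos (k%:R * node R l + b) = - (k%:R * sin (k%:R * node R j + b)).
  move=> kN.
  have hS := D1mx_sin_sum j N0 Ne kN; have hC := D1mx_cos_sum j k N0 Ne.
  set be := k%:R * node R j + b.
  transitivity (cos be * (\sum_(l < N) row_coef j l * cos (k%:R * (node R j - node R l))) +
     sin be * \sum_(l < N) row_coef j l * sin (k%:R * (node R j - node R l))).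
    rewrite !mulr_sumr -big_split/=; apply: eq_bigr => l _.
    rewrite (_ : k%:R * node R l + b = be - k%:R * (node R j - node R l)); last by rewrite /be; ring.
    by rewrite cosB /row_coef; ring.
  by rewrite hC hS; ring.
have half : N%:R / 2 = N./2%:R :> R.
  by rewrite -[N in LHS]odd_double_half (negbTE Ne) add0n -muln2 natrM; field.
move: mint mN => /intrP[[k|k] ->].
  by rewrite normr_nat half ltr_nat => kN; rewrite H// mulrN.
rewrite NegzE mulrNz -pmulrn normrN normr_nat half ltr_nat => kN.
under eq_bigr => l _ do rewrite -cosN opprD mulNr opprK.
rewrite H// (_ : - k.+1%:R * node R j + a = - (k.+1%:R * node R j - a)); last by ring.
by rewrite sinN; ring.
Qed.

End Differentiation1D.

(** * Decay of the coefficients and truncation error *)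

Section Decay.
Context {R : realType}.
Implicit Types (k x y : pt R) (u : pt R -> R) (v w : 'I_3) (th T : R).

Definition maxfreq (i j l : nat) : nat := maxn (uphalf i) (maxn (uphalf j) (uphalf l)).

Lemma maxfreq_coordinate i j l : exists w, `|coordinate w (freqv i j l) : R| = (maxfreq i j l)%:R.
Proof.
rewrite /maxfreq.
have h0 : `|coordinate 0 (freqv i j l) : R| = (uphalf i)%:R by rewrite -norm_freq.
have h1 : `|coordinate 1 (freqv i j l) : R| = (uphalf j)%:R by rewrite -norm_freq.
have h2 : `|coordinate 2 (freqv i j l) : R| = (uphalf l)%:R by rewrite -norm_freq.
have [ij|ij] := leqP (uphalf i) (maxn (uphalf j) (uphalf l)).
  have [jl|jl] := leqP (uphalf j) (uphalf l).
    by exists 2; rewrite h2.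
  by exists 1; rewrite h1.
by exists 0; rewrite h0.
Qed.

(** Each weight is at least the inverse square of the largest frequency. *)
Lemma inv_sq_prod_ge i j l :
  (maxn 1 (maxfreq i j l))%:R ^- 6 <= inv_sq i * inv_sq j * inv_sq l :> R.
Proof.
have H a (m : nat) : (maxn 1 (uphalf a) <= m)%N -> (0 < m)%N -> m%:R ^- 2 <= inv_sq a :> R.
  move=> am m0; rewrite /inv_sq lef_pV2 ?posrE ?exprn_gt0 ?ltr0n ?leq_max//.
  by rewrite lerXn2r ?nnegrE// ler_nat.
set m := maxn 1 (maxfreq i j l).
have m0 : (0 < m)%N by rewrite leq_max.
have p a : 0 <= m%:R ^- 2 :> R by rewrite invr_ge0 exprn_ge0.
have -> : m%:R ^- 6 = m%:R ^- 2 * m%:R ^- 2 * m%:R ^- 2 :> R.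
  by rewrite -!invfM -!exprD.
have h a : (uphalf a <= maxfreq i j l)%N -> (maxn 1 (uphalf a) <= m)%N.
  by move=> al; rewrite geq_max leq_maxl (leq_trans al (leq_maxr _ _)).
apply: ler_pM => //; rewrite ?mulr_ge0//.
  apply: ler_pM => //; apply: H => //; apply: h; rewrite /maxfreq !leq_max leqnn ?orbT//.
by apply: H => //; apply: h; rewrite /maxfreq !leq_max leqnn !orbT.
Qed.

Lemma coordinate_sq_le_normsq w k : `|coordinate w k| ^+ 2 <= normsq k.
Proof.
rewrite /normsq (bigD1 w)//= real_normK ?num_real// lerDl.
by apply: sumr_ge0 => v _; exact: sqr_ge0.
Qed.

(** With M the largest component of the frequency, M^r |f| <= B and r >= 6 give
|f| <= B M^-6; at frequency zero the exponent n = 0 is used instead. *)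
Lemma mode_bound r (B : R) (U : pt R -> R) i j l x : (6 <= r)%N ->
  (forall n w k th, (n == 0%N) || (n == r) -> intvec k ->
    `|coordinate w k| ^+ n * `|fcoef U k th| <= B) ->
  `|mode U (freqv i j l) x| <= B * (inv_sq i * inv_sq j * inv_sq l).
Proof.
move=> r6 HB; have [w Hw] := maxfreq_coordinate i j l.
have ik := @intvec_freqv R i j l.
have B0 : 0 <= B.
  by apply: le_trans (HB 0%N 0 _ 0 isT ik); rewrite mulr_ge0 ?exprn_ge0.
rewrite /mode; have /= h0 := HB 0%N w _ (- dot (freqv i j l) x) isT ik.
have /= hr := HB r w _ (- dot (freqv i j l) x) _ ik; rewrite eqxx orbT in hr.
have {}hr := hr isT; rewrite expr0 mul1r in h0.
apply: (@le_trans _ _ (B * (maxn 1 (maxfreq i j l))%:R ^- 6)); last first.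
  by rewrite ler_wpM2l// inv_sq_prod_ge.
rewrite ler_pdivlMr ?exprn_gt0 ?ltr0n ?leq_max//.
case: (posnP (maxfreq i j l)) => m0.
  by rewrite m0 /= expr1n mulr1.
rewrite (maxn_idPr m0); move: hr; rewrite Hw => hr; apply: le_trans hr.
by rewrite mulrC ler_wpM2r// ler_weXn2l// ler1n.
Qed.

Lemma fourier_sum_bound r (B : R) (U : pt R -> R) n x : (6 <= r)%N ->
  (forall n w k th, (n == 0%N) || (n == r) -> intvec k ->
    `|coordinate w k| ^+ n * `|fcoef U k th| <= B) ->
  `|fourier_sum n U x| <= (2 * pi) ^- 3 * (B * 9 ^+ 3).
Proof.
move=> r6 HB; rewrite /fourier_sum normrM ger0_norm; last by rewrite invr_ge0 exprn_ge0// ltW// twopi_gt0.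
rewrite ler_wpM2l// ?invr_ge0 ?exprn_ge0 ?(ltW twopi_gt0)//.
have B0 : 0 <= B.
  apply: le_trans (HB 0%N 0 (freqv 0 0 0) 0 isT (@intvec_freqv R 0 0 0)).
  by rewrite mulr_ge0 ?exprn_ge0.
apply: (@freq_block_sum_bound R 0 n 0 n 0 n) => // i j l _ _ _; exact: (mode_bound _ _ _ _ r6 HB).
Qed.

(** Applied with U6 the sixth time derivative of U.  Dividing the bound of the
coefficients of U6, of order |k|^-r, by |k|^6 leaves a summable factor |k|^-6,
and the whole factor |k|^-r is available as n0^-r outside the cube. *)
Lemma fourier_sum_tail r (B kap : R) (U U6 : pt R -> R) n0 n m x : (0 < r)%N -> kap != 0 ->
  (0 < n0)%N -> n0 = uphalf n ->
  (forall k th, intvec k -> fcoef U6 k th = (kap * normsq k) ^+ 3 * fcoef U k th) ->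
  (forall n w k th, (n == 0%N) || (n == r) -> intvec k ->
    `|coordinate w k| ^+ n * `|fcoef U6 k th| <= B) ->
  (n <= m)%N ->
  `|fourier_sum m U x - fourier_sum n U x| <=
    (2 * pi) ^- 3 * (3 * (B * `|kap| ^- 3 * 9 ^+ 3)) * n0%:R ^- r.
Proof.
move=> r0 kap0 n00 n0E U6E HB nm; have kp : 0 < `|kap| by rewrite normr_gt0.
have p30 : 0 <= (2 * pi : R) ^- 3 by rewrite invr_ge0 exprn_ge0// ltW// twopi_gt0.
have B0 : 0 <= B.
  apply: le_trans (HB 0%N 0 (freqv 0 0 0) 0 isT (@intvec_freqv R 0 0 0)).
  by rewrite mulr_ge0 ?exprn_ge0.
pose A := B * `|kap| ^- 3 * n0%:R ^- r.
have A0 : 0 <= A by rewrite !mulr_ge0 ?invr_ge0 ?exprn_ge0.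
rewrite /fourier_sum -mulrBr normrM (ger0_norm p30) -mulrA ler_wpM2l//.
rewrite (_ : 3 * _ * _ = 3 * (A * 9 ^+ 3)); last by rewrite /A; ring.
apply: freq_sum_tail => // i j l out.
have [w Hw] := maxfreq_coordinate i j l; have ik := @intvec_freqv R i j l.
have up (a b : nat) : (a <= b)%N -> (uphalf a <= uphalf b)%N.
  by move=> ab; rewrite !uphalfE half_leq.
have M0 : (n0 <= maxfreq i j l)%N.
  move: out; rewrite !negb_and -!leqNgt n0E /maxfreq !leq_max.
  by case/or3P => /up ->; rewrite ?orbT.
have Mp : (0 < maxfreq i j l)%N by exact: leq_trans n00 M0.
have := HB r w _ (- dot (freqv i j l) x) _ ik; rewrite eqxx orbT => /(_ isT).
rewrite U6E// Hw -/(mode U (freqv i j l) x) normrM normrX normrM.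
set M := maxfreq i j l in M0 Mp Hw *; set f := `|mode _ _ _| => H.
have f0 : 0 <= f by exact: normr_ge0.
have MR : 0 < M%:R :> R by rewrite ltr0n.
have n0R : 0 < n0%:R :> R by rewrite ltr0n.
have kq : M%:R ^+ 2 <= `|normsq (freqv i j l) : R|.
  by rewrite -Hw; apply: le_trans (coordinate_sq_le_normsq w _) (ler_norm _).
have H1 : M%:R ^+ r * (`|kap| ^+ 3 * M%:R ^+ 6 * f) <= B.
  apply: le_trans H; rewrite ler_wpM2l ?exprn_ge0// ler_wpM2r ?normr_ge0//.
  rewrite exprMn ler_wpM2l ?exprn_ge0// (_ : M%:R ^+ 6 = (M%:R ^+ 2) ^+ 3); last by rewrite -exprM.
  by rewrite lerXn2r ?nnegrE.
apply: (@le_trans _ _ (A * M%:R ^- 6)); last first.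
  rewrite ler_wpM2l//; have := inv_sq_prod_ge i j l; by rewrite -/M (maxn_idPr Mp).
rewrite ler_pdivlMr ?exprn_gt0// /A ler_pdivlMr ?exprn_gt0// ler_pdivlMr ?exprn_gt0//.
apply: le_trans H1.
rewrite (_ : f * M%:R ^+ 6 * n0%:R ^+ r * `|kap| ^+ 3 = n0%:R ^+ r * (`|kap| ^+ 3 * M%:R ^+ 6 * f)); last by ring.
rewrite ler_wpM2r ?mulr_ge0 ?exprn_ge0//.
by rewrite lerXn2r ?nnegrE// ler_nat.
Qed.

End Decay.

(** * Discrete partial derivatives of Fourier partial sums *)

Section GridOperators.
Context {R : realType}.
Implicit Types (N : nat) (w : 'I_3) (k : pt R).

Lemma tens_sum (m n : nat) (f : 'I_(m * n) -> R) :
  \sum_p f p = \sum_(i < m) \sum_(j < n) f (mxtens_index (i, j)).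
Proof.
rewrite pair_big (reindex (@mxtens_index m n))/=.
  by apply: eq_bigr => -[i j].
exists (@mxtens_unindex m n) => p _; [exact: mxtens_indexK|exact: mxtens_unindexK].
Qed.

Lemma tens1l_apply (m n : nat) (B : 'M[R]_n) (v : 'I_(m * n) -> R) i j :
  \sum_p ((1%:M : 'M[R]_m) *t B) (mxtens_index (i, j)) p * v p =
  \sum_l B j l * v (mxtens_index (i, l)).
Proof.
rewrite tens_sum (bigD1 i)//= [X in _ + X]big1 ?addr0 => [|i' ii'].
  by apply: eq_bigr => l _; rewrite tensmxE mxE eqxx mul1r.
by apply: big1 => l _; rewrite tensmxE mxE eq_sym (negbTE ii') !mul0r.
Qed.

Lemma tens1r_apply (m n : nat) (A : 'M[R]_m) (v : 'I_(m * n) -> R) i j :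
  \sum_p (A *t (1%:M : 'M[R]_n)) (mxtens_index (i, j)) p * v p =
  \sum_k A i k * v (mxtens_index (k, j)).
Proof.
rewrite tens_sum; apply: eq_bigr => k _.
rewrite (bigD1 j)//= big1 ?addr0 => [|l lj].
  by rewrite tensmxE [1%:M _ _]mxE eqxx mulr1.
by rewrite tensmxE [1%:M _ _]mxE eq_sym (negbTE lj) mulr0 mul0r.
Qed.

Lemma tens11 (m n : nat) : (1%:M : 'M[R]_m) *t (1%:M : 'M[R]_n) = 1%:M.
Proof.
apply/matrixP => p q; rewrite -[p]mxtens_unindexK -[q]mxtens_unindexK.
case: (mxtens_unindex p) (mxtens_unindex q) => [a b] [c d].
by rewrite tensmxE !mxE (can_eq (@mxtens_indexK m n)) xpair_eqE -natrM mulnb.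
Qed.

Lemma grid_pointE N (m k j : 'I_N) :
  grid_point R (mxtens_index (mxtens_index (m, k), j)) = (node R j, node R k, node R m).
Proof. by rewrite /grid_point !mxtens_indexK. Qed.

Definition partial_mx N w : 'M[R]_(N * N * N) :=
  if w == 0 then Dx R N else if w == 1 then Dy R N else Dz R N.

Lemma partial_mx_wave N w k (a : R) : (0 < N)%N -> ~~ odd N -> intvec k ->
  `|coordinate w k| < N%:R / 2 -> forall i,
  \sum_p partial_mx N w i p * wave k a (grid_point R p) =
  coordinate w k * wave k (a + pi / 2) (grid_point R i).
Proof.
move=> N0 Ne ik kN i.
rewrite -[i]mxtens_unindexK; case: (mxtens_unindex i) => mk j.
rewrite -[mk]mxtens_unindexK; case: (mxtens_unindex mk) => m l {mk i}.
have kw := ik w.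
rewrite /partial_mx; case: (I3_cases w) kN kw => -> /= kN kw.
- rewrite /Dx tens11 tens1l_apply.
  under eq_bigr => q _ do rewrite grid_pointE.
  rewrite grid_pointE.
  have := D1mx_wave j (k.1.2 * node R l + k.2 * node R m + a) N0 Ne kw kN.
  rewrite /wave /dot /coordinate /= => H.
  transitivity (\sum_(l0 < N) D1mx R N j l0 * cos (k.1.1 * node R l0 + (k.1.2 * node R l + k.2 * node R m + a))).
    by apply: eq_bigr => q _; congr (_ * cos _); ring.
  by rewrite H; congr (_ * cos _); ring.
- rewrite /Dy tens1r_apply.
  have := @tens1l_apply N N (D1mx R N) (fun q => wave k a (grid_point R (mxtens_index (q, j)))) m l.
  move=> ->.
  under eq_bigr => q _ do rewrite grid_pointE.
  rewrite grid_pointE.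
  have := D1mx_wave l (k.1.1 * node R j + k.2 * node R m + a) N0 Ne kw kN.
  rewrite /wave /dot /coordinate /= => H.
  transitivity (\sum_(l0 < N) D1mx R N l l0 * cos (k.1.2 * node R l0 + (k.1.1 * node R j + k.2 * node R m + a))).
    by apply: eq_bigr => q _; congr (_ * cos _); ring.
  by rewrite H; congr (_ * cos _); ring.
- rewrite /Dz tens1r_apply.
  have := @tens1r_apply N N (D1mx R N) (fun q => wave k a (grid_point R (mxtens_index (q, j)))) m l.
  move=> ->.
  under eq_bigr => q _ do rewrite grid_pointE.
  rewrite grid_pointE.
  have := D1mx_wave m (k.1.1 * node R j + k.1.2 * node R l + a) N0 Ne kw kN.
  rewrite /wave /dot /coordinate /= => H.
  transitivity (\sum_(l0 < N) D1mx R N m l0 * cos (k.2 * node R l0 + (k.1.1 * node R j + k.1.2 * node R l + a))).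
    by apply: eq_bigr => q _; congr (_ * cos _); ring.
  by rewrite H; congr (_ * cos _); ring.
Qed.

(** Every frequency of the partial sum is below N / 2 in absolute value, since its
index is less than N - 1. *)
Lemma partial_mx_fourier_sum N r (u : pt R -> R) (U : jet R) w i : (0 < N)%N -> ~~ odd N ->
  (0 < r)%N -> Hp_jet r u U ->
  \sum_p partial_mx N w i p * fourier_sum N.-1 (U mi0) (grid_point R p) =
  fourier_sum N.-1 (U (mi1 w)) (grid_point R i).
Proof.
move=> N0 Ne r0 HU.
have iU : integrableO (U mi0) by apply: L2_integrableO; apply: Hp_jet_L2 HU _; rewrite mi_size0.
have step k : intvec k -> `|coordinate w k| < N%:R / 2 ->
    \sum_p partial_mx N w i p * mode (U mi0) k (grid_point R p) = mode (U (mi1 w)) k (grid_point R i).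
  move=> ik kN.
  transitivity (fcoef (U mi0) k 0 * (\sum_p partial_mx N w i p * wave k 0 (grid_point R p)) +
    fcoef (U mi0) k (pi / 2) * (\sum_p partial_mx N w i p * wave k (pi / 2) (grid_point R p))).
    rewrite !mulr_sumr -big_split/=; apply: eq_bigr => p _.
    by rewrite modeE//; ring.
  rewrite !partial_mx_wave// /mode (fcoef_jet (a := mi1 w) _ HU) ?mi_size1// kpow1 mul1r.
  rewrite (fcoef_phase _ (- _ - _) iU) /wave add0r.
  set d := dot k _; rewrite -opprD cosN sinN !cosDpihalf sinDpihalf !addrA.
  rewrite cosDpihalf sinDpihalf; ring.
rewrite /fourier_sum /freq_sum.
under eq_bigr => p _ do rewrite mulrCA.
rewrite -mulr_sumr; congr (_ * _).
under eq_bigr => p _ do rewrite mulr_sumr.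
rewrite exchange_big /=; apply: eq_big_nat => a /andP[_ aN].
under eq_bigr => p _ do rewrite mulr_sumr.
rewrite exchange_big /=; apply: eq_big_nat => b /andP[_ bN].
under eq_bigr => p _ do rewrite mulr_sumr.
rewrite exchange_big /=; apply: eq_big_nat => c /andP[_ cN].
apply: step; first exact: intvec_freqv.
have zN q : (q < N.-1)%N -> `|freq q : R| < N%:R / 2.
  move=> qN; rewrite norm_freq ltr_pdivlMr// -natrM ltr_nat uphalf_half muln2.
  have := odd_double_half q; move: qN; clear -N0; case: N N0 => //= n _ qn E.
  rewrite ltnS (leq_trans _ qn)// -[in leqRHS]E doubleD; case: (odd q) => //=.
by rewrite /coordinate; case: (I3_cases w) => -> /=; exact: zN.
Qed.

End GridOperators.

(** * The truncated solution and the discrete operators *)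

Section SemiDiscrete.
Context {R : realType}.
Implicit Types (k x y : pt R) (v w : 'I_3) (th T : R).

(** With n = N - 1 the partial sum contains exactly the frequencies |k_w| < N / 2,
those which the differentiation matrix treats exactly. *)
Definition trunc_field N (A : 'I_3 -> nat -> R -> jet R) i t : 'cV[R]_(vdim N) :=
  grid_field N (fun w => fourier_sum N.-1 (A w i t mi0)).

Lemma partial_mx_grid_values N r (u : pt R -> R) (U : jet R) w : (0 < N)%N -> ~~ odd N ->
  (0 < r)%N -> Hp_jet r u U ->
  partial_mx N w *m grid_values N (fourier_sum N.-1 (U mi0)) = grid_values N (fourier_sum N.-1 (U (mi1 w))).
Proof.
move=> N0 Ne r0 HU; apply/matrixP => i j; rewrite !mxE ord1 -(partial_mx_fourier_sum w i N0 Ne r0 HU).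
by apply: eq_bigr => p _; rewrite !mxE.
Qed.

Lemma fourier_sum_curl n r (c : R) (B : 'I_3 -> jet R) (u : 'I_3 -> pt R -> R) (f : pt R -> R) w x :
  (0 < r)%N -> c != 0 -> (forall v, Hp_jet r (u v) (B v)) ->
  (forall k th, intvec k -> fcoef f k th =
    c * (coordinate (w + 1) k * fcoef (B (w + 2) mi0) k (th - pi / 2) -
         coordinate (w + 2) k * fcoef (B (w + 1) mi0) k (th - pi / 2))) ->
  fourier_sum n (B (w + 2) (mi1 (w + 1))) x - fourier_sum n (B (w + 1) (mi1 (w + 2))) x = c^-1 * fourier_sum n f x.
Proof.
move=> r0 c0 HB Ff; rewrite /fourier_sum -mulrBr mulrCA; congr (_ * _).
have FE v v' k th : intvec k -> fcoef (B v (mi1 v')) k th = coordinate v' k * fcoef (B v mi0) k (th - pi / 2).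
  by move=> ik; rewrite (fcoef_jet th (HB v)) ?mi_size1// kpow1 mul1r.
rewrite /freq_sum -sumrB mulr_sumr; apply: eq_bigr => i _.
rewrite -sumrB mulr_sumr; apply: eq_bigr => j _.
rewrite -sumrB mulr_sumr; apply: eq_bigr => l _.
have ik := @intvec_freqv R i j l.
by rewrite /mode Ff// mulKf// !FE.
Qed.

(** The truncated solution solves the semi-discrete system without any residual:
the difference operators act exactly on it, and truncation commutes with the
equations because these hold coefficient by coefficient. *)
Lemma Dmx_trunc_field N n r (c T : R) (uA uB : 'I_3 -> R -> pt R -> R) A B i t :
  (0 < N)%N -> ~~ odd N -> 0 < T -> (0 < r)%N -> c != 0 ->
  (forall w, Ck_Hp n r T (uA w) (A w)) -> (forall w, Ck_Hp n r T (uB w) (B w)) ->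
  curl_law c T A B -> (i < n)%N -> 0 <= t <= T ->
  Dmx R N *m trunc_field N B i t = c^-1 *: trunc_field N A i.+1 t.
Proof.
move=> N0 Ne T0 r0 c0 CA CB AB i_n tT.
have HB v : Hp_jet r (B v i t mi0) (B v i t).
  by have [_ + _ _] := CB v; apply => //; exact: ltnW.
have D w v := partial_mx_grid_values w N0 Ne r0 (HB v).
have C w x := @fourier_sum_curl N.-1 r c (fun v => B v i t) _ (A w i.+1 t mi0) w x r0 c0 HB
  (fun k th => fcoef_curl_law T0 r0 CA CB AB w th i_n tT).
have [e1 e2 e3 [e4 e5 e6]] := I3_add.
have Dx0 v := D 0 v; have Dy0 v := D 1 v; have Dz0 v := D 2 v.
rewrite /partial_mx /= in Dx0 Dy0 Dz0.
rewrite /Dmx /trunc_field /grid_field !mul_col_mx !mul_row_col !mulNmx !mul0mx !Dx0 !Dy0 !Dz0.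
rewrite !scale_col_mx add0r addr0; congr (col_mx (col_mx _ _) _).
- apply/matrixP => p q; rewrite !mxE; have := C 0 (grid_point R p).
  by rewrite e1 e2 addrC.
- by apply/matrixP => p q; rewrite !mxE; have := C 1 (grid_point R p); rewrite e3 e4.
- by apply/matrixP => p q; rewrite !mxE addr0; have := C 2 (grid_point R p); rewrite e5 e6 addrC.
Qed.

Lemma D1mx_tr N : (D1mx R N)^T = - D1mx R N.
Proof.
apply/matrixP => i j; rewrite !mxE eq_sym; case: eqVneq => _; first by rewrite oppr0.
cbv zeta; rewrite [in LHS](_ : (node R j - node R i) / 2 = - ((node R i - node R j) / 2)); last by field.
by rewrite cosN sinN invrN !mulrN addnC.
Qed.

(** The blocks are antisymmetric, and so is their arrangement. *)
Lemma Dmx_tr N : (Dmx R N)^T = Dmx R N.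
Proof.
have hx : (Dx R N)^T = - Dx R N.
  by rewrite /Dx !trmx_tens !trmx1 D1mx_tr; apply/matrixP => p q; rewrite !mxE mulrN.
have hy : (Dy R N)^T = - Dy R N.
  by rewrite /Dy !trmx_tens !trmx1 D1mx_tr; apply/matrixP => p q; rewrite !mxE mulrN mulNr.
have hz : (Dz R N)^T = - Dz R N.
  by rewrite /Dz !trmx_tens !trmx1 D1mx_tr; apply/matrixP => p q; rewrite !mxE !mulNr.
have hx' p q : Dx R N q p = - Dx R N p q by have := congr1 (fun A : 'M[R]_(N * N * N) => A p q) hx; rewrite !mxE.
have hy' p q : Dy R N q p = - Dy R N p q by have := congr1 (fun A : 'M[R]_(N * N * N) => A p q) hy; rewrite !mxE.
have hz' p q : Dz R N q p = - Dz R N p q by have := congr1 (fun A : 'M[R]_(N * N * N) => A p q) hz; rewrite !mxE.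
have zT (p q : 'I_(N * N * N)) : (0 : 'M[R]_(N * N * N)) p q = 0 by rewrite mxE.
have oT (A : 'M[R]_(N * N * N)) p q : (- A) p q = - A p q by rewrite mxE.
apply/matrixP => p q; rewrite [LHS]mxE /Dmx.
by case: (split_ordP p) => p1 ->; case: (split_ordP q) => q1 ->;
  try (case: (split_ordP p1) => p2 ->); try (case: (split_ordP q1) => q2 ->);
  rewrite !(col_mxEu, col_mxEd, row_mxEl, row_mxEr, zT, oT) //
    ?hx' ?hy' ?hz' ?opprK.
Qed.

Lemma Dhat_tr N (c tau : R) : (Dhat N c tau)^T = Dhat N c tau.
Proof.
have E n : (Dmx R N ^+ n)^T = Dmx R N ^+ n.
  elim: n => [|n IH]; first by rewrite expr0 trmx1.
  by rewrite [in LHS]exprS [in RHS]exprSr -[Dmx R N * _]/(Dmx R N *m _) trmx_mul IH Dmx_tr.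
by rewrite /Dhat !linearD !linearZ /= !E Dmx_tr.
Qed.

(** Each application of the discrete curl can be traded for a time derivative,
alternating between the two fields; the powers of the wave speed gam in Dhat
compensate the constants c and c'. *)
Lemma Dhat_trunc_field N r (c c' gam tau T : R) (uA uB : 'I_3 -> R -> pt R -> R) A B t :
  (0 < N)%N -> ~~ odd N -> 0 < T -> (0 < r)%N -> c != 0 -> c' != 0 ->
  gam ^+ 2 = - (c * c') ->
  (forall w, Ck_Hp 7 r T (uA w) (A w)) -> (forall w, Ck_Hp 7 r T (uB w) (B w)) ->
  curl_law c T A B -> curl_law c' T B A -> 0 <= t <= T ->
  Dhat N gam tau *m trunc_field N B 0 t =
  c^-1 *: (trunc_field N A 1 t - (tau ^+ 2 / 12) *: trunc_field N A 3 t + (tau ^+ 4 / 120) *: trunc_field N A 5 t).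
Proof.
move=> N0 Ne T0 r0 c0 c'0 gamE CA CB AB BA tT.
have DB i : (i < 7)%N -> Dmx R N *m trunc_field N B i t = c^-1 *: trunc_field N A i.+1 t.
  by move=> i7; exact: Dmx_trunc_field CA CB AB i7 tT.
have DA i : (i < 7)%N -> Dmx R N *m trunc_field N A i t = c'^-1 *: trunc_field N B i.+1 t.
  by move=> i7; exact: Dmx_trunc_field CB CA BA i7 tT.
have ex n (v : 'cV[R]_(vdim N)) : Dmx R N ^+ n.+1 *m v = Dmx R N *m (Dmx R N ^+ n *m v).
  by rewrite exprS mulmxA.
have E1 : Dmx R N *m trunc_field N B 0 t = c^-1 *: trunc_field N A 1 t by exact: DB.
have E3 : Dmx R N ^+ 3 *m trunc_field N B 0 t = (c^-1 * c'^-1 * c^-1) *: trunc_field N A 3 t.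
  rewrite !ex expr0 mul1mx DB// -scalemxAr DA// -!scalemxAr DB// !scalerA.
  by congr (_ *: _); ring.
have E5 : Dmx R N ^+ 5 *m trunc_field N B 0 t = (c^-1 * c'^-1 * c^-1 * c'^-1 * c^-1) *: trunc_field N A 5 t.
  rewrite !ex expr0 mul1mx DB// -scalemxAr DA// -!scalemxAr DB// -!scalemxAr DA// -!scalemxAr DB// !scalerA.
  by congr (_ *: _); ring.
rewrite /Dhat !mulmxDl -!scalemxAl E1 E3 E5 scalerDr scalerBr !scalerA -scaleNr.
congr (_ + _ + _); congr (_ *: _).
  by rewrite gamE; field; rewrite c0 c'0.
have -> : gam ^+ 4 = (c * c') ^+ 2 by rewrite -[RHS]sqrrN -gamE -exprM.
by field; rewrite c0 c'0.
Qed.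

Lemma fourier_sum_deriv_on n r T (uV : R -> pt R -> R) V i x m : Ck_Hp n r T uV V -> (i < n)%N ->
  deriv_on T (fun t => fourier_sum m (V i t mi0) x) (fun t => fourier_sum m (V i.+1 t mi0) x).
Proof.
move=> CV i_n; rewrite /fourier_sum /freq_sum; apply: deriv_onZ.
by do 3!(apply: deriv_on_sum => ?); exact: Ck_deriv_on CV i_n.
Qed.

(** The expression inside the norm is a combination of Taylor remainders of f 0,
f 1, f 3, f 5 at a, of orders 7, 6, 4, 2: the coefficients 1/12 and 1/120 are
those for which all the terms of the Taylor polynomials cancel. *)
Lemma consistency T (f : nat -> R -> R) (K a tau : R) :
  (forall j, (j < 7)%N -> deriv_on T (f j) (f j.+1)) ->
  (forall t, 0 <= t <= T -> `|f 7 t| <= K) ->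
  0 <= a -> 0 <= tau -> a + tau <= T ->
  `|f 0%N (a + tau) - f 0%N a - tau / 2 *
     ((f 1%N (a + tau) - tau ^+ 2 / 12 * f 3%N (a + tau) + tau ^+ 4 / 120 * f 5%N (a + tau)) +
      (f 1%N a - tau ^+ 2 / 12 * f 3%N a + tau ^+ 4 / 120 * f 5%N a))| <= 2 * K * tau ^+ 7.
Proof.
move=> df fK a0 tau0 aT.
have at_ : a <= a + tau by rewrite lerDl.
have K0 : 0 <= K by apply: le_trans (fK a _) => //; rewrite a0 (le_trans at_).
have ta : a + tau - a = tau by rewrite addrC addKr.
have H0 := @deriv_on_taylor R T f K 7 0 a (a + tau) df fK a0 at_ aT.
have H1 := @deriv_on_taylor R T f K 6 1 a (a + tau) df fK a0 at_ aT.
have H3 := @deriv_on_taylor R T f K 4 3 a (a + tau) df fK a0 at_ aT.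
have H5 := @deriv_on_taylor R T f K 2 5 a (a + tau) df fK a0 at_ aT.
rewrite ta !big_ord_recr big_ord0 /= in H0 H1 H3 H5.
have [g0 g1 g2 [g3 g4 g5 g6]] : [/\ 0`! = 1, 1`! = 1, 2`! = 2 &
  [/\ 3`! = 6, 4`! = 24, 5`! = 120 & 6`! = 720]]%N by [].
rewrite ?big_ord0 !g0 !g1 !g2 !g3 !g4 !g5 !g6 ?add0r in H0.
rewrite ?big_ord0 !g0 !g1 !g2 !g3 !g4 !g5 ?add0r in H1.
rewrite ?big_ord0 !g0 !g1 !g2 !g3 ?add0r in H3.
rewrite ?big_ord0 !g0 !g1 ?add0r in H5.
rewrite /= in H0 H1 H3 H5.
set e0 := (X in `|X| <= _) in H0; set e1 := (X in `|X| <= _) in H1.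
set e3 := (X in `|X| <= _) in H3; set e5 := (X in `|X| <= _) in H5.
have -> : f 0%N (a + tau) - f 0%N a - tau / 2 *
     ((f 1%N (a + tau) - tau ^+ 2 / 12 * f 3%N (a + tau) + tau ^+ 4 / 120 * f 5%N (a + tau)) +
      (f 1%N a - tau ^+ 2 / 12 * f 3%N a + tau ^+ 4 / 120 * f 5%N a)) =
   e0 - tau / 2 * e1 + tau ^+ 3 / 24 * e3 - tau ^+ 5 / 240 * e5.
  rewrite /e0 /e1 /e3 /e5 /=.
  move: (f 0%N (a + tau)) (f 1%N (a + tau)) (f 3%N (a + tau)) (f 5%N (a + tau)).
  rewrite ?addnE /=.
  move: (f 0%N a) (f 1%N a) (f 2%N a) (f 3%N a) (f 4%N a) (f 5%N a) (f 6%N a).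
  by move=> x0 x1 x2 x3 x4 x5 x6 y0 y1 y3 y5; field.
have b1 : `|tau / 2 * e1| <= K * tau ^+ 7 / 2.
  rewrite normrM ger0_norm ?divr_ge0// (_ : K * tau ^+ 7 / 2 = tau / 2 * (K * tau ^+ 6)).
    by rewrite ler_wpM2l// divr_ge0.
  by field.
have b3 : `|tau ^+ 3 / 24 * e3| <= K * tau ^+ 7 / 24.
  have t3 : 0 <= tau ^+ 3 / 24 by rewrite divr_ge0// exprn_ge0.
  rewrite normrM ger0_norm// (_ : K * tau ^+ 7 / 24 = tau ^+ 3 / 24 * (K * tau ^+ 4)).
    by rewrite ler_wpM2l.
  by field.
have b5 : `|tau ^+ 5 / 240 * e5| <= K * tau ^+ 7 / 240.
  have t5 : 0 <= tau ^+ 5 / 240 by rewrite divr_ge0// exprn_ge0.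
  rewrite normrM ger0_norm// (_ : K * tau ^+ 7 / 240 = tau ^+ 5 / 240 * (K * tau ^+ 2)).
    by rewrite ler_wpM2l.
  by field.
have X0 : 0 <= K * tau ^+ 7 by rewrite mulr_ge0// exprn_ge0.
move: b1 b3 b5 H0; move: (tau / 2 * e1) (tau ^+ 3 / 24 * e3) (tau ^+ 5 / 240 * e5) e0.
move=> z1 z3 z5 z0 b1 b3 b5 b0.
apply: (le_trans (ler_normB _ _)); apply: (@le_trans _ _ (`|z0| + `|z1| + `|z3| + `|z5|)).
  rewrite lerD2r; apply: (le_trans (ler_normD _ _)); rewrite lerD2r.
  exact: ler_normB.
lra.
Qed.

End SemiDiscrete.

(** * Discrete energy and discrete norms *)

Section Energy.
Context {R : realType}.

Definition dotv m (u v : 'cV[R]_m) : R := \sum_i u i 0 * v i 0.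

Lemma dotvC m (u v : 'cV[R]_m) : dotv u v = dotv v u.
Proof. by apply: eq_bigr => i _; rewrite mulrC. Qed.

Lemma dotvDl m (u v x : 'cV[R]_m) : dotv (u + v) x = dotv u x + dotv v x.
Proof. by rewrite -big_split; apply: eq_bigr => i _; rewrite mxE mulrDl. Qed.

Lemma dotvZl m (c : R) (u x : 'cV[R]_m) : dotv (c *: u) x = c * dotv u x.
Proof. by rewrite mulr_sumr; apply: eq_bigr => i _; rewrite mxE mulrA. Qed.

Lemma dotvDr m (u v x : 'cV[R]_m) : dotv x (u + v) = dotv x u + dotv x v.
Proof. by rewrite dotvC dotvDl !(dotvC x). Qed.

Lemma dotvZr m (c : R) (u x : 'cV[R]_m) : dotv x (c *: u) = c * dotv x u.
Proof. by rewrite dotvC dotvZl (dotvC x). Qed.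

Lemma dotvNl m (u x : 'cV[R]_m) : dotv (- u) x = - dotv u x.
Proof. by rewrite -scaleN1r dotvZl mulN1r. Qed.

Lemma dotvNr m (u x : 'cV[R]_m) : dotv x (- u) = - dotv x u.
Proof. by rewrite dotvC dotvNl dotvC. Qed.

Lemma dotv_ge0 m (u : 'cV[R]_m) : 0 <= dotv u u.
Proof. by apply: sumr_ge0 => i _; rewrite -expr2 sqr_ge0. Qed.

Lemma dotv_sym m (D : 'M[R]_m) (u v : 'cV[R]_m) : D^T = D ->
  dotv (D *m u) v = dotv u (D *m v).
Proof.
move=> DT; have E (x y : 'cV[R]_m) : dotv x y = (x^T *m y) 0 0.
  by rewrite mxE; apply: eq_bigr => i _; rewrite mxE.
by rewrite !E trmx_mul DT mulmxA.
Qed.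

Lemma dotv_le m (u : 'cV[R]_m) (b : R) : 0 <= b -> (forall i, `|u i 0| <= b) ->
  dotv u u <= m%:R * b ^+ 2.
Proof.
move=> b0 ub; apply: (@le_trans _ _ (\sum_(i < m) b ^+ 2)).
  apply: ler_sum => i _; rewrite -expr2 -real_normK ?num_real//.
  by rewrite lerXn2r ?nnegrE.
by rewrite sumr_const card_ord mulr_natl.
Qed.

(** The discriminant form of the Cauchy-Schwarz inequality. *)
Lemma discriminant_le (A B c : R) : 0 <= A -> 0 <= B ->
  (forall l, 0 <= A + 2 * l * c + l ^+ 2 * B) -> c <= Num.sqrt A * Num.sqrt B.
Proof.
move=> A0 B0 H; have [Bp|] := ltrP 0 B; last first.
  move=> Bn; have -> : B = 0 by apply/eqP; rewrite eq_le Bn B0.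
  have B00 : B = 0 by apply/eqP; rewrite eq_le Bn B0.
  rewrite sqrtr0 mulr0 leNgt; apply/negP => c0.
  have := H (- (A + 1) / (2 * c)); rewrite B00 mulr0 addr0.
  have -> : 2 * (- (A + 1) / (2 * c)) * c = - (A + 1) by field; rewrite gt_eqF.
  lra.
have := H (- c / B).
have -> : A + 2 * (- c / B) * c + (- c / B) ^+ 2 * B = A - c ^+ 2 / B by field; rewrite gt_eqF.
rewrite subr_ge0 ler_pdivrMr// => h.
rewrite -sqrtrM//; have := ler_wsqrtr h; rewrite sqrtr_sqr.
by apply: le_trans; exact: ler_norm.
Qed.

(** Up to the volume of a grid cell, twice the discrete electromagnetic energy.  The
weights are the natural ones, mu on the magnetic and eps on the electric field. *)
Definition energy m (mu eps : R) (uH uE : 'cV[R]_m) : R := mu * dotv uH uH + eps * dotv uE uE.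

Lemma energy_ge0 m (mu eps : R) (uH uE : 'cV[R]_m) : 0 < mu -> 0 < eps ->
  0 <= energy mu eps uH uE.
Proof. by move=> m0 e0; rewrite addr_ge0// mulr_ge0 ?dotv_ge0 ?ltW. Qed.

Lemma energy_CS m (mu eps : R) (uH uE vH vE : 'cV[R]_m) : 0 < mu -> 0 < eps ->
  mu * dotv uH vH + eps * dotv uE vE <=
  Num.sqrt (energy mu eps uH uE) * Num.sqrt (energy mu eps vH vE).
Proof.
move=> m0 e0; apply: discriminant_le; [exact: energy_ge0|exact: energy_ge0|] => l.
have := energy_ge0 (uH + l *: vH) (uE + l *: vE) m0 e0.
rewrite /energy !(dotvDl, dotvDr, dotvZl, dotvZr) (dotvC vH) (dotvC vE).
by congr (0 <= _); ring.
Qed.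

(** Pair the two equations with the sums bH + aH and bE + aE.  By symmetry of D the
two terms that contain D cancel, so the energies differ only by the product of
the residuals with these sums, which the Cauchy-Schwarz inequality bounds by
d (qb + qa). *)
Lemma energy_step m (D : 'M[R]_m) (mu eps tau : R) (aH bH aE bE rH rE : 'cV[R]_m) :
  D^T = D -> 0 < mu -> 0 < eps ->
  mu *: (bH - aH) = - (tau / 2) *: (D *m (bE + aE)) + mu *: rH ->
  eps *: (bE - aE) = (tau / 2) *: (D *m (bH + aH)) + eps *: rE ->
  Num.sqrt (energy mu eps bH bE) <=
  Num.sqrt (energy mu eps aH aE) + Num.sqrt (energy mu eps rH rE).
Proof.
move=> DT m0 e0 EH EE.
set qb := Num.sqrt _; set qa := Num.sqrt _; set d := Num.sqrt _.
have qb2 : qb ^+ 2 = energy mu eps bH bE by rewrite sqr_sqrtr ?energy_ge0.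
have qa2 : qa ^+ 2 = energy mu eps aH aE by rewrite sqr_sqrtr ?energy_ge0.
have qb0 : 0 <= qb by exact: sqrtr_ge0.
have qa0 : 0 <= qa by exact: sqrtr_ge0.
have d0 : 0 <= d by exact: sqrtr_ge0.
have H1 : energy mu eps bH bE - energy mu eps aH aE =
   dotv (mu *: (bH - aH)) (bH + aH) + dotv (eps *: (bE - aE)) (bE + aE).
  rewrite /energy !dotvZl !(dotvDl, dotvDr, dotvNl, dotvNr).
  rewrite (dotvC aH bH) (dotvC aE bE); ring.
have H2 : energy mu eps bH bE - energy mu eps aH aE =
   (mu * dotv rH bH + eps * dotv rE bE) + (mu * dotv rH aH + eps * dotv rE aE).
  rewrite H1 EH EE !(dotvDl, dotvZl) (dotv_sym _ _ DT) (dotvC (bE + aE)).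
  rewrite !(dotvDr _ _ rH) !(dotvDr _ _ rE); ring.
have h1 := energy_CS rH rE bH bE m0 e0; have h2 := energy_CS rH rE aH aE m0 e0.
rewrite -/qb -/qa -/d in h1 h2.
have H3 : (qb - qa) * (qb + qa) <= d * (qb + qa).
  rewrite (_ : (qb - qa) * (qb + qa) = qb ^+ 2 - qa ^+ 2); last by ring.
  rewrite qb2 qa2 H2 mulrDr; lra.
(* If qb + qa = 0 both square roots vanish and there is nothing to divide by. *)
have [s0|s0] := ltrP 0 (qb + qa); last lra.
by move: H3; rewrite ler_pM2r// => H3; lra.
Qed.

Lemma grid_step3 N : (0 < N)%N -> grid_step R N ^+ 3 * (vdim N)%:R = 3 * (2 * pi) ^+ 3.
Proof.
move=> N0; have NR : N%:R != 0 :> R by rewrite pnatr_eq0 -lt0n.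
by rewrite /grid_step /vdim !natrD !natrM; field.
Qed.

Lemma normh_sq N (U : 'cV[R]_(vdim N)) : normh U ^+ 2 = grid_step R N ^+ 3 * dotv U U.
Proof.
have h0 : 0 <= grid_step R N ^+ 3.
  by rewrite exprn_ge0// divr_ge0// ltW// twopi_gt0.
rewrite /normh sqr_sqrtr; last first.
  by apply: mulr_ge0 => //; apply: sumr_ge0 => i _; exact: sqr_ge0.
by congr (_ * _); apply: eq_bigr => i _; rewrite real_normK ?num_real// expr2.
Qed.

Lemma normhD_sq N (U V : 'cV[R]_(vdim N)) :
  normh (U + V) ^+ 2 <= 2 * normh U ^+ 2 + 2 * normh V ^+ 2.
Proof.
rewrite !normh_sq [leRHS](_ : _ = grid_step R N ^+ 3 * (2 * dotv U U + 2 * dotv V V)); last by ring.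
apply: ler_wpM2l; first by rewrite exprn_ge0// divr_ge0// ltW// twopi_gt0.
have := dotv_ge0 (U - V).
rewrite !(dotvDl, dotvDr, dotvNl, dotvNr) (dotvC V U); lra.
Qed.

Lemma normh_le N (U : 'cV[R]_(vdim N)) (b : R) : (0 < N)%N -> 0 <= b ->
  (forall i, `|U i 0| <= b) -> normh U ^+ 2 <= 3 * (2 * pi) ^+ 3 * b ^+ 2.
Proof.
move=> N0 b0 Ub; rewrite normh_sq -(grid_step3 N0) -mulrA.
apply: ler_wpM2l; last exact: dotv_le.
by rewrite exprn_ge0// divr_ge0// ltW// twopi_gt0.
Qed.

Lemma grid_field_entry N (i : 'I_(vdim N)) : exists w (p : 'I_(N * N * N)),
  forall f : 'I_3 -> pt R -> R, grid_field N f i 0 = f w (grid_point R p).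
Proof.
rewrite /grid_field; case: (split_ordP i) => i1 ->; last first.
  by exists 2, i1 => f; rewrite col_mxEd mxE.
case: (split_ordP i1) => i2 ->.
  by exists 0, i2 => f; rewrite !col_mxEu mxE.
by exists 1, i2 => f; rewrite col_mxEu col_mxEd mxE.
Qed.

Lemma grid_point_Omega N (p : 'I_(N * N * N)) : (0 < N)%N -> Omega (grid_point R p).
Proof.
move=> N0; rewrite /grid_point; case: (mxtens_unindex p) => mk j.
case: (mxtens_unindex mk) => m k.
have h0 : 0 <= grid_step R N by rewrite divr_ge0// ltW// twopi_gt0.
have H (q : 'I_N) : 0 <= node R q <= 2 * pi.
  rewrite /node mulr_ge0//= -(@grid_stepN R N N0) ler_wpM2r// ler_nat; exact: ltnW.
by apply/OmegaP => w; case: (I3_cases w) => ->; exact: H.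
Qed.

End Energy.

(** * Uniform estimates for the truncated solution *)

Section FieldEstimates.
Context {R : realType}.
Local Notation Om := (@Omega R).
Implicit Types (k x y : pt R) (v w : 'I_3) (th T : R).

(** Only estimates that are monotone in the constant are used, so the sum of the
three constants serves all components. *)
Lemma common_bound3 (P : 'I_3 -> R -> Prop) :
  (forall w a b, a <= b -> P w a -> P w b) ->
  (forall w, exists2 a, 0 <= a & P w a) -> exists2 a, 0 <= a & forall w, P w a.
Proof.
move=> mono H; have [a0 p0 h0] := H 0; have [a1 p1 h1] := H 1; have [a2 p2 h2] := H 2.
exists (a0 + a1 + a2); first by rewrite !addr_ge0.
by move=> w; case: (I3_cases w) => ->; [apply: mono h0|apply: mono h1|apply: mono h2]; lra.
Qed.

Lemma half_uphalf_pred n : (0 < n)%N -> n./2 = uphalf n.-1.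
Proof. by case: n. Qed.

(** The two facts about one of the fields that the error analysis rests on: the
truncation error at every point, and a bound for the partial sums of the
seventh time derivative that is uniform in the number of terms. *)
Lemma field_estimates r (c c' T : R) (uA uB : 'I_3 -> R -> pt R -> R) A B :
  0 < T -> (6 <= r)%N -> c != 0 -> c' != 0 ->
  (forall w, Ck_Hp 7 r T (uA w) (A w)) -> (forall w, Ck_Hp 7 r T (uB w) (B w)) ->
  (forall t w, 0 <= t <= T -> {within Om, continuous (uA w t)}) ->
  curl_law c T A B -> curl_law c' T B A -> div_law T A ->
  exists2 K, 0 <= K & forall w,
    (forall N t x, (0 < N)%N -> ~~ odd N -> 0 <= t <= T -> Om x ->
       `|uA w t x - fourier_sum N.-1 (A w 0%N t mi0) x| <= K * N%:R ^- r) /\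
    (forall n t x, 0 <= t <= T -> `|fourier_sum n (A w 7 t mi0) x| <= K).
Proof.
move=> T0 r6 c0 c'0 CA CB cA AB BA dA.
have r0 : (0 < r)%N by exact: leq_trans r6.
apply: (@common_bound3 (fun w K =>
    (forall N t x, (0 < N)%N -> ~~ odd N -> 0 <= t <= T -> Om x ->
       `|uA w t x - fourier_sum N.-1 (A w 0%N t mi0) x| <= K * N%:R ^- r) /\
    (forall n t x, 0 <= t <= T -> `|fourier_sum n (A w 7 t mi0) x| <= K))) => [w a b ab [h1 h2]|w].
  split=> [N t x N0 Ne tT Ox|n t x tT].
    apply: (le_trans (h1 N t x N0 Ne tT Ox)).
    by rewrite ler_wpM2r// invr_ge0 exprn_ge0.
  exact: le_trans (h2 n t x tT) ab.
have [Bd HB] := Ck_coef_bounds (ltW T0) (CA w).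
have kap0 : c * c' != 0 by rewrite mulf_neq0.
have p3 : 0 <= (2 * pi : R) ^- 3 by rewrite invr_ge0 exprn_ge0// ltW// twopi_gt0.
have Bd0 : 0 <= Bd.
  have := HB 0%N 0 (freqv 0 0 0) 0 0 isT (@intvec_freqv R 0 0 0).
  rewrite lexx (ltW T0) => /(_ isT)[h _]; apply: le_trans h.
  by rewrite mulr_ge0 ?exprn_ge0.
pose K7 := (2 * pi : R) ^- 3 * (Bd * 9 ^+ 3).
(* The tail bound is in powers of N / 2, hence the factor 2^r. *)
pose K0 := (2 * pi : R) ^- 3 * (3 * (Bd * `|c * c'| ^- 3 * 9 ^+ 3)) * 2 ^+ r.
have K70 : 0 <= K7 by rewrite !mulr_ge0 ?exprn_ge0.
have q3 : 0 <= `|c * c'| ^- 3 by rewrite invr_ge0 exprn_ge0.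
have K00 : 0 <= K0.
  apply: mulr_ge0; last exact: exprn_ge0.
  by apply: mulr_ge0 => //; rewrite !mulr_ge0 ?exprn_ge0.
exists (K0 + K7); first exact: addr_ge0.
split=> [N t x N0 Ne tT Ox|n t x tT]; last first.
  apply: (@le_trans _ _ K7); last by rewrite lerDr.
  apply: (fourier_sum_bound _ _ r6) => m v k th mr ik.
  by have [] := HB m v k th t mr ik tT.
have NE : N = (N./2).*2 by rewrite -[LHS]odd_double_half (negbTE Ne).
have n20 : (0 < N./2)%N by move: N0; rewrite {1}NE double_gt0.
have n2E : N./2 = uphalf N.-1 by exact: half_uphalf_pred.
have iA0 : integrableO (A w 0%N t mi0) by exact: Ck_integrableO (CA w) (leq0n _) tT.
have tail m y : (N.-1 <= m)%N -> `|fourier_sum m (A w 0%N t mi0) y - fourier_sum N.-1 (A w 0%N t mi0) y| <= K0 * N%:R ^- r.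
  move=> nm.
  have := @fourier_sum_tail R r Bd (c * c') (A w 0%N t mi0) (A w 6 t mi0) N./2 N.-1 m y r0 kap0 n20 n2E.
  have NH : N%:R = 2 * (N./2)%:R :> R by rewrite [in LHS]NE -muln2 natrM mulrC.
  have E2 : 2 ^+ r * N%:R ^- r = (N./2)%:R ^- r :> R.
    by rewrite NH exprMn invfM mulrA mulfV ?mul1r// expf_neq0.
  rewrite [K0 * _](_ : _ = (2 * pi) ^- 3 * (3 * (Bd * `|c * c'| ^- 3 * 9 ^+ 3)) *
    (2 ^+ r * N%:R ^- r)); last by rewrite /K0 [RHS]mulrA.
  rewrite E2.
  apply=> //.
  - move=> k th ik.
    by rewrite !(fcoef_wave_law T0 r0 CA CB AB BA dA)//; ring.
  - move=> m' v k th mr ik; by have [] := HB m' v k th t mr ik tT.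
have ae0 : {ae vol R, forall y, Om y -> A w 0%N t mi0 y = uA w t y}.
  by have [+ _ _ _] := CA w => /(_ t tT)[].
apply: (le_trans (inversion iA0 ae0 (cA t w tT) tail Ox)).
by rewrite ler_wpM2r ?invr_ge0 ?exprn_ge0// lerDl.
Qed.

Lemma maxwell_laws (eps mu T : R) (E H : 'I_3 -> nat -> R -> jet R) :
  0 < eps -> 0 < mu -> maxwell eps mu T E H ->
  [/\ curl_law eps^-1 T E H, curl_law (- mu^-1) T H E, div_law T E & div_law T H].
Proof.
move=> e0 m0 MX.
split=> t tT; have H1 := MX t tT.
- by move=> w; apply: (ae_imply H1) => x Hx Ox; have [-> _ _ _] := Hx Ox.
- by move=> w; apply: (ae_imply H1) => x Hx Ox; have [_ -> _ _] := Hx Ox.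
- apply: (ae_imply H1) => x Hx Ox; have [_ _ + _] := Hx Ox.
  by rewrite -mulr_sumr => /eqP; rewrite mulf_eq0 gt_eqF//= => /eqP.
- apply: (ae_imply H1) => x Hx Ox; have [_ _ _ +] := Hx Ox.
  by rewrite -mulr_sumr => /eqP; rewrite mulf_eq0 gt_eqF//= => /eqP.
Qed.

(** The operator d_t - tau^2/12 d_t^3 + tau^4/120 d_t^5 applied to the truncated
field: the expansion of (2/tau) tanh (tau d_t / 2), whose use in place of d_t
makes the trapezoidal rule of order six. *)
Definition pade_sum N A (tau t : R) : 'cV[R]_(vdim N) :=
  trunc_field N A 1 t - (tau ^+ 2 / 12) *: trunc_field N A 3 t + (tau ^+ 4 / 120) *: trunc_field N A 5 t.

Lemma trunc_field_consistency N r (T K a tau : R) (uA : 'I_3 -> R -> pt R -> R) A i :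
  (forall w, Ck_Hp 7 r T (uA w) (A w)) ->
  (forall w n t x, 0 <= t <= T -> `|fourier_sum n (A w 7 t mi0) x| <= K) ->
  0 <= a -> 0 <= tau -> a + tau <= T ->
  `|(trunc_field N A 0 (a + tau) - trunc_field N A 0 a -
     (tau / 2) *: (pade_sum N A tau (a + tau) + pade_sum N A tau a)) i 0| <= 2 * K * tau ^+ 7.
Proof.
move=> CA K7 a0 t0 aT; have [w [p Hp]] := @grid_field_entry R N i.
have := @consistency R T (fun j t => fourier_sum N.-1 (A w j t mi0) (grid_point R p)) K a tau.
move=> /(_ (fun j j7 => fourier_sum_deriv_on (grid_point R p) N.-1 (CA w) j7))
  /(_ (fun t tT => K7 w N.-1 t (grid_point R p) tT) a0 t0 aT).
have HG j s : trunc_field N A j s i 0 = fourier_sum N.-1 (A w j s mi0) (grid_point R p) by exact: Hp.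
rewrite -!HG /pade_sum.
move: (trunc_field N A 0 (a + tau)) (trunc_field N A 1 (a + tau)) (trunc_field N A 3 (a + tau)) (trunc_field N A 5 (a + tau)).
move: (trunc_field N A 0 a) (trunc_field N A 1 a) (trunc_field N A 3 a) (trunc_field N A 5 a) => x0 x1 x3 x5 y0 y1 y3 y5.
by rewrite !mxE.
Qed.

End FieldEstimates.

(** * Error recursion and convergence *)

Section Assembly.
Context {R : realType}.

Lemma energy_le m (mu eps b : R) (uH uE : 'cV[R]_m) : 0 < mu -> 0 < eps -> 0 <= b ->
  (forall i, `|uH i 0| <= b) -> (forall i, `|uE i 0| <= b) ->
  Num.sqrt (energy mu eps uH uE) <= Num.sqrt ((mu + eps) * m%:R) * b.
Proof.
move=> m0 e0 b0 hH hE.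
have s0 : 0 <= (mu + eps) * m%:R by rewrite mulr_ge0// addr_ge0// ltW.
rewrite -[b in leRHS](ger0_norm b0) -sqrtr_sqr -sqrtrM//; apply: ler_wsqrtr.
have h1 := dotv_le b0 hH; have h2 := dotv_le b0 hE.
have := ler_wpM2l (ltW m0) h1; have := ler_wpM2l (ltW e0) h2.
rewrite /energy -mulrA mulrDl; lra.
Qed.

(** The error satisfies the equation of the scheme up to the defect of the truncated
solution G, g in the trapezoidal rule. *)
Lemma error_equation m (D : 'M[R]_m) (z z' c d : R)
    (G G' x x' y y' g g' s s' : 'cV[R]_m) :
  z *: (x' - x) = c *: (D *m (y' + y)) -> D *m g = z' *: s -> D *m g' = z' *: s' ->
  c * z' = z * d ->
  z *: (G' - x' - (G - x)) =
    c *: (D *m (g' - y' + (g - y))) + z *: (G' - G - d *: (s' + s)).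
Proof.
move=> E1 E2 E3 E4.
have -> : G' - x' - (G - x) = (G' - G) - (x' - x).
  by apply/matrixP => a b; rewrite !mxE; ring.
have -> : g' - y' + (g - y) = (g' + g) - (y' + y).
  by apply/matrixP => a b; rewrite !mxE; ring.
rewrite scalerBr E1 mulmxBr [D *m (g' + g)]mulmxDr E2 E3.
move: (D *m (y' + y)) => Y.
apply/matrixP => a b; rewrite !mxE.
have -> : c * (z' * s' a b + z' * s a b - Y a b) = (c * z') * (s' a b + s a b) - c * Y a b.
  by ring.
by rewrite E4; ring.
Qed.

(** The residual of each step has entries at most 2 K tau^7, so its energy norm is at
most sqrt ((mu + eps) dim) times that; the steps add up. *)
Lemma scheme_error N r (eps mu T tau K : R) (uE uH : 'I_3 -> R -> pt R -> R)
    (dE dH : 'I_3 -> nat -> R -> jet R) (Hn En : nat -> 'cV[R]_(vdim N)) (M : nat) :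
  (0 < N)%N -> ~~ odd N -> 0 < T -> (0 < r)%N -> 0 < eps -> 0 < mu -> 0 < tau ->
  M%:R * tau = T -> 0 <= K ->
  (forall w, Ck_Hp 7 r T (uE w) (dE w)) -> (forall w, Ck_Hp 7 r T (uH w) (dH w)) ->
  curl_law eps^-1 T dE dH -> curl_law (- mu^-1) T dH dE ->
  (forall w n t x, 0 <= t <= T -> `|fourier_sum n (dE w 7 t mi0) x| <= K) ->
  (forall w n t x, 0 <= t <= T -> `|fourier_sum n (dH w 7 t mi0) x| <= K) ->
  scheme eps mu tau Hn En ->
  forall q, (forall n, q n = Num.sqrt (energy mu eps
     (trunc_field N dH 0 (n%:R * tau) - Hn n) (trunc_field N dE 0 (n%:R * tau) - En n))) ->
  forall n, (n <= M)%N ->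
  q n <= q 0%N + n%:R * (Num.sqrt ((mu + eps) * (vdim N)%:R) * (2 * K * tau ^+ 7)).
Proof.
move=> N0 Ne T0 r0 e0 m0 tau0 MT K0 CE CH lE lH KE KH sch q qE n nM.
elim: n nM => [|n IH] nM; first by rewrite mul0r addr0.
have {}IH := IH (ltnW nM).
have tn j : (j <= M)%N -> 0 <= j%:R * tau <= T.
  by move=> jM; rewrite -MT mulr_ge0 ?(ltW tau0)//= ler_pM2r// ler_nat.
have e0' : eps^-1 != 0 by rewrite invr_eq0 gt_eqF.
have m0' : - mu^-1 != 0 by rewrite oppr_eq0 invr_eq0 gt_eqF.
set gam := (Num.sqrt (eps * mu))^-1.
have gam1 : gam ^+ 2 = - (eps^-1 * - mu^-1).
  by rewrite /gam exprVn sqr_sqrtr ?mulr_ge0 ?ltW// invfM mulrN opprK.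
have gam2 : gam ^+ 2 = - (- mu^-1 * eps^-1) by rewrite gam1 mulrC.
have DH j : (j <= M)%N -> Dhat N gam tau *m trunc_field N dH 0 (j%:R * tau) = eps *: pade_sum N dE tau (j%:R * tau).
  move=> jM; have := Dhat_trunc_field tau N0 Ne T0 r0 e0' m0' gam1 CE CH lE lH (tn j jM).
  by rewrite invrK.
have DE j : (j <= M)%N -> Dhat N gam tau *m trunc_field N dE 0 (j%:R * tau) = (- mu) *: pade_sum N dH tau (j%:R * tau).
  move=> jM; have := Dhat_trunc_field tau N0 Ne T0 r0 m0' e0' gam2 CH CE lH lE (tn j jM).
  by rewrite invrN invrK.
have [s1 s2] := sch n.
have tS : n.+1%:R * tau = n%:R * tau + tau by rewrite -natr1 mulrDl mul1r.
have /andP[ta0 _] := tn n (ltnW nM).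
have taT : n%:R * tau + tau <= T by rewrite -tS; have /andP[] := tn _ nM.
(* Defects of the truncated solution in the sixth-order trapezoidal rule. *)
pose rH := trunc_field N dH 0 (n.+1%:R * tau) - trunc_field N dH 0 (n%:R * tau) -
  (tau / 2) *: (pade_sum N dH tau (n.+1%:R * tau) + pade_sum N dH tau (n%:R * tau)).
pose rE := trunc_field N dE 0 (n.+1%:R * tau) - trunc_field N dE 0 (n%:R * tau) -
  (tau / 2) *: (pade_sum N dE tau (n.+1%:R * tau) + pade_sum N dE tau (n%:R * tau)).
have b0 : 0 <= 2 * K * tau ^+ 7.
  by apply: mulr_ge0; [exact: mulr_ge0|exact/exprn_ge0/ltW].
have bH i : `|rH i 0| <= 2 * K * tau ^+ 7.
  by rewrite /rH tS; exact: trunc_field_consistency CH KH ta0 (ltW tau0) taT.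
have bE i : `|rE i 0| <= 2 * K * tau ^+ 7.
  by rewrite /rE tS; exact: trunc_field_consistency CE KE ta0 (ltW tau0) taT.
have tt : tau * tau^-1 = 1 by rewrite mulfV// gt_eqF.
have cancel_tau (z : R) (X : 'cV[R]_(vdim N)) : z *: X = tau *: (z *: (tau^-1 *: X)).
  by rewrite !scalerA -mulrA mulrCA tt mulr1.
have s1' : mu *: (Hn n.+1 - Hn n) = - (tau / 2) *: (Dhat N gam tau *m (En n.+1 + En n)).
  by rewrite cancel_tau s1 -scalemxAr scalerN scalerA scaleNr.
have s2' : eps *: (En n.+1 - En n) = (tau / 2) *: (Dhat N gam tau *m (Hn n.+1 + Hn n)).
  by rewrite cancel_tau s2 -scalemxAr scalerA.
have dtr : (Dhat N gam tau)^T = Dhat N gam tau by exact: Dhat_tr.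
have := @energy_step R _ (Dhat N gam tau) mu eps tau
  (trunc_field N dH 0 (n%:R * tau) - Hn n) (trunc_field N dH 0 (n.+1%:R * tau) - Hn n.+1)
  (trunc_field N dE 0 (n%:R * tau) - En n) (trunc_field N dE 0 (n.+1%:R * tau) - En n.+1)
  rH rE dtr m0 e0.
have cH : - (tau / 2) * - mu = mu * (tau / 2) by rewrite mulrNN mulrC.
have cE : tau / 2 * eps = eps * (tau / 2) by rewrite mulrC.
have eqH := error_equation (trunc_field N dH 0 (n%:R * tau)) (trunc_field N dH 0 (n.+1%:R * tau))
  s1' (DE n (ltnW nM)) (DE n.+1 nM) cH.
have eqE := error_equation (trunc_field N dE 0 (n%:R * tau)) (trunc_field N dE 0 (n.+1%:R * tau))
  s2' (DH n (ltnW nM)) (DH n.+1 nM) cE.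
move=> /(_ eqH eqE) step.
have rb := energy_le m0 e0 b0 bH bE.
rewrite -!qE in step; apply: (le_trans step); apply: (le_trans (lerD IH rb)).
move: (Num.sqrt _ * (2 * K * tau ^+ 7)) => A.
by rewrite -natr1 mulrDl mul1r addrA.
Qed.

End Assembly.

Lemma subvE (R : realType) m (A B : 'cV[R]_m) i : (A - B) i 0 = A i 0 - B i 0.
Proof. by rewrite !mxE. Qed.

Lemma oppvE (R : realType) m (A : 'cV[R]_m) i : (- A) i 0 = - A i 0.
Proof. by rewrite mxE. Qed.

(** The error splits into the truncation error UH, UE, controlled pointwise, and the
scheme error VH, VE, controlled in energy.  The norm to be estimated has eps on
the magnetic and mu on the electric field, the reverse of the energy; passing
from one to the other costs the factor eps / mu + mu / eps. *)
Lemma weighted_error_le (R : realType) N (eps mu e q : R) (UH UE VH VE : 'cV[R]_(vdim N)) :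
  (0 < N)%N -> 0 < eps -> 0 < mu -> 0 <= e -> 0 <= q ->
  (forall i, `|UH i 0| <= e) -> (forall i, `|UE i 0| <= e) ->
  Num.sqrt (energy mu eps VH VE) <= Num.sqrt ((mu + eps) * (vdim N)%:R) * q ->
  eps * normh (UH + VH) ^+ 2 + mu * normh (UE + VE) ^+ 2 <=
  2 * (eps + mu) * (3 * (2 * pi) ^+ 3) * (1 + (eps / mu + mu / eps)) * (e + q) ^+ 2.
Proof.
move=> N0 e0 m0 ee0 q0 hH hE hq.
set W := 3 * (2 * pi) ^+ 3; set ka := eps / mu + mu / eps.
have W0 : 0 <= W by rewrite mulr_ge0// exprn_ge0// ltW// twopi_gt0.
have g0 : 0 <= grid_step R N ^+ 3 by rewrite exprn_ge0// divr_ge0// ltW// twopi_gt0.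
have nH := normhD_sq UH VH; have nE := normhD_sq UE VE.
have bH := normh_le N0 ee0 hH; have bE := normh_le N0 ee0 hE.
rewrite -/W in bH bE.
have en : grid_step R N ^+ 3 * energy mu eps VH VE <= (mu + eps) * W * q ^+ 2.
  have s0 : 0 <= (mu + eps) * (vdim N)%:R by rewrite mulr_ge0// addr_ge0// ltW.
  have : energy mu eps VH VE <= (mu + eps) * (vdim N)%:R * q ^+ 2.
    rewrite -(sqr_sqrtr (energy_ge0 VH VE m0 e0)) -(sqr_sqrtr s0) -exprMn.
    by rewrite lerXn2r ?nnegrE ?mulr_ge0 ?sqrtr_ge0.
  move=> /(ler_wpM2l g0) /le_trans; apply.
  by rewrite /W -(@grid_step3 R N N0) le_eqVlt; apply/orP; left; apply/eqP; ring.
have k1 : eps <= ka * mu.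
  rewrite /ka mulrDl divfK ?gt_eqF// lerDl mulr_ge0 ?divr_ge0// ltW//.
have k2 : mu <= ka * eps.
  rewrite /ka mulrDl divfK ?gt_eqF// lerDr mulr_ge0 ?divr_ge0// ltW//.
have ka0 : 0 <= ka by rewrite addr_ge0// divr_ge0// ltW.
have V2 : eps * normh VH ^+ 2 + mu * normh VE ^+ 2 <= ka * ((mu + eps) * W * q ^+ 2).
  apply: (@le_trans _ _ (ka * (grid_step R N ^+ 3 * energy mu eps VH VE))); last exact: ler_wpM2l.
  rewrite (_ : ka * _ = ka * mu * normh VH ^+ 2 + ka * eps * normh VE ^+ 2); last first.
    by rewrite !normh_sq /energy; ring.
  by apply: lerD; apply: ler_wpM2r; rewrite ?sqr_ge0.
have A1 : eps * normh (UH + VH) ^+ 2 <= eps * (2 * (W * e ^+ 2) + 2 * normh VH ^+ 2).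
  by apply: ler_wpM2l; [exact: ltW|lra].
have A2 : mu * normh (UE + VE) ^+ 2 <= mu * (2 * (W * e ^+ 2) + 2 * normh VE ^+ 2).
  by apply: ler_wpM2l; [exact: ltW|lra].
have S0 : 0 <= 2 * (eps + mu) * W.
  by apply: mulr_ge0 => //; apply: mulr_ge0 => //; apply: addr_ge0; exact: ltW.
apply: (le_trans (lerD A1 A2)).
apply: (@le_trans _ _ (2 * (eps + mu) * W * (e ^+ 2 + ka * q ^+ 2))).
  have -> : 2 * (eps + mu) * W * (e ^+ 2 + ka * q ^+ 2) =
    2 * (eps + mu) * (W * e ^+ 2) + 2 * (ka * ((mu + eps) * W * q ^+ 2)) by ring.
  have -> : eps * (2 * (W * e ^+ 2) + 2 * normh VH ^+ 2) + mu * (2 * (W * e ^+ 2) + 2 * normh VE ^+ 2) =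
    2 * (eps + mu) * (W * e ^+ 2) + 2 * (eps * normh VH ^+ 2 + mu * normh VE ^+ 2) by ring.
  by rewrite lerD2l ler_wpM2l.
rewrite -[leRHS]mulrA ler_wpM2l//.
have h1 : e ^+ 2 <= (e + q) ^+ 2 by rewrite lerXn2r ?nnegrE ?addr_ge0// lerDl.
have h2 : ka * q ^+ 2 <= ka * (e + q) ^+ 2.
  by rewrite ler_wpM2l// lerXn2r ?nnegrE ?addr_ge0// lerDr.
by rewrite [leRHS](_ : _ = (e + q) ^+ 2 + ka * (e + q) ^+ 2) ?lerD//; ring.
Qed.

Theorem theorem5p1 (R : realType) (eps mu T : R) (r : nat)
    (E H : R -> 'I_3 -> R * R * R -> R)
    (dE dH : 'I_3 -> nat -> R -> jet R)
    (heps : 0 < eps) (hmu : 0 < mu) (hT : 0 < T)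
    (hr : 10 / 2 < r%:R :> R)
    (hE : forall w, Ck_Hp 7 r T (fun t => E t w) (dE w))
    (hH : forall w, Ck_Hp 7 r T (fun t => H t w) (dH w))
    (hE0 : forall w, Hp r (E 0 w)) (hH0 : forall w, Hp r (H 0 w))
    (cE : forall t w, 0 <= t <= T -> {within @Omega R, continuous (E t w)})
    (cH : forall t w, 0 <= t <= T -> {within @Omega R, continuous (H t w)})
    (hmaxwell : maxwell eps mu T dE dH) :
  exists C : R, 0 < C /\
    forall (N M : nat), (0 < N)%N -> ~~ odd N -> (0 < M)%N ->
    let tau := T / M%:R in
    forall Hn En : nat -> 'cV[R]_(vdim N),
      Hn 0%N = grid_field N (H 0) -> En 0%N = grid_field N (E 0) ->
      scheme eps mu tau Hn En ->
      \big[Num.max/0]_(0 <= n < M.+1)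
        Num.sqrt
          (eps * normh (grid_field N (H (n%:R * tau)) - Hn n) ^+ 2
           + mu * normh (grid_field N (E (n%:R * tau)) - En n) ^+ 2)
      <= C * T * (tau ^+ 6 + N%:R ^- r).
Proof.
have r6 : (6 <= r)%N.
  by rewrite -(ltr_nat R); apply: le_lt_trans hr; lra.
have r0 : (0 < r)%N by exact: leq_trans r6.
have [lE lH dvE dvH] := maxwell_laws heps hmu hmaxwell.
have e0 : eps^-1 != 0 by rewrite invr_eq0 gt_eqF.
have m0 : - mu^-1 != 0 by rewrite oppr_eq0 invr_eq0 gt_eqF.
have [KE KE0 estE] := field_estimates hT r6 e0 m0 hE hH cE lE lH dvE.
have [KH KH0 estH] := field_estimates hT r6 m0 e0 hH hE cH lH lE dvH.
pose K := KE + KH.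
have K0 : 0 <= K by exact: addr_ge0.
(* S is the constant of weighted_error_le; the errors entering there add up to
   2 K N^-r + 2 K T tau^6, hence L.  The 1 added below only makes C positive, and
   the division by T undoes the factor T of the statement. *)
pose S := 2 * (eps + mu) * (3 * (2 * pi) ^+ 3) * (1 + (eps / mu + mu / eps)).
have S0 : 0 <= S.
  have x0 : 0 <= eps / mu by rewrite divr_ge0// ltW.
  have y0 : 0 <= mu / eps by rewrite divr_ge0// ltW.
  apply: mulr_ge0; last lra.
  apply: mulr_ge0; first by apply: mulr_ge0 => //; apply: addr_ge0; exact: ltW.
  by apply: mulr_ge0 => //; apply: exprn_ge0; exact/ltW/twopi_gt0.
pose L := 2 * K + 2 * K * T.
have L0 : 0 <= L by rewrite addr_ge0 ?mulr_ge0// ltW.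
have C0 : 0 <= Num.sqrt S * L by rewrite mulr_ge0// sqrtr_ge0.
exists ((Num.sqrt S * L + 1) / T); split; first by rewrite divr_gt0// ltr_wpDl.
move=> N M N0 Ne M0 tau Hn En Hn0 En0 sch.
have MR : 0 < M%:R :> R by rewrite ltr0n.
have tau0 : 0 < tau by rewrite divr_gt0.
have MT : M%:R * tau = T by rewrite /tau mulrC divfK// gt_eqF.
have T0 : T != 0 by rewrite gt_eqF.
rewrite divfK//.
set X := tau ^+ 6 + N%:R ^- r.
have Nr : 0 <= N%:R ^- r :> R by rewrite invr_ge0 exprn_ge0.
have t6 : 0 <= tau ^+ 6 by rewrite exprn_ge0// ltW.
have X0 : 0 <= X by exact: addr_ge0.
have tn n : (n <= M)%N -> 0 <= n%:R * tau <= T.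
  by move=> nM; rewrite -MT mulr_ge0 ?(ltW tau0)//= ler_pM2r// ler_nat.
pose e := K * N%:R ^- r.
have ee0 : 0 <= e by exact: mulr_ge0.
have dHe n i : (n <= M)%N -> `|(grid_field N (H (n%:R * tau)) - trunc_field N dH 0 (n%:R * tau)) i 0| <= e.
  move=> nM; have [w [p Hp]] := @grid_field_entry R N i.
  rewrite subvE /trunc_field !Hp.
  apply: (le_trans ((estH w).1 N _ _ N0 Ne (tn n nM) (grid_point_Omega p N0))).
  by rewrite ler_wpM2r// /K lerDr.
have dEe n i : (n <= M)%N -> `|(grid_field N (E (n%:R * tau)) - trunc_field N dE 0 (n%:R * tau)) i 0| <= e.
  move=> nM; have [w [p Hp]] := @grid_field_entry R N i.
  rewrite subvE /trunc_field !Hp.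
  apply: (le_trans ((estE w).1 N _ _ N0 Ne (tn n nM) (grid_point_Omega p N0))).
  by rewrite ler_wpM2r// /K lerDl.
have KE7 w n t x : 0 <= t <= T -> `|fourier_sum n (dE w 7 t mi0) x| <= K.
  by move=> tT; apply: (le_trans ((estE w).2 n t x tT)); rewrite /K lerDl.
have KH7 w n t x : 0 <= t <= T -> `|fourier_sum n (dH w 7 t mi0) x| <= K.
  by move=> tT; apply: (le_trans ((estH w).2 n t x tT)); rewrite /K lerDr.
pose q n := Num.sqrt (energy mu eps (trunc_field N dH 0 (n%:R * tau) - Hn n) (trunc_field N dE 0 (n%:R * tau) - En n)).
have qn n : (n <= M)%N -> q n <= Num.sqrt ((mu + eps) * (vdim N)%:R) * (e + 2 * K * T * tau ^+ 6).
  move=> nM.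
  have qS := scheme_error N0 Ne hT r0 heps hmu tau0 MT K0 hE hH lE lH KE7 KH7 sch
    (fun n => erefl (q n)) nM.
  have q0 : q 0%N <= Num.sqrt ((mu + eps) * (vdim N)%:R) * e.
    apply: energy_le => // i.
      have -> : trunc_field N dH 0 (0%:R * tau) - Hn 0%N = - (grid_field N (H (0%:R * tau)) - trunc_field N dH 0 (0%:R * tau)).
        by rewrite mul0r Hn0 opprB.
      by rewrite oppvE normrN; exact: dHe.
    have -> : trunc_field N dE 0 (0%:R * tau) - En 0%N = - (grid_field N (E (0%:R * tau)) - trunc_field N dE 0 (0%:R * tau)).
      by rewrite mul0r En0 opprB.
    by rewrite oppvE normrN; exact: dEe.
  apply: (le_trans qS); rewrite [leRHS]mulrDr; apply: lerD; first exact: q0.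
  (* One power of tau is absorbed in the elapsed time n tau <= T. *)
  have -> : n%:R * (Num.sqrt ((mu + eps) * (vdim N)%:R) * (2 * K * tau ^+ 7)) =
    Num.sqrt ((mu + eps) * (vdim N)%:R) * (2 * K * (n%:R * tau) * tau ^+ 6) by ring.
  apply: ler_wpM2l; first exact: sqrtr_ge0.
  apply: ler_wpM2r => //; apply: ler_wpM2l; first exact: mulr_ge0.
  by have /andP[] := tn n nM.
have g0 : 0 <= 2 * K * T * tau ^+ 6.
  by apply: mulr_ge0 => //; apply: mulr_ge0; [exact: mulr_ge0|exact: ltW].
have C1X : 0 <= (Num.sqrt S * L + 1) * X by rewrite mulr_ge0// addr_ge0.
rewrite big_seq; apply: (big_ind (fun z => z <= (Num.sqrt S * L + 1) * X)) => //.
  by move=> x y hx hy; rewrite ge_max hx.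
move=> n; rewrite mem_index_iota ltnS => /andP[_ nM].
have := @weighted_error_le R N eps mu e (e + 2 * K * T * tau ^+ 6)
  (grid_field N (H (n%:R * tau)) - trunc_field N dH 0 (n%:R * tau))
  (grid_field N (E (n%:R * tau)) - trunc_field N dE 0 (n%:R * tau))
  (trunc_field N dH 0 (n%:R * tau) - Hn n) (trunc_field N dE 0 (n%:R * tau) - En n)
  N0 heps hmu ee0 (addr_ge0 ee0 g0) (fun i => dHe n i nM) (fun i => dEe n i nM) (qn n nM).
rewrite -/S !addrA !subrK => hS.
apply: (@le_trans _ _ (Num.sqrt S * L * X)); last first.
  by rewrite ler_wpM2r// lerDl.
apply: (@le_trans _ _ (Num.sqrt (S * (e + e + 2 * K * T * tau ^+ 6) ^+ 2))).
  exact: ler_wsqrtr.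
rewrite sqrtrM// sqrtr_sqr ger0_norm; last by rewrite !addr_ge0.
rewrite -[leRHS]mulrA; apply: ler_wpM2l; first exact: sqrtr_ge0.
rewrite (_ : e + e + 2 * K * T * tau ^+ 6 = 2 * K * N%:R ^- r + 2 * K * T * tau ^+ 6); last first.
  by rewrite /e; ring.
rewrite /L [leRHS]mulrDl; apply: lerD.
  by rewrite ler_wpM2l ?mulr_ge0// /X lerDr.
by rewrite ler_wpM2l ?mulr_ge0 ?(ltW hT)// /X lerDl.
Qed.
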